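(* Let $\mathcal{P}_0\subset\mathcal{P}$ and $\mathcal{H}_0=\mathcal{P}_0\cap\mathcal{H}$. Suppose that there exist deterministic rate functions $g,h$ tending to zero as $n\to\infty$ and functions $\xi,\xi':[0,1]\times[0,1]^d\to\mathbb{R}$ such that (a) $\|F_{X\mid Z}-\hat F^{(n)}_{X\mid Z}\|_{\mathcal{T},\infty}\in\mathcal{O}_{\mathcal{P}_0}(g(n))$ and $\|F_{Y\mid Z}-\hat F^{(n)}_{Y\mid Z}\|'_{\mathcal{T},\infty}\in\mathcal{O}_{\mathcal{P}_0}(h(n))$; (b) $\|\xi-\hat F^{(n)}_{X\mid Z}\|_{\mathcal{T}^c,\infty}\in\mathcal{O}_{\mathcal{P}_0}(g(n))$ and $\|\xi'-\hat F^{(n)}_{Y\mid Z}\|'_{\mathcal{T}^c,\infty}\in\mathcal{O}_{\mathcal{P}_0}(h(n))$. Let $\hat\rho_n=\frac1n\sum_{i=1}^n\phi(\hat U_{1,i})\phi(\hat U_{2,i})^T$. Then: (i) If the rate functions satisfy $\sqrt n\,g(n)h(n)\to0$, then $\sqrt n\,\hat\rho_n\Rightarrow_{\mathcal{H}_0}\mathcal{N}(0,\Sigma\otimes\Sigma)$, where $\Sigma_{k,s}=\int_0^1\phi_k(u)\phi_s(u)\,\mathrm{d}u$ for $k,s=1,\dots,q$. (ii) $\hat\rho_n\to_{\mathcal{P}_0}\rho$, where $\rho=E_P(\phi(U_1)\phi(U_2)^T)$ (without any requirement on $\sqrt n\,g(n)h(n)$).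
   Context: $\mathcal{P}$ is the set of distributions of $(X,Y,Z)$ on $[0,1]^{2+d}$ ($X,Y\in[0,1]$, $Z\in[0,1]^d$) absolutely continuous with respect to Lebesgue measure; $\mathcal{H}\subset\mathcal{P}$ is the subset for which $X$ and $Y$ are conditionally independent given $Z$. Throughout, for every $z$ the conditional distributions of $X$ and of $Y$ given $Z=z$ are continuous. $F_{X\mid Z}(t\mid z)=P(X\le t\mid Z=z)$ and $Q_{X\mid Z}(\tau\mid z)=\inf\{t\in[0,1]:F_{X\mid Z}(t\mid z)\ge\tau\}$; similarly for $Y$. $U_1=F_{X\mid Z}(X\mid Z)$, $U_2=F_{Y\mid Z}(Y\mid Z)$. $(X_i,Y_i,Z_i)_{i=1}^n$ is an i.i.d. sample from $P$. An estimator $\hat F^{(n)}_{X\mid Z}$ is a mapping from the sample $(X_i,Z_i)_{i=1}^n$ to functions $\hat F^{(n)}_{X\mid Z}(\cdot\mid z):[0,1]\to[0,1]$ that for every $z\in[0,1]^d$ are continuous and increasing with value $0$ at $0$ and $1$ at $1$; similarly $\hat F^{(n)}_{Y\mid Z}$ is such a mapping from $(Y_i,Z_i)_{i=1}^n$. Put $\hat U_{1,i}=\hat F^{(n)}_{X\mid Z}(X_i\mid Z_i)$ and $\hat U_{2,i}=\hat F^{(n)}_{Y\mid Z}(Y_i\mid Z_i)$. The function $\phi=(\phi_1,\dots,\phi_q):[0,1]\to\mathbb{R}^q$ satisfies: each $\phi_k$ has support $\mathcal{T}_k$ that is a compact subset of $(0,1)$; each $\phi_k$ is Lipschitz continuous;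 $\int_0^1\phi_k(u)\,\mathrm{d}u=0$ and $\int_0^1\phi_k(u)^2\,\mathrm{d}u=1$; $\phi_1,\dots,\phi_q$ are linearly independent. $\tau_{\min}=\inf(\mathcal{T}_1\cup\dots\cup\mathcal{T}_q)$, $\tau_{\max}=\sup(\mathcal{T}_1\cup\dots\cup\mathcal{T}_q)$, $\mathcal{T}=[\tau_{\min},\tau_{\max}]$. $\|f\|_{\mathcal{T},\infty}=\sup_{z\in[0,1]^d}\sup_{t\in Q_{X\mid Z}(\mathcal{T}\mid z)}|f(t,z)|$ with $Q_{X\mid Z}(\mathcal{T}\mid z)=[Q_{X\mid Z}(\tau_{\min}\mid z),Q_{X\mid Z}(\tau_{\max}\mid z)]$, and $\|f\|_{\mathcal{T}^c,\infty}$ is the same with the inner supremum over the complement $[0,1]\setminus Q_{X\mid Z}(\mathcal{T}\mid z)$. $\|\cdot\|'_{\mathcal{T},\infty}$ and $\|\cdot\|'_{\mathcal{T}^c,\infty}$ are defined in the same way with $Q_{Y\mid Z}$ in place of $Q_{X\mid Z}$. For a set $\mathcal{M}$ of distributions: $X_n\in\mathcal{O}_{\mathcal{M}}(a_n)$ ($a_n$ nonzero) means for every $\epsilon>0$ there is $M>0$ with $\sup_n\sup_{P\in\mathcal{M}}P(|X_n/a_n|>M)<\epsilon$. $X_n\to_{\mathcal{M}}X$ means $\sup_{P\in\mathcal{M}}P(|X_n-X|>\epsilon)\to0$ for every $\epsilon>0$ (entrywise for matrices; the limit $\rho$ depends on $P$). $X_n\Rightarrow_{\mathcal{M}}X$ means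 $\sup_{P\in\mathcal{M}}|E_P(f(X_n))-E_P(f(X))|\to0$ for all bounded continuous real-valued $f$. $\mathcal{N}(0,\Sigma\otimes\Sigma)$ on $\mathbb{R}^{q\times q}$ is the centered Gaussian law in which the covariance of entries $(k,\ell)$ and $(s,t)$ is $\Sigma_{ks}\Sigma_{\ell t}$. *)

(* Defs.v *)
From HB Require Import structures.
From mathcomp Require Import all_boot all_order all_algebra.
From mathcomp Require Import all_classical all_reals all_analysis.

Set Implicit Arguments.
Unset Strict Implicit.
Unset Printing Implicit Defensive.

Import Order.TTheory GRing.Theory Num.Theory.
Import numFieldNormedType.Exports.

Local Open Scope classical_set_scope.
Local Open Scope ring_scope.

Section product_of_copies.
Local Open Scope ereal_scope.

Definition tuple_cons {dT} {T : measurableType dT} (n : nat)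
  (p : T * n.-tuple T) : n.+1.-tuple T := [tuple of p.1 :: p.2].

Lemma measurable_tuple_cons dT (T : measurableType dT) (n : nat) :
  measurable_fun setT (@tuple_cons dT T n).
Proof. exact: measurable_cons measurable_fst measurable_snd. Qed.

HB.instance Definition _ dT (T : measurableType dT) (n : nat) :=
  isMeasurableFun.Build _ _ _ _ (@tuple_cons dT T n)
    (@measurable_tuple_cons dT T n).

(* The n-fold product of P: the law of an i.i.d. sample of size n from P. *)
Fixpoint iid_law {dT} {T : measurableType dT} {R : realType}
    (P : probability T R) (n : nat) : probability (n.-tuple T) R :=
  match n with
  | 0 => \d_ [tuple]
  | m.+1 => distribution (P \x iid_law P m) (@tuple_cons dT T m)
  end.

(* Lebesgue measure on R^n; the image under [tuple_cons] is written through
   its measure structure because the latter takes the measurability proof. *)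
Fixpoint lebesgue_tuple (R : realType) (n : nat) :
    {measure set (n.-tuple R) -> \bar R} :=
  match n with
  | 0 => \d_ [tuple]
  | m.+1 => measure_function_pushforward__canonical__measure_function_Measure
              (lebesgue_measure \x^ lebesgue_tuple R m)
              (@measurable_tuple_cons _ R m)
  end.

End product_of_copies.

(* A point of R^{2+d} is w = (x, y, z) with x = w.1.1, y = w.1.2, z = w.2. *)
Notation obs R d := (R * R * d.-tuple R)%type.

Section model.
Context (R : realType) (d : nat).
Implicit Types (P : probability (obs R d) R).

Definition cube : set (d.-tuple R) :=
  [set z | forall i, tnth z i \in `[0, 1]].

Definition unit_obs : set (obs R d) :=
  [set w | [/\ w.1.1 \in `[0, 1], w.1.2 \in `[0, 1] & cube w.2]].

Definition lebesgue_obs : set (obs R d) -> \bar R :=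
  ((lebesgue_measure \x lebesgue_measure) \x^ lebesgue_tuple R d)%E.

(* Distributions on [0,1]^{2+d} are probabilities on R^{2+d} that give the
   cube mass one. *)
Definition abs_cont_laws : set (probability (obs R d) R) :=
  [set P | P unit_obs = 1%E /\ P `<< lebesgue_obs].

(* p is a version of P(E | Z = .) *)
Definition cond_prob_version P (E : set (obs R d)) (p : d.-tuple R -> R) :=
  [/\ measurable_fun setT p,
      P.-integrable setT (fun w => (p w.2)%:E) &
      forall C, measurable C ->
        \int[P]_(w in snd @^-1` C) (p w.2)%:E = P (E `&` snd @^-1` C)]%E.

(* P(X in A, Y in B | Z) = P(X in A | Z) P(Y in B | Z) a.s. *)
Definition cond_indep_laws : set (probability (obs R d) R) :=
  [set P | forall A B : set R, measurable A -> measurable B ->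
    forall p q : d.-tuple R -> R,
      cond_prob_version P [set w | A w.1.1] p ->
      cond_prob_version P [set w | B w.1.2] q ->
      cond_prob_version P [set w | A w.1.1 /\ B w.1.2] (p \* q)].

Definition cond_cdf (k : R.-pker (d.-tuple R) ~> R) (t : R) (z : d.-tuple R) :=
  fine (k z `]-oo, t]%classic).

Definition cond_quantile (k : R.-pker (d.-tuple R) ~> R) (tau : R)
    (z : d.-tuple R) : R :=
  inf [set t | t \in `[0, 1] /\ tau <= cond_cdf k t z].

(* k is a regular version of the conditional distribution of V given Z which,
   for every z in the cube, lives on [0,1] and is continuous. *)
Definition cond_dist P (V : obs R d -> R) (k : R.-pker (d.-tuple R) ~> R) :=
  (forall A, measurable A ->
     cond_prob_version P (V @^-1` A) (fun z => fine (k z A))) /\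
  (forall z, cube z ->
     k z `[0, 1]%classic = 1%E /\ continuous (fun t => cond_cdf k t z)).

(* An estimator of a conditional distribution function: F n s t z is the value
   of \hat F^{(n)}(t | z) computed from the sample s.  Only samples and
   arguments in the unit cube matter, and the only measurability asked for is
   that the transformed observations are random variables. *)
Definition estimator
    (F : forall n, n.-tuple (R * d.-tuple R) -> R -> d.-tuple R -> R) :=
  (forall n (s : n.-tuple (R * d.-tuple R)),
     (forall i, (tnth s i).1 \in `[0, 1] /\ cube (tnth s i).2) ->
     forall z, cube z ->
     [/\ {within `[0, 1], continuous (fun t => F n s t z)},
         {in `[0, 1] &, {homo (fun t => F n s t z) : t u / t <= u}},
         F n s 0 z = 0 & F n s 1 z = 1]) /\
  (forall n (i : 'I_n),
     measurable_fun setT (fun s : n.-tuple (R * d.-tuple R) =>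
       F n s (tnth s i).1 (tnth s i).2)).

Definition xz_sample n (s : n.-tuple (obs R d)) : n.-tuple (R * d.-tuple R) :=
  [tuple of map (fun w => (w.1.1, w.2)) s].

Definition yz_sample n (s : n.-tuple (obs R d)) : n.-tuple (R * d.-tuple R) :=
  [tuple of map (fun w => (w.1.2, w.2)) s].

(* sup_{z in [0,1]^d} sup_{t in D z} |f t z|, possibly +oo *)
Definition sup_norm_on (D : d.-tuple R -> set R) (f : R -> d.-tuple R -> R) :
    \bar R :=
  ereal_sup [set ereal_sup [set `|f t z|%:E | t in D z] | z in cube].

Definition quantile_range (k : R.-pker (d.-tuple R) ~> R) (tmin tmax : R)
    (z : d.-tuple R) : set R :=
  `[cond_quantile k tmin z, cond_quantile k tmax z]%classic.

Definition quantile_range_compl (k : R.-pker (d.-tuple R) ~> R)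
    (tmin tmax : R) (z : d.-tuple R) : set R :=
  `[0, 1]%classic `\` quantile_range k tmin tmax z.

End model.

Section score_functions.
Context (R : realType) (q : nat).
Implicit Types (phi : 'I_q -> R -> R).

(* phi is a function on [0,1]; having support in (0,1), it is identified with
   its extension by zero to R. *)
Definition score_support phi (k : 'I_q) : set R :=
  closure [set u | phi k u != 0].

Definition score_functions phi :=
  [/\ forall k, compact (score_support phi k) /\
        score_support phi k `<=` `]0, 1[%classic,
      forall k, [lipschitz phi k u | u in (`[0, 1] : set R)],
      forall k, \int[lebesgue_measure]_(u in `[0, 1]) phi k u = 0,
      forall k, \int[lebesgue_measure]_(u in `[0, 1]) (phi k u ^+ 2) = 1 &
      forall c : 'I_q -> R,
        (forall u : R, u \in `[0, 1] -> \sum_k c k * phi k u = 0) ->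
        forall k, c k = 0].

Definition tau_min phi : R := inf (\bigcup_k score_support phi k).
Definition tau_max phi : R := sup (\bigcup_k score_support phi k).

Definition score_cov phi (k s : 'I_q) : R :=
  \int[lebesgue_measure]_(u in `[0, 1]) (phi k u * phi s u).

End score_functions.

Section statistics.
Context (R : realType) (d q : nat).

Definition rho_hat
    (FX FY : forall n, n.-tuple (R * d.-tuple R) -> R -> d.-tuple R -> R)
    (phi : 'I_q -> R -> R) n (s : n.-tuple (obs R d)) : 'M[R]_q :=
  \matrix_(k, l) (n%:R^-1 * \sum_(i < n)
     phi k (FX n (xz_sample s) (tnth s i).1.1 (tnth s i).2) *
     phi l (FY n (yz_sample s) (tnth s i).1.2 (tnth s i).2)).

Definition rho (kX kY : R.-pker (d.-tuple R) ~> R) (phi : 'I_q -> R -> R)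
    (P : probability (obs R d) R) : 'M[R]_q :=
  \matrix_(k, l) \int[P]_w
    (phi k (cond_cdf kX w.1.1 w.2) * phi l (cond_cdf kY w.1.2 w.2)).

End statistics.

Section uniform_convergence.
Context (R : realType) (d : nat).
Implicit Types (M : set (probability (obs R d) R)).

(* Supremum in [0,+oo]; the supremum of the empty set is 0. *)
Definition nng_sup (A : set (\bar R)) : \bar R := ereal_sup (0%E |` A).

(* X_n in O_M(a_n).  The outer measure of the law of the sample is used
   because X_n may be a supremum over an uncountable set. *)
Definition unif_bigO M
    (X : probability (obs R d) R -> forall n, n.-tuple (obs R d) -> \bar R)
    (a : nat -> R) :=
  (forall n, (0 < n)%N -> a n != 0) /\
  forall eps : R, 0 < eps -> exists2 B : R, 0 < B &
    (nng_sup [set nng_sup [set ((iid_law P n)^*)%mu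
                         [set s | B%:E < `|X P n s * ((a n)^-1)%:E|]
                    | P in M] | n in [set n | (0 < n)%N]] < eps%:E)%E.

(* X_n ->_M X, entrywise *)
Definition unif_cvg_prob q M
    (X : forall n, n.-tuple (obs R d) -> 'M[R]_q)
    (X0 : probability (obs R d) R -> 'M[R]_q) :=
  forall (k l : 'I_q) (eps : R), 0 < eps ->
    nng_sup [set ((iid_law P n)^*)%mu [set s | eps < `|X n s k l - X0 P k l|]
         | P in M] @[n --> \oo] --> 0%E.

Definition borel_mx q := g_sigma_algebraType (@open 'M[R]_q).

(* X_n =>_M nu for a Borel probability nu on q x q matrices *)
Definition unif_cvg_law q M
    (X : forall n, n.-tuple (obs R d) -> 'M[R]_q)
    (nu : probability (borel_mx q) R) :=
  forall f : 'M[R]_q -> R, continuous f ->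
    (exists B : R, forall x, `|f x| <= B) ->
    nng_sup [set `| \int[iid_law P n]_s (f (X n s))%:E - \int[nu]_x (f x)%:E |%E
         | P in M] @[n --> \oo] --> 0%E.

End uniform_convergence.

Section gaussian.
Context (R : realType) (q : nat).

(* [normal_prob m 0] is not the degenerate normal law at m. *)
Definition normal_law (m s : R) (A : set R) : \bar R :=
  if s == 0 then \d_m A else normal_prob m s A.

Definition mx_entry (k l : 'I_q) (x : borel_mx R q) : R := (x : 'M[R]_q) k l.

(* nu is the centered Gaussian law on q x q matrices for which the covariance
   of the entries (k, l) and (s, t) is C k l s t. *)
Definition centered_gaussian (nu : probability (borel_mx R q) R)
    (C : 'I_q -> 'I_q -> 'I_q -> 'I_q -> R) :=
  [/\ forall a : 'I_q -> 'I_q -> R, exists m s : R,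
        forall A, measurable A ->
          nu [set x | A (\sum_k \sum_l a k l * mx_entry k l x)] =
          normal_law m s A,
      forall k l, ('E_nu[mx_entry k l] = 0)%E &
      forall k l s t,
        covariance nu (mx_entry k l) (mx_entry s t) = (C k l s t)%:E].

End gaussian.

(* Main.v *)
Require Import Defs.
From HB Require Import structures.
From mathcomp Require Import all_boot all_order all_algebra.
From mathcomp Require Import all_classical all_reals all_analysis.
From mathcomp Require Import measurable_realfun.
From mathcomp Require Import ring lra.

Set Implicit Arguments.
Unset Strict Implicit.
Unset Printing Implicit Defensive.

Import Order.TTheory GRing.Theory Num.Theory.
Import numFieldNormedType.Exports.

Local Open Scope classical_set_scope.
Local Open Scope ring_scope.


(** The statistic is compared with its oracle version, the average of
    phi(U1) phi(U2)^T computed from the true conditional ranks.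

    Estimation errors. Since phi is Lipschitz, replacing a true rank by an
    estimated one changes a score by at most a constant times the error of the
    estimated conditional distribution function, as long as the observation
    lies between the two quantiles of the range T. Beyond them the true score
    is zero, and monotonicity of the estimator keeps the estimated rank within
    the error at the nearest quantile of the region where phi vanishes
    ([plug_in_score]). So the errors of all scores are uniformly of the order
    of g(n), respectively h(n), up to a small probability
    ([large_err_prob]).

    Consistency then follows from Chebyshev's inequality for the oracle
    average.

    For normality, the difference between sqrt n rho_hat and the normalised
    oracle sum is made of three terms. The product of the two errors is of the
    order of sqrt n g(n) h(n). The two others are linear in one error, for
    instance the sum of the errors in X times phi(U2). Under conditional
    independence U2 is uniform and independent of (X, Z)
    ([Ex_cond_indep_gen]), while the errors in X are functions of the sample
    of (X, Z). Given that sample the summands are centred and uncorrelated,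
    and the second moment of the sum is n times that of a single error
    ([cross_term_sqr]); after normalisation it tends to zero.

    The oracle summands are bounded and centred, with covariance
    Sigma (x) Sigma whatever the law. Their central limit theorem must be
    uniform over the laws, which rules out soft arguments for a fixed law.
    Lindeberg's replacement argument is uniform by nature: for a test function
    with a third-order expansion with uniform constants ([smooth3]), replacing
    one summand by a Gaussian matrix costs a constant times n^(-3/2)
    ([lindeberg_telescope]). Of the Gaussian law it uses only its stability
    ([Ex_gmx_rotation]) and its moments of order at most three. A bounded
    continuous function is reduced to such test functions on a large ball by
    Bernstein polynomials in the bounded coordinates t / (1 + t^2)
    ([smooth3_approx]), and Chebyshev's inequality takes care of the outside
    of the ball ([uniform_clt]). The Gaussian matrix itself is A G A^T, where
    Sigma = A A^T ([score_cov_factor]) and G has independent standard normal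
    entries. *)

(** * Expectations of bounded measurable functions *)

Section bounded_measurable.
Context {R : realType}.

(** Such functions are integrable for every probability, so that linearity of
    the expectation and Fubini's theorem hold without further conditions. *)
Definition bmf d (T : measurableType d) (f : T -> R) :=
  measurable_fun setT f /\ exists B, forall x, `|f x| <= B.

Section closure.
Context d (T : measurableType d).
Implicit Types f g : T -> R.

Lemma bmf_meas f : bmf f -> measurable_fun setT f.
Proof. by case. Qed.

Lemma bmf_cst (c : R) : bmf (fun _ : T => c).
Proof. by split; [exact: measurable_cst|exists `|c|]. Qed.

Lemma bmfD f g : bmf f -> bmf g -> bmf (fun x => f x + g x).
Proof.
move=> [mf [B Bf]] [mg [C Cg]]; split; first exact: measurable_funD.
by exists (B + C) => x; rewrite (le_trans (ler_normD _ _))// lerD.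
Qed.

Lemma bmfM f g : bmf f -> bmf g -> bmf (fun x => f x * g x).
Proof.
move=> [mf [B Bf]] [mg [C Cg]]; split; first exact: measurable_funM.
by exists (B * C) => x; rewrite normrM ler_pM.
Qed.

Lemma bmfN f : bmf f -> bmf (fun x => - f x).
Proof.
move=> [mf [B Bf]]; split; first by apply: measurableT_comp mf.
by exists B => x; rewrite normrN.
Qed.

Lemma bmfB f g : bmf f -> bmf g -> bmf (fun x => f x - g x).
Proof. by move=> bf bg; apply: bmfD => //; exact: bmfN. Qed.

Lemma bmfZ (c : R) f : bmf f -> bmf (fun x => c * f x).
Proof. by move=> bf; apply: bmfM => //; exact: bmf_cst. Qed.

Lemma bmf_norm f : bmf f -> bmf (fun x => `|f x|).
Proof.
move=> [mf [B Bf]]; split; first by apply: measurableT_comp mf.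
by exists B => x; rewrite normr_id.
Qed.

Lemma bmf_sum (I : Type) (r : seq I) (Q : pred I) (f : I -> T -> R) :
  (forall i, bmf (f i)) -> bmf (fun x => \sum_(i <- r | Q i) f i x).
Proof.
move=> bf; elim: r => [|i r IH].
  by rewrite (_ : (fun x => _) = fun=> 0);
    [exact: bmf_cst|apply/funext => x; rewrite big_nil].
rewrite (_ : (fun x => _) = fun x => (if Q i then f i x else 0) +
   \sum_(i <- r | Q i) f i x).
  by apply: bmfD => //; case: (Q i); [exact: bf|exact: bmf_cst].
by apply/funext => x; rewrite big_cons; case: (Q i); rewrite ?add0r.
Qed.

Lemma bmf_exp f n : bmf f -> bmf (fun x => f x ^+ n).
Proof.
move=> bf; elim: n => [|n IH].
  by under eq_fun do rewrite expr0; exact: bmf_cst.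
by under eq_fun do rewrite exprS; exact: bmfM.
Qed.

Lemma bmf_indic (A : set T) : measurable A -> bmf (\1_A : T -> R).
Proof.
move=> mA; split; first exact: measurable_indic.
by exists 1 => x; rewrite indicE; case: (_ \in _); rewrite ?normr1 ?normr0.
Qed.

Lemma bmf_comp d' (T' : measurableType d') (h : T' -> T) f :
  measurable_fun setT h -> bmf f -> bmf (fun x => f (h x)).
Proof.
move=> mh [mf [B Bf]]; split; first exact: measurableT_comp mf mh.
by exists B.
Qed.

End closure.

Lemma measurable_gt d (T : measurableType d) (f : T -> R) (c : R) :
  measurable_fun setT f -> measurable [set x | c < f x].
Proof.
move=> mf; rewrite (_ : [set x | _] = setT `&` f @^-1` `]c, +oo[%classic); first exact: mf.
by rewrite setTI; apply/seteqP; split => x; rewrite /= in_itv/= andbT.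
Qed.

Lemma measurable_tail d (T : measurableType d) (f : T -> R) (c : R) :
  bmf f -> measurable [set x | c < `|f x|].
Proof. by move=> bf; apply: measurable_gt; exact: bmf_meas (bmf_norm bf). Qed.

Section expectation.
Context d (T : measurableType d) (P : probability T R).
Implicit Types f g : T -> R.

Lemma bmf_integrable f : bmf f -> P.-integrable setT (EFin \o f).
Proof.
move=> [mf [B Bf]]; apply: measurable_bounded_integrable => //.
  by apply: le_lt_trans (probability_le1 P measurableT) _; rewrite ltry.
by exists B; split; rewrite ?num_real// => M /ltW BM x _; exact: le_trans BM.
Qed.

Lemma EFin_Ex f : P.-integrable setT (EFin \o f) ->
  (\int[P]_x f x)%:E = (\int[P]_x (f x)%:E)%E.
Proof. by move=> /integrable_fin_num fi; rewrite fineK// fi. Qed.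

Lemma Ex_cst (c : R) : \int[P]_x (fun=> c) x = c.
Proof. rewrite Rintegral_cst// -[RHS]mulr1; congr (_ * _).
by rewrite -[RHS]/(fine 1%E); congr fine; exact: probability_setT. Qed.

Lemma Ex_le f g : bmf f -> bmf g -> (forall x, f x <= g x) ->
  \int[P]_x f x <= \int[P]_x g x.
Proof. by move=> bf bg fg; apply: le_Rintegral => //; exact: bmf_integrable. Qed.

Lemma ExD f g : bmf f -> bmf g ->
  \int[P]_x (f x + g x) = \int[P]_x f x + \int[P]_x g x.
Proof. by move=> bf bg; apply: RintegralD => //; exact: bmf_integrable. Qed.

Lemma ExB f g : bmf f -> bmf g ->
  \int[P]_x (f x - g x) = \int[P]_x f x - \int[P]_x g x.
Proof. by move=> bf bg; apply: RintegralB => //; exact: bmf_integrable. Qed.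

Lemma ExZ (c : R) f : bmf f -> \int[P]_x (c * f x) = c * \int[P]_x f x.
Proof. by move=> bf; apply: RintegralZl => //; exact: bmf_integrable. Qed.

Lemma ExZr (c : R) f : bmf f -> \int[P]_x (f x * c) = \int[P]_x f x * c.
Proof. by move=> bf; apply: RintegralZr => //; exact: bmf_integrable. Qed.

Lemma Ex_sum (I : Type) (r : seq I) (f : I -> T -> R) :
  (forall i, bmf (f i)) ->
  \int[P]_x (\sum_(i <- r) f i x) = \sum_(i <- r) \int[P]_x f i x.
Proof.
move=> bf; elim: r => [|i r IH].
  by under eq_Rintegral do rewrite big_nil; rewrite big_nil Ex_cst.
under eq_Rintegral do rewrite big_cons.
by rewrite big_cons ExD ?IH//; exact: bmf_sum.
Qed.

Lemma Ex_norm_le f : bmf f -> `|\int[P]_x f x| <= \int[P]_x `|f x|.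
Proof. by move=> bf; apply: le_normr_Rintegral => //; exact: bmf_integrable. Qed.

Lemma Ex_bound (B : R) f : bmf f -> (forall x, `|f x| <= B) ->
  `|\int[P]_x f x| <= B.
Proof.
move=> bf Bf; apply: (le_trans (Ex_norm_le bf)).
rewrite -[leRHS](Ex_cst B); apply: Ex_le => //; first exact: bmf_norm.
exact: bmf_cst.
Qed.

Lemma Ex_indic (A : set T) : measurable A -> \int[P]_x (\1_A x) = fine (P A).
Proof. by move=> mA; rewrite /Rintegral integral_indic// setIT. Qed.

End expectation.

Section product.
Context d1 d2 (T1 : measurableType d1) (T2 : measurableType d2)
  (P : probability T1 R) (Q : probability T2 R).
Implicit Type f : T1 * T2 -> R.

Lemma bmf_fst f y : bmf f -> bmf (fun x => f (x, y)).
Proof. exact/bmf_comp/pair2_measurable. Qed.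

Lemma bmf_snd f x : bmf f -> bmf (fun y => f (x, y)).
Proof. exact/bmf_comp/pair1_measurable. Qed.

Lemma bmf_Ex_snd f : bmf f -> bmf (fun x => \int[Q]_y f (x, y)).
Proof.
move=> bf; have [_ [B Bf]] := bf; split.
  apply/measurable_EFinP.
  have := measurable_fubini_F (bmf_integrable (P \x Q)%E bf).
  apply: eq_measurable_fun => x _ /=; rewrite /fubini_F EFin_Ex//.
  exact/bmf_integrable/bmf_snd.
by exists B => x; apply: Ex_bound => //; exact: bmf_snd.
Qed.

Lemma Ex_prod f : bmf f ->
  \int[(P \x Q)%E]_z f z = \int[P]_x \int[Q]_y f (x, y).
Proof.
move=> bf; rewrite [LHS]/Rintegral.
rewrite -(integral12_prod_meas1 (bmf_integrable (P \x Q)%E bf)).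
congr fine; apply: eq_integral => x _.
by rewrite /fubini_F/= EFin_Ex//; exact/bmf_integrable/bmf_snd.
Qed.

Lemma Ex_swap f : bmf f ->
  \int[P]_x \int[Q]_y f (x, y) = \int[Q]_y \int[P]_x f (x, y).
Proof.
move=> bf; have := Fubini (bmf_integrable (P \x Q)%E bf).
rewrite /fubini_F /fubini_G/= => e.
rewrite [LHS]/Rintegral [RHS]/Rintegral; congr fine.
transitivity (\int[P]_x \int[Q]_y (f (x, y))%:E)%E.
  by apply: eq_integral => x _; rewrite EFin_Ex//; exact/bmf_integrable/bmf_snd.
by rewrite e; apply: eq_integral => y _; rewrite EFin_Ex//;
  exact/bmf_integrable/bmf_fst.
Qed.

End product.

(** * Samples *)

Section iid.
Context d (T : measurableType d) (P : probability T R).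

Lemma tnth_tuple_cons0 n w (s : n.-tuple T) : tnth (tuple_cons (w, s)) ord0 = w.
Proof. by rewrite (tnth_nth w). Qed.

Lemma tnth_tuple_consS n w (s : n.-tuple T) j :
  tnth (tuple_cons (w, s)) (lift ord0 j) = tnth s j.
Proof. by rewrite !(tnth_nth w). Qed.

Lemma bmf_tuple_cons n (f : n.+1.-tuple T -> R) : bmf f ->
  bmf (fun p : T * n.-tuple T => f (tuple_cons p)).
Proof. by move=> bf; apply: bmf_comp bf; exact: measurable_tuple_cons. Qed.

Lemma Ex_iid0 (f : 0.-tuple T -> R) :
  \int[iid_law P 0]_s f s = f [tuple].
Proof.
rewrite -[RHS](Ex_cst (iid_law P 0)); apply: eq_Rintegral => s _.
by rewrite tuple0.
Qed.

Lemma Ex_iidS_prod n (f : n.+1.-tuple T -> R) : bmf f ->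
  \int[iid_law P n.+1]_s f s =
  \int[(P \x iid_law P n)%E]_p f (tuple_cons p).
Proof.
move=> bf; rewrite /Rintegral integral_distribution//.
  exact/measurable_EFinP/bmf_meas.
exact/bmf_integrable/bmf_tuple_cons.
Qed.

Lemma Ex_iidS n (f : n.+1.-tuple T -> R) : bmf f ->
  \int[iid_law P n.+1]_s f s =
  \int[P]_w \int[iid_law P n]_s f (tuple_cons (w, s)).
Proof.
by move=> bf; rewrite Ex_iidS_prod// Ex_prod//; exact: bmf_tuple_cons.
Qed.

Lemma Ex_iidS_swap n (f : n.+1.-tuple T -> R) : bmf f ->
  \int[iid_law P n.+1]_s f s =
  \int[iid_law P n]_s \int[P]_w f (tuple_cons (w, s)).
Proof.
move=> bf; rewrite Ex_iidS//.
by apply: (Ex_swap _ _ (f := fun p => f (tuple_cons p))); exact: bmf_tuple_cons.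
Qed.

Lemma iid_law_all n (A : set T) : measurable A -> P A = 1%E ->
  iid_law P n [set s | forall i, A (tnth s i)] = 1%E.
Proof.
move=> mA PA; elim: n => [|n IH].
  rewrite (_ : [set _ | _] = setT) ?probability_setT//.
  by apply/seteqP; split => // s _ [].
rewrite /= /distribution /pushforward/=.
rewrite (_ : _ @^-1` _ = A `*` [set s : n.-tuple T | forall i, A (tnth s i)]).
  transitivity (P A * iid_law P n [set s | forall i, A (tnth s i)])%E.
    apply: product_measure1E => //.
    rewrite (_ : [set s | _] =
        \bigcap_(i : 'I_n) ((fun s => tnth s i) @^-1` A)).
      by apply: fin_bigcap_measurable => // i _;
        rewrite -[X in measurable X]setTI; exact: measurable_tnth.
    by apply/seteqP; split => s h i; [move=> _; exact: h|exact: (h i)].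
  by rewrite PA mul1e.
apply/seteqP; split => [[w s] h|[w s] [Aw As] i] /=.
  split; first by have := h ord0; rewrite (tnth_nth w).
  by move=> i /=; have := h (lift ord0 i); rewrite !(tnth_nth w).
case: (unliftP ord0 i) => [j ->|->]; last by rewrite (tnth_nth w).
by have := As j; rewrite !(tnth_nth w).
Qed.

End iid.

End bounded_measurable.

(** * Disintegration along a kernel *)

Section measure_uniqueness.
Context {R : realType}.

Lemma measure_unique_rect d1 d2 (T1 : measurableType d1)
    (T2 : measurableType d2) (m1 m2 : {measure set (T1 * T2) -> \bar R}) :
  (m1 setT < +oo)%E ->
  (forall A B, measurable A -> measurable B -> m1 (A `*` B) = m2 (A `*` B)) ->
  forall X, measurable X -> m1 X = m2 X.
Proof.
move=> fin12 eq12.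
apply: (measure_unique [set A `*` B | A in measurable & B in measurable]
  (fun=> setT)).
- by rewrite measurable_prod_measurableType.
- move=> _ _ [X1 mX1 [X2 mX2 <-]] [Y1 mY1 [Y2 mY2 <-]].
  exists (X1 `&` Y1); first exact: measurableI.
  by exists (X2 `&` Y2); [exact: measurableI|rewrite setXI].
- by move=> _; exists setT => //; exists setT => //; rewrite setXTT.
- by apply/seteqP; split => // x _; exists 0%N.
- by move=> _ [A mA [B mB <-]]; exact: eq12.
- by move=> _.
Qed.

Lemma measure_unique_ray (m1 m2 : {measure set (measurableTypeR R) -> \bar R}) :
  (m1 setT < +oo)%E ->
  (forall t : R, m1 `]-oo, t[%classic = m2 `]-oo, t[%classic) ->
  forall X : set R, measurable X -> m1 X = m2 X.
Proof.
move=> fin12 eq12.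
apply: (@measure_unique _ R (measurableTypeR R) (@RGenInftyO.G R) (fun n : nat => `]-oo, n%:R[%classic)).
- exact: RGenInftyO.measurableE.
- move=> _ _ [a ->] [b ->]; exists (Order.min a b).
  by apply/seteqP; split => x /=; rewrite !in_itv/= lt_min;
    [case=> -> ->|move=> /andP[]].
- by move=> n; exists n%:R.
- apply/seteqP; split => // x _; exists (Num.bound `|x|) => //=; rewrite in_itv/=.
  exact: le_lt_trans (ler_norm x) (archi_boundP (normr_ge0 x)).
- by move=> _ [t ->].
- move=> n; apply: le_lt_trans fin12; apply: le_measure => //; rewrite inE//.
Qed.

End measure_uniqueness.

Section disintegration.
Local Open Scope ereal_scope.
Context {R : realType} d (T : measurableType d) d' (S : measurableType d')
  d'' (Y : measurableType d'').
Variables (P : probability T R) (k : R.-pker S ~> Y).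
Variables (Z : T -> S) (mZ : measurable_fun setT Z).
Variables (a : T -> R) (a0 : forall w, (0 <= a w)%R)
  (ma : measurable_fun setT a).

(** The law of (Z, V) when Z has the weight a under P and V is then drawn from
    the kernel. *)
Definition kmix (E : set (S * Y)) := \int[P]_w ((a w)%:E * k (Z w) (xsection E (Z w))).

Let mk E : measurable E ->
  measurable_fun setT (fun w => (a w)%:E * k (Z w) (xsection E (Z w))).
Proof.
move=> mE; apply: emeasurable_funM; first exact/measurable_EFinP.
apply: (measurableT_comp (f := fun z => k z (xsection E z))) => //.
by apply: measurable_fun_xsection_finite_kernel; rewrite inE.
Qed.

Let kmix0 : kmix set0 = 0.
Proof. by rewrite /kmix integral0_eq// => w _; rewrite xsection0 measure0 mule0. Qed.

Let kmix_ge0 E : 0 <= kmix E.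
Proof. by apply: integral_ge0 => w _; rewrite mule_ge0// lee_fin. Qed.

Let kmix_sigma_additive : semi_sigma_additive kmix.
Proof.
move=> F mF tF mUF.
rewrite [X in _ --> X](_ : _ = \sum_(n <oo) kmix (F n)).
  by apply/cvg_closeP; split; [exact: is_cvg_nneseries|rewrite closeE].
rewrite -integral_nneseries//.
- apply: eq_integral => w _; rewrite nneseriesZl//; congr (_ * _).
  apply/esym/cvg_lim => //=; rewrite xsection_bigcup.
  apply: (measure_sigma_additive _ (trivIset_xsection tF)) => n.
  exact: measurable_xsection.
- by move=> n; exact: mk.
- by move=> n w _; rewrite mule_ge0// lee_fin.
Qed.

HB.instance Definition _ := isMeasure.Build _ _ _ kmix
  kmix0 kmix_ge0 kmix_sigma_additive.

(** Both sides are finite measures of E which agree on rectangles by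
    assumption; a w is to be thought of as the conditional probability of D
    given Z. *)
Lemma disintegration (D : set T) (V : T -> Y) :
  measurable D -> measurable_fun setT V ->
  (forall B C, measurable B -> measurable C ->
    P (D `&` V @^-1` B `&` Z @^-1` C) = \int[P]_(w in Z @^-1` C) ((a w)%:E * k (Z w) B)) ->
  forall E, measurable E ->
  P (D `&` [set w | E (Z w, V w)]) =
  \int[P]_w ((a w)%:E * k (Z w) (xsection E (Z w))).
Proof.
move=> mD mV H E mE.
have mZV : measurable_fun setT (fun w => (Z w, V w)) by exact: measurable_fun_pair.
pose m1 := measure_function_pushforward__canonical__measure_function_Measure
  (mrestr P mD) mZV.
transitivity (m1 E).
  by rewrite /m1/= /pushforward /mrestr/= setIC.
apply: (@measure_unique_rect R _ _ S Y m1 kmix) => //.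
- rewrite /m1/= /pushforward /mrestr/= preimage_setT setTI.
  by apply: le_lt_trans (probability_le1 P mD) _; rewrite ltry.
- move=> C B mC mB.
  rewrite /m1/= /pushforward /mrestr/= setIC.
  transitivity (P (D `&` V @^-1` B `&` Z @^-1` C)).
    congr (P _); apply/seteqP; split => w /=; first by case=> Dw [Cw Bw].
    by case=> -[].
  rewrite H// /kmix [LHS]integral_mkcond/=.
  apply: eq_integral => w _; rewrite patchE.
  case: ifPn => Cw.
    by rewrite in_xsectionX//; move: Cw; rewrite !inE.
  by rewrite notin_xsectionX ?measure0 ?mule0.
Qed.

End disintegration.

(** * The probability integral transform *)

Section probability_integral_transform.
Context {R : realType}.
Local Notation U01 := (uniform_prob (@ltr01 R)).

Lemma uniform_ray (t : R) :
  U01 `]-oo, t[%classic = (Order.max 0 (Order.min t 1))%:E.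
Proof.
rewrite /uniform_prob integral_uniform_pdf.
transitivity (\int[lebesgue_measure]_(x in `]-oo, t[ `&` `[0%R, 1%R])
    (1%:E : \bar R))%E.
  apply: eq_integral => x; rewrite inE/= !in_itv/= => -[_ x01].
  by rewrite /uniform_pdf x01 subr0 invr1.
rewrite integral_cst/= ?mul1e//; last exact: measurableI.
have [t0|t0] := leP t 0.
  rewrite (_ : _ `&` _ = set0) ?measure0.
    by congr EFin; rewrite max_l// ge_min t0.
  by apply/seteqP; split => y //=; rewrite !in_itv/= => -[yt /andP[y0 _]]; lra.
have [t1|t1] := ltP 1 t.
  rewrite (_ : _ `&` _ = `[0, 1]%classic).
    by rewrite lebesgue_measure_itv/= lte_fin ltr01 oppr0 adde0 max_r.
  apply/seteqP; split => y /=; rewrite !in_itv/=; first by case.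
  by move=> y01; split => //; lra.
rewrite (_ : _ `&` _ = `[0, t[%classic).
  by rewrite lebesgue_measure_itv/= lte_fin t0 oppr0 adde0 max_r// ltW.
apply/seteqP; split => y /=; rewrite !in_itv/=; first by case=> ? /andP[->].
by move=> /andP[y0 yt]; split => //; lra.
Qed.

(** F is continuous, hence attains every level in [0, 1]. At a point where the
    level t is attained, monotonicity bounds the left-hand side by t; points
    where the levels t - e are attained give the reverse inequality. *)
Lemma probability_integral_transform (m : probability R R) (F : R -> R) :
  (forall t, F t = fine (m `]-oo, t]%classic)) -> continuous F ->
  m `[0, 1]%classic = 1%E ->
  forall t, m [set y | F y < t] = U01 `]-oo, t[%classic.
Proof.
move=> FE cF m01 t.
have mE t' : (F t')%:E = m `]-oo, t']%classic.
  by rewrite FE fineK// fin_num_measure.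
have F1 : F 1 = 1.
  apply/EFin_inj; rewrite mE; apply/eqP; rewrite eq_le probability_le1//=.
  rewrite -m01; apply: le_measure; rewrite ?inE//.
  by move=> x /=; rewrite !in_itv/= => /andP[].
have F0 : F (-1) = 0.
  apply/EFin_inj; rewrite mE; apply/eqP; rewrite eq_le measure_ge0 andbT.
  apply: (@le_trans _ _ (m (~` `[0, 1]%classic))); last first.
    by rewrite probability_setC// m01 subee.
  apply: le_measure; rewrite ?inE//; first exact: measurableC.
  by move=> x /=; rewrite !in_itv/= => x1 /andP[x0 _]; clear -x0 x1; lra.
have Fge0 y : 0 <= F y by rewrite -lee_fin mE.
have Fle1 y : F y <= 1 by rewrite -lee_fin mE probability_le1.
have Fnd x y : x <= y -> F x <= F y.
  move=> xy; rewrite -lee_fin !mE; apply: le_measure; rewrite ?inE//.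
  by move=> z /=; rewrite !in_itv/= => /le_trans; apply.
have mF s : measurable [set y | F y < s].
  rewrite (_ : [set _ | _] = F @^-1` `]-oo, s[).
    by rewrite -[X in measurable X]setTI; apply: continuous_measurable_fun.
  by apply/seteqP; split => y /=; rewrite in_itv.
rewrite uniform_ray; have [t0|t0] := leP t 0.
  rewrite (_ : [set _ | _] = set0) ?measure0.
    by congr EFin; rewrite max_l// ge_min t0.
  by apply/seteqP; split => y //=; rewrite ltNge (le_trans t0).
have [t1|t1] := ltP 1 t.
  rewrite (_ : [set _ | _] = setT) ?probability_setT ?max_r//.
  by apply/seteqP; split => y //= _; exact: le_lt_trans t1.
rewrite max_r ?(ltW t0)//.
have attained s : 0 <= s <= 1 -> exists y, F y = s.
  move=> s01; have [y _ <-] : exists2 c, c \in `[-1, 1]%R & F c = s; last by exists y.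
  apply: IVT.
  - by clear; lra.
  - by move=> x; apply/continuous_subspaceT => y; exact: cF.
  - by rewrite F1 F0 min_l ?max_r.
apply/eqP; rewrite eq_le; apply/andP; split.
  have [|y yt] := attained t; first by rewrite (ltW t0).
  rewrite -yt mE; apply: le_measure; rewrite ?inE//.
  move=> z /= Fz; rewrite in_itv/= leNgt; apply/negP => yz.
  by move: (Fnd _ _ (ltW yz)); rewrite leNgt Fz.
apply/lee_subgt0Pr => e e0.
have [te|te] := leP (t - e) 0; first exact: le_trans (measure_ge0 _ _).
have [|y yt] := attained (t - e); first by rewrite (ltW te)/=; clear -t1 e0; lra.
rewrite -EFinB -yt mE; apply: le_measure; rewrite ?inE//.
move=> z /=; rewrite in_itv/= => zy; apply: le_lt_trans (Fnd _ _ zy) _; clear -yt e0; lra.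
Qed.

End probability_integral_transform.

(** * Conditional ranks *)

Section conditional_cdf_measurable.
Context {R : realType} d (S : measurableType d).
Variable k : R.-pker S ~> R.

(** The kernel with a threshold added to its parameter: the conditional
    distribution function is then the kernel of a section of the measurable
    set of the triples whose last component is below the threshold, which
    makes it jointly measurable. *)
Definition kernel_fst (p : S * R) : {measure set R -> \bar R} := k p.1.

Let kernel_fst_measurable U : measurable U ->
  measurable_fun setT (kernel_fst ^~ U).
Proof.
move=> mU; exact: measurableT_comp (measurable_kernel k U mU) measurable_fst.
Qed.

HB.instance Definition _ :=
  isKernel.Build _ _ _ _ _ kernel_fst kernel_fst_measurable.

Let kernel_fst_prob p : kernel_fst p setT = 1%E.
Proof. exact: prob_kernel. Qed.

HB.instance Definition _ :=
  Kernel_isProbability.Build _ _ _ _ _ kernel_fst kernel_fst_prob.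

Lemma measurable_kernel_cdf :
  measurable_fun setT (fun p : S * R => fine (k p.1 `]-oo, p.2]%classic)).
Proof.
apply: measurableT_comp => //=.
pose E : set ((S * R) * R) := [set q | q.2 <= q.1.2].
have mE : measurable E.
  have := @measurable_fun_ler _ _ R setT (fun q : (S * R) * R => q.2)
    (fun q => q.1.2) measurable_snd
    (measurableT_comp measurable_snd measurable_fst).
  move=> /(_ measurableT [set true] I); rewrite setTI.
  by congr measurable; apply/seteqP.
have := measurable_fun_xsection_finite_kernel kernel_fst (A := E).
rewrite inE => /(_ mE); apply: eq_measurable_fun => p _ /=.
congr (k p.1 _); apply/seteqP; split => y;
  by rewrite /xsection/= inE /E/= in_itv.
Qed.

End conditional_cdf_measurable.

Lemma measure_setI_full {R : realType} d (T : measurableType d)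
    (P : probability T R) (A K : set T) :
  measurable A -> measurable K -> P K = 1%E -> P (A `&` K) = P A.
Proof.
move=> mA mK PK; apply/eqP; rewrite eq_le; apply/andP; split.
  by apply: le_measure; rewrite ?inE//; exact: measurableI.
have PKC : P (~` K) = 0%E by rewrite probability_setC// PK subee.
rewrite -[leRHS]adde0 -PKC.
apply: le_trans (measureU2 _ _ _); rewrite ?inE//.
- apply: le_measure; rewrite ?inE//.
    by apply: measurableU; [exact: measurableI|exact: measurableC].
  by move=> x Ax; have [Kx|nKx] := pselect (K x); [left|right].
- exact: measurableI.
- exact: measurableC.
Qed.

Section probability_of_measure.
Context {R : realType} d (T : measurableType d) (m : {measure set T -> \bar R}).

(** This makes a probability of the value of a probability kernel at a
    point. *)
Definition prob_of_measure (m1 : m setT = 1%E) : set T -> \bar R := m.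

Hypothesis m1 : m setT = 1%E.

HB.instance Definition _ := Measure.on (prob_of_measure m1).
HB.instance Definition _ :=
  Measure_isProbability.Build _ _ _ (prob_of_measure m1) m1.

End probability_of_measure.

Section conditional_rank.
Context {R : realType} d (T : measurableType d) d' (S : measurableType d').
Variables (P : probability T R) (k : R.-pker S ~> R).
Variables (Z : T -> S) (V1 V : T -> R) (K : set S).
Hypotheses (mZ : measurable_fun setT Z) (mV1 : measurable_fun setT V1)
  (mV : measurable_fun setT V) (mK : measurable K).
Hypothesis PK : P (Z @^-1` K) = 1%E.
Hypothesis goodK : forall z, K z -> k z `[0, 1]%classic = 1%E /\
  continuous (fun t => fine (k z `]-oo, t]%classic)).
(** V1 and V are conditionally independent given Z: a A is the conditional
    probability that V1 is in A, and k is the conditional law of V. *)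
Variable a : set R -> S -> R.
Hypotheses (a0 : forall A z, measurable A -> 0 <= a A z)
  (ma : forall A, measurable A -> measurable_fun setT (a A)).
Hypothesis CI : forall A B C, measurable A -> measurable B -> measurable C ->
  (P (V1 @^-1` A `&` V @^-1` B `&` Z @^-1` C) =
   \int[P]_(w in Z @^-1` C) ((a A (Z w))%:E * k (Z w) B))%E.

Local Notation U01 := (uniform_prob (@ltr01 R)).

Definition rank (w : T) : R := fine (k (Z w) `]-oo, V w]%classic).

Lemma measurable_rank : measurable_fun setT rank.
Proof.
apply: (measurableT_comp (f := fun p : S * R => fine (k p.1 `]-oo, p.2]%classic))
  (measurable_kernel_cdf k) (g := fun w => (Z w, V w))).
exact: measurable_fun_pair.
Qed.

Let mpre d1 (T1 : measurableType d1) (f : T -> T1) B : measurable_fun setT f ->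
  measurable B -> measurable (f @^-1` B).
Proof. by move=> mf mB; rewrite -[X in measurable X]setTI; exact: mf. Qed.

(** Given Z in K the law of V is continuous, so the conditional probability
    that its rank is below t is that of a uniform variable and does not depend
    on Z; it factors out of the integral. *)
Lemma rank_rect A C t : measurable A -> measurable C ->
  (P (V1 @^-1` A `&` Z @^-1` C `&` [set w | (rank w < t)%R]) =
   P (V1 @^-1` A `&` Z @^-1` C) * U01 `]-oo, t[%classic)%E.
Proof.
move=> mA mC.
have mF := measurable_kernel_cdf k.
pose F z v := fine (k z `]-oo, v]%classic).
have mrank : measurable [set w | (rank w < t)%R].
  rewrite (_ : [set _ | _] = rank @^-1` `]-oo, t[%classic).
    by apply: mpre => //; exact: measurable_rank.
  by apply/seteqP; split => w /=; rewrite in_itv.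
pose E : set (S * R) := ((K `&` C) `*` setT) `&`
  ((fun p => F p.1 p.2) @^-1` `]-oo, t[%classic).
have mE : measurable E.
  apply: measurableI; first by apply: measurableX => //; exact: measurableI.
  by rewrite -[X in measurable X]setTI; exact: mF.
transitivity (P (V1 @^-1` A `&` [set w | E (Z w, V w)])).
  rewrite -(measure_setI_full (K := Z @^-1` K) _ _ PK).
  - congr (P _); apply/seteqP; split => w.
      by move=> [[[Aw Cw] rw] Kw]; split => //; split => //; rewrite /= in_itv.
    by move=> [Aw [[[Kw Cw] _]]]; rewrite /= in_itv.
  - by apply: measurableI => //; apply: measurableI; exact: mpre.
  - exact: mpre.
rewrite (disintegration (k := k) mZ (a := a A \o Z)) //; first last.
- by move=> B D mB mD; exact: CI.
- exact: mpre.
- exact: measurableT_comp (ma mA) mZ.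
- by move=> w; exact: a0.
transitivity (\int[P]_(w in Z @^-1` (K `&` C))
    ((a A (Z w))%:E * U01 `]-oo, t[%classic))%E.
  rewrite [RHS]integral_mkcond; apply: eq_integral => w _ /=.
  rewrite patchE; case: ifPn => [/set_mem[Kw Cw]|/negP KCw]; last first.
    rewrite (_ : xsection _ _ = set0) ?measure0 ?mule0//.
    apply/seteqP; split => v //; rewrite /xsection/= inE => -[[/= KC _] _].
    by apply: KCw; rewrite inE.
  have [k01 ck] := goodK Kw.
  rewrite (_ : xsection _ _ = [set v | F (Z w) v < t]).
    congr (_ * _)%E.
    exact: (@probability_integral_transform _ (prob_of_measure (prob_kernel _))).
  apply/seteqP; split => v; rewrite /xsection/= inE.
    by move=> [_]; rewrite /= in_itv.
  by move=> rv; split => //=; rewrite in_itv.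
have mKC : measurable (K `&` C) by exact: measurableI.
have -> : P (V1 @^-1` A `&` Z @^-1` C) = P (V1 @^-1` A `&` Z @^-1` (K `&` C)).
  rewrite -[LHS](measure_setI_full (K := Z @^-1` K) _ _ PK).
  - by rewrite preimage_setI [in RHS](setIC (Z @^-1` K)) setIA.
  - by apply: measurableI; exact: mpre.
  - exact: mpre.
have := CI mA measurableT mKC; rewrite preimage_setT setIT => ->.
rewrite -ge0_integralZr//.
- by apply: eq_integral => w _; rewrite prob_kernel mule1.
- exact: mpre.
- apply: emeasurable_funM; apply: measurable_funTS.
    exact/measurable_EFinP/(measurableT_comp (ma mA) mZ).
  exact: measurableT_comp (measurable_kernel k _ measurableT) mZ.
- by move=> w _; rewrite mule_ge0// lee_fin a0.
Qed.

Let W w := (V1 w, Z w).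
Let mW : measurable_fun setT W.
Proof. exact: measurable_fun_pair. Qed.

Local Notation pushfwd m mf :=
  (measure_function_pushforward__canonical__measure_function_Measure m mf).

Let rank_indep_ray E t : measurable E ->
  (P (W @^-1` E `&` [set w | (rank w < t)%R]) =
   P (W @^-1` E) * U01 `]-oo, t[%classic)%E.
Proof.
have mrank : measurable [set w | (rank w < t)%R].
  rewrite (_ : [set _ | _] = rank @^-1` `]-oo, t[%classic).
    by apply: mpre => //; exact: measurable_rank.
  by apply/seteqP; split => w /=; rewrite in_itv.
have Ufin := fin_num_measure U01 _ (measurable_itv `]-oo, t[).
pose c : {nonneg R} := NngNum (fine_ge0 (measure_ge0 U01 `]-oo, t[%classic)).
have := @measure_unique_rect _ _ _ _ _
  (pushfwd (mrestr P mrank) mW) (mscale c (pushfwd P mW)).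
rewrite /= /pushforward /mrestr/= /mscale/= /pushforward fineK// => H mE.
rewrite muleC; apply: H mE.
  rewrite preimage_setT setTI.
  by apply: le_lt_trans (probability_le1 P mrank) _; rewrite ltry.
by move=> A C mA mC; rewrite muleC; exact: rank_rect.
Qed.

Lemma rank_indep E B : measurable E -> measurable B ->
  (P (W @^-1` E `&` rank @^-1` B) = P (W @^-1` E) * U01 B)%E.
Proof.
move=> mE; have mWE : measurable (W @^-1` E) by exact: mpre.
have Pfin := fin_num_measure P _ mWE.
pose c : {nonneg R} := NngNum (fine_ge0 (measure_ge0 P (W @^-1` E))).
have mrankR := measurable_rank : @measurable_fun _ _ T (measurableTypeR R) setT rank.
move: B; have := @measure_unique_ray _
  (pushfwd (mrestr P mWE) mrankR) (mscale c U01).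
rewrite /= /pushforward /mrestr/= /mscale/= fineK// => H B mB.
rewrite setIC; apply: H => //.
  by rewrite preimage_setT setTI; apply: le_lt_trans (probability_le1 P mWE) _;
    rewrite ltry.
by move=> t; rewrite setIC -rank_indep_ray.
Qed.

(** The rank is uniform and independent of the pair (V1, Z), so the joint law
    is a product and Fubini's theorem applies. *)
Lemma Ex_rank_indep (G : R * S -> R) (psi : R -> R) : bmf G -> bmf psi ->
  \int[P]_w (G (V1 w, Z w) * psi (rank w)) =
  \int[P]_w G (V1 w, Z w) * \int[U01]_u psi u.
Proof.
move=> bG bpsi.
have mWr : @measurable_fun _ _ T ((R * S) * measurableTypeR R)%type setT
    (fun w => (W w, rank w)).
  by apply: measurable_fun_pair => //; exact: measurable_rank.
pose f (p : (R * S) * measurableTypeR R) := G p.1 * psi p.2.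
have bf : bmf f by apply: bmfM;
  [exact: bmf_comp measurable_fst bG|exact: bmf_comp measurable_snd bpsi].
pose Q : probability (R * S)%type R := distribution P (HB.pack_for {mfun T >-> (R * S)%type} W (isMeasurableFun.Build _ _ _ _ W mW)).
have lawE X : measurable X -> pushfwd P mWr X = (Q \x U01)%E X.
  move: X; apply: measure_unique_rect.
    rewrite /= /pushforward/= preimage_setT; apply: le_lt_trans (probability_le1 P measurableT) _.
    by rewrite ltry.
  move=> A B mA mB.
  transitivity (Q A * U01 B)%E; last by apply/esym/product_measure1E.
  exact: rank_indep.
transitivity (\int[(Q \x U01)%E]_p f p).
  rewrite /Rintegral; congr fine.
  transitivity (\int[pushfwd P mWr]_p (f p)%:E)%E; last first.
    by apply: eq_measure_integral => X mX _; exact: lawE.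
  rewrite integral_pushforward//=.
  - exact/measurable_EFinP/bmf_meas.
  - rewrite preimage_setT; exact: bmf_integrable (bmf_comp mWr bf).
rewrite Ex_prod//.
under eq_Rintegral do rewrite /f/= ExZ//.
rewrite ExZr//; congr (_ * _).
rewrite /Rintegral; congr fine.
rewrite integral_distribution//.
- exact/measurable_EFinP/bmf_meas.
- exact: bmf_integrable (bmf_comp mW bG).
Qed.

End conditional_rank.

Section uniform_expectation.
Context {R : realType}.

Lemma Ex_uniform (psi : R -> R) : bmf psi ->
  \int[uniform_prob (@ltr01 R)]_u psi u =
  \int[lebesgue_measure]_(u in `[0, 1]) psi u.
Proof.
move=> bpsi; have [mpsi [B psiB]] := bpsi.
have lebfin : (lebesgue_measure (`[0%R, 1%R]%classic : set R) < +oo)%E.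
  by rewrite lebesgue_measure_itv/= lte_fin ltr01 oppr0 adde0 ltry.
have int01 (f : R -> R) : bmf f ->
    lebesgue_measure.-integrable `[0, 1]%classic (EFin \o f).
  move=> [mf [C fC]]; apply: measurable_bounded_integrable => //.
    exact: measurable_funTS.
  by exists C; split; rewrite ?num_real// => M /ltW CM x _; exact: le_trans CM.
have E1 : \int[uniform_prob (@ltr01 R)]_u (psi u + B) =
    \int[lebesgue_measure]_(u in `[0, 1]) (psi u + B).
  rewrite /Rintegral integral_uniform ?subr0 ?invr1 ?mul1e//.
    by apply/measurable_EFinP; apply: measurable_funD.
  by move=> x; rewrite lee_fin -lerBlDr sub0r; have := psiB x; rewrite ler_norml => /andP[].
move: E1; rewrite ExD//; last exact: bmf_cst.
rewrite RintegralD//; [|exact: int01|by apply: int01; exact: bmf_cst].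
rewrite Ex_cst Rintegral_cst//= lebesgue_measure_itv/= lte_fin ltr01 oppr0 adde0/= mulr1.
exact: addIr.
Qed.

End uniform_expectation.

(** * Ranks of the observed coordinates *)

Section observations.
Context {R : realType} {d : nat}.
Implicit Types P : probability (obs R d) R.

Lemma measurable_cube : measurable (@cube R d).
Proof.
rewrite (_ : @cube R d = \bigcap_(i : 'I_d) ((fun z : d.-tuple R => tnth z i) @^-1` `[0, 1]%classic)).
  apply: fin_bigcap_measurable => // i _; rewrite -[X in measurable X]setTI.
  exact: measurable_tnth.
by apply/seteqP; split => z h i; [move=> _; exact: h|exact: (h i)].
Qed.

Definition xcoord (w : obs R d) : R := w.1.1.
Definition ycoord (w : obs R d) : R := w.1.2.
Definition zcoord (w : obs R d) : d.-tuple R := w.2.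

Lemma measurable_xcoord : measurable_fun setT xcoord.
Proof. exact: measurableT_comp measurable_fst measurable_fst. Qed.

Lemma measurable_ycoord : measurable_fun setT ycoord.
Proof. exact: measurableT_comp measurable_snd measurable_fst. Qed.

Lemma measurable_zcoord : measurable_fun setT zcoord.
Proof. exact: measurable_snd. Qed.

Lemma measurable_unit_obs : measurable (@unit_obs R d).
Proof.
rewrite (_ : @unit_obs R d = (xcoord @^-1` `[0, 1]%classic `&`
  ycoord @^-1` `[0, 1]%classic) `&` zcoord @^-1` @cube R d).
  apply: measurableI; first apply: measurableI.
  - by rewrite -[X in measurable X]setTI; exact: measurable_xcoord.
  - by rewrite -[X in measurable X]setTI; exact: measurable_ycoord.
  - rewrite -[X in measurable X]setTI; apply: measurable_zcoord => //.
    exact: measurable_cube.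
by apply/seteqP; split => w [] //= [].
Qed.

Lemma abs_cont_cube P : abs_cont_laws P -> P (zcoord @^-1` @cube R d) = 1%E.
Proof.
move=> [P1 _]; apply/eqP; rewrite eq_le; apply/andP; split.
  apply: probability_le1; rewrite -[X in measurable X]setTI.
  by apply: measurable_zcoord => //; exact: measurable_cube.
rewrite -P1; apply: le_measure; rewrite ?inE; first exact: measurable_unit_obs.
  rewrite -[X in measurable X]setTI.
  by apply: measurable_zcoord => //; exact: measurable_cube.
by move=> w [].
Qed.

Lemma measurable_cond_cdf (k : R.-pker (d.-tuple R) ~> R) (V : obs R d -> R) :
  measurable_fun setT V -> measurable_fun setT (fun w => cond_cdf k (V w) w.2).
Proof. by move=> mV; exact: (measurable_rank k measurable_zcoord mV). Qed.

(** The case of a constant V1 in [Ex_rank_indep]. *)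
Lemma Ex_cond_cdf P V (k : R.-pker (d.-tuple R) ~> R) (psi : R -> R) :
  abs_cont_laws P -> measurable_fun setT V -> cond_dist P V k -> bmf psi ->
  \int[P]_w psi (cond_cdf k (V w) w.2) =
  \int[lebesgue_measure]_(u in `[0, 1]) psi u.
Proof.
move=> acP mV [verk goodk] bpsi.
rewrite -Ex_uniform// -[RHS]mul1r.
have := @Ex_rank_indep R _ _ _ _ P k zcoord (fun=> 0) V (@cube R d) measurable_zcoord
  (measurable_cst _) mV measurable_cube (abs_cont_cube acP) goodk
  (fun A _ => \1_A 0) _ _ _ (fun=> 1) psi (@bmf_cst R _ (R * d.-tuple R)%type 1) bpsi.
rewrite Ex_cst => <-.
- by apply: eq_Rintegral => w _; rewrite mul1r.
- by move=> A z _; rewrite indicE.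
- by move=> A _.
move=> A B C mA mB mC; have [mp _ kC] := verk B mB.
have kE w : (fine (k w B))%:E = k w B.
  rewrite fineK// ge0_fin_numE//; apply: le_lt_trans (ltry 1).
  by rewrite -(prob_kernel (s := k) w); apply: le_measure; rewrite ?inE.
have : (P (V @^-1` B `&` snd @^-1` C) = \int[P]_(w in snd @^-1` C) k (zcoord w) B)%E.
  by rewrite -kC//; apply: eq_integral => w _; rewrite kE.
rewrite indicE; have [A0|A0] := boolP (0 \in A).
  rewrite (_ : (fun=> 0) @^-1` A = setT); last first.
    by apply/seteqP; split => // w _; exact/set_mem.
  by rewrite setTI => ->; apply: eq_integral => w _; rewrite mul1e.
rewrite (_ : (fun=> 0) @^-1` A = set0); last first.
  by apply/seteqP; split => // w A0'; move/negP: A0; apply; rewrite inE.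
rewrite !set0I measure0 => _.
by rewrite integral0_eq// => w _; rewrite mul0e.
Qed.

Lemma cond_indep_swap P A B (mA : measurable A) (mB : measurable B) p q :
  cond_indep_laws P ->
  cond_prob_version P (ycoord @^-1` A) p -> cond_prob_version P (xcoord @^-1` B) q ->
  cond_prob_version P [set w | A w.1.2 /\ B w.1.1] (p \* q).
Proof.
move=> ciP hp hq; have := ciP B A mB mA q p hq hp.
rewrite (_ : q \* p = p \* q); last by apply/funext => z /=; rewrite mulrC.
by congr cond_prob_version; apply/seteqP; split => w [].
Qed.

(** Conditional independence is what makes the rank of V independent of
    (V1, Z), and not only of Z. *)
Lemma Ex_cond_indep_gen P (V1 V : obs R d -> R)
    (k1 k : R.-pker (d.-tuple R) ~> R)
    (G : R * d.-tuple R -> R) (psi : R -> R) :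
  abs_cont_laws P -> measurable_fun setT V1 -> measurable_fun setT V ->
  cond_dist P V1 k1 -> cond_dist P V k ->
  (forall A B, measurable A -> measurable B -> forall p q,
     cond_prob_version P (V1 @^-1` A) p -> cond_prob_version P (V @^-1` B) q ->
     cond_prob_version P (V1 @^-1` A `&` V @^-1` B) (p \* q)) ->
  bmf G -> bmf psi ->
  \int[P]_w (G (V1 w, w.2) * psi (cond_cdf k (V w) w.2)) =
  \int[P]_w G (V1 w, w.2) * \int[lebesgue_measure]_(u in `[0, 1]) psi u.
Proof.
move=> acP mV1 mV [verk1 _] [verk goodk] ci bG bpsi.
rewrite -Ex_uniform//.
apply: (@Ex_rank_indep R _ _ _ _ P k zcoord V1 V (@cube R d) measurable_zcoord
  mV1 mV measurable_cube (abs_cont_cube acP) goodk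
  (fun A z => fine (k1 z A)) _ _ _ G psi bG bpsi).
- by move=> A z mA; exact: fine_ge0.
- by move=> A mA; case: (verk1 A mA).
move=> A B C mA mB mC.
have [_ _ <-//] := ci A B mA mB _ _ (verk1 A mA) (verk B mB).
apply: eq_integral => w _ /=; rewrite EFinM; congr (_ * _)%E.
rewrite fineK// ge0_fin_numE//; apply: le_lt_trans (ltry 1).
by rewrite -(prob_kernel (s := k) (zcoord w)); apply: le_measure; rewrite ?inE.
Qed.

End observations.

(** * Second moments of sums over a sample *)

Section orthogonality.
Context {R : realType} d (T : measurableType d) d' (T' : measurableType d').
Variables (P : probability T R) (W : T -> T') (mk : T' -> T) (psi : T -> R).
(** W is the part of an observation that is conditioned upon, mk completes
    such a part to an observation, and psi is centred given W. *)
Hypotheses (mmk : measurable_fun setT mk) (mkK : cancel mk W).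
Hypothesis bpsi : bmf psi.
Hypothesis psi0 : forall G : T' -> R, bmf G -> \int[P]_w (G (W w) * psi w) = 0.

Lemma bmf_tnth n (i : 'I_n) (f : T -> R) : bmf f ->
  bmf (fun s : n.-tuple T => f (tnth s i)).
Proof. by move=> bf; apply: bmf_comp bf; exact: measurable_tnth. Qed.

(** L depends on the i-th observation only through W. Integrating with respect
    to this observation first leaves the conditional mean of psi; there L is
    rewritten through mk as a function of W alone. *)
Lemma Ex_iid_orthogonal n (i : 'I_n) (L : n.-tuple T -> R) : bmf L ->
  (forall s s', (forall j, W (tnth s j) = W (tnth s' j)) ->
     (forall j, j != i -> tnth s j = tnth s' j) -> L s = L s') ->
  \int[iid_law P n]_s (L s * psi (tnth s i)) = 0.
Proof.
elim: n i L => [[]//|n IH] i L bL dep.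
have bLpsi : bmf (fun s => L s * psi (tnth s i)).
  by apply: bmfM => //; exact: bmf_tnth.
have tnth0 w (s : n.-tuple T) : tnth (tuple_cons (w, s)) ord0 = w.
  by rewrite (tnth_nth w).
have tnthS w (s : n.-tuple T) j : tnth (tuple_cons (w, s)) (lift ord0 j) = tnth s j.
  by rewrite !(tnth_nth w).
move: dep bLpsi; case: (unliftP ord0 i) => [j ->|->] dep bLpsi.
  rewrite Ex_iidS// -[RHS](Ex_cst P 0); apply: eq_Rintegral => w _.
  transitivity (\int[iid_law P n]_s (L (tuple_cons (w, s)) * psi (tnth s j))).
    by apply: eq_Rintegral => s _; rewrite tnthS.
  apply: (IH j (fun s => L (tuple_cons (w, s)))).
    by apply: bmf_comp bL;
      exact: (measurable_cons (measurable_cst w) (@measurable_id _ _ setT)).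
  move=> s s' Wss' ss'; apply: dep => l.
    by case: (unliftP ord0 l) => [l' ->|->]; rewrite ?tnthS ?tnth0.
  case: (unliftP ord0 l) => [l' ->|->]; rewrite ?tnthS ?tnth0//.
  by move=> /eqP l'j; apply: ss'; apply/eqP => l'E; apply: l'j; rewrite l'E.
rewrite Ex_iidS_swap// -[RHS](Ex_cst (iid_law P n) 0); apply: eq_Rintegral => s _.
rewrite -[RHS](psi0 (G := fun t => L (tuple_cons (mk t, s)))); last first.
  apply: bmf_comp bL.
 exact: (measurable_cons mmk (measurable_cst s)).
apply: eq_Rintegral => w _; rewrite tnth0; congr (_ * _); apply: dep => l.
  by case: (unliftP ord0 l) => [l' ->|->]; rewrite ?tnthS ?tnth0// mkK.
by case: (unliftP ord0 l) => [l' ->|->]; rewrite ?tnthS// eqxx.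
Qed.

(** The weights D i may depend on the whole sample of W. In the expanded square
    every cross product is orthogonal to one factor psi, so that only the
    diagonal remains. *)
Lemma Ex_iid_sum_sqr n (D : 'I_n -> n.-tuple T -> R) :
  (forall i, bmf (D i)) ->
  (forall i s s', (forall j, W (tnth s j) = W (tnth s' j)) -> D i s = D i s') ->
  \int[iid_law P n]_s ((\sum_i D i s * psi (tnth s i)) ^+ 2) =
  \sum_i \int[iid_law P n]_s (D i s ^+ 2 * psi (tnth s i) ^+ 2).
Proof.
move=> bD dep.
have bDpsi i : bmf (fun s => D i s * psi (tnth s i)).
  by apply: bmfM => //; exact: bmf_tnth.
under eq_Rintegral do rewrite expr2 big_distrlr /=.
rewrite Ex_sum; last by move=> i; apply: bmf_sum => j; exact: bmfM.
apply: eq_bigr => i _; rewrite Ex_sum; last by move=> j; exact: bmfM.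
rewrite (bigD1 i)//= [X in _ + X]big1 ?addr0.
  by apply: eq_Rintegral => s _; rewrite -expr2 exprMn.
move=> j ji.
rewrite -[RHS](@Ex_iid_orthogonal n i
  (fun s => D i s * D j s * psi (tnth s j))).
- by apply: eq_Rintegral => s _; ring.
- by apply: bmfM; [exact: bmfM|exact: bmf_tnth].
- by move=> s s' Ws ss'; rewrite (dep i _ _ Ws) (dep j _ _ Ws) ss'.
Qed.

End orthogonality.

Section second_moment.
Context {R : realType} d (T : measurableType d) (P : probability T R).

Lemma Ex_iid_sum_sqr_le n (f : T -> R) (B : R) (w0 : T) : bmf f ->
  \int[P]_w f w = 0 -> (forall w, `|f w| <= B) ->
  \int[iid_law P n]_s ((\sum_(i < n) f (tnth s i)) ^+ 2) <= n%:R * B ^+ 2.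
Proof.
move=> bf f0 fB.
have := @Ex_iid_sum_sqr R _ T _ unit P (fun=> tt) (fun=> w0) f
  (measurable_cst _) _ bf _ n (fun _ _ => 1) (fun=> bmf_cst _ 1) _.
under eq_Rintegral do under eq_bigr do rewrite mul1r.
move=> ->//; last 2 first.
- by case.
- by move=> G bG; rewrite ExZ// f0 mulr0.
rewrite (le_trans (y := \sum_(i < n) B ^+ 2))//; last first.
  by rewrite sumr_const card_ord mulr_natl.
apply: ler_sum => i _; rewrite -[leRHS](Ex_cst (iid_law P n)).
apply: Ex_le.
- by apply: bmfM; [exact: bmf_exp (bmf_cst _ 1)|exact/bmf_exp/bmf_tnth].
- exact: bmf_cst.
- move=> s; rewrite expr1n mul1r -(real_normK (num_real (f (tnth s i)))) lerXn2r ?nnegrE//.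
  exact: le_trans (fB (tnth s i)).
Qed.

Lemma markov_sqr (f : T -> R) (e : R) : 0 < e -> bmf f ->
  (P [set w | (e < `|f w|)%R] <= ((\int[P]_w (f w ^+ 2)) / e ^+ 2)%:E)%E.
Proof.
move=> e0 bf; set A := [set _ | _].
have mA : measurable A by exact: measurable_tail.
have PA : P A = (\int[P]_w (\1_A w))%:E.
  by rewrite Ex_indic// fineK// fin_num_measure.
rewrite PA lee_fin ler_pdivlMr ?exprn_gt0// -ExZr; last exact: bmf_indic.
apply: Ex_le.
- by apply: bmfM; [exact: bmf_indic|exact: bmf_cst].
- exact: bmf_exp.
move=> w; rewrite indicE; case: (boolP (w \in A)) => [|_]; last first.
  by rewrite mul0r sqr_ge0.
rewrite inE /A/= mul1r => /ltW ef.
by rewrite -(real_normK (num_real (f w))) lerXn2r ?nnegrE// ltW.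
Qed.

End second_moment.

(** * Densities and affine changes of variable *)

Section density.
Local Open Scope ereal_scope.
Import HBNNSimple.
Context {R : realType} d (T : measurableType d).
Variables (mu m : {measure set T -> \bar R}) (p : T -> R).
Hypotheses (p0 : forall x, (0 <= p x)%R) (mp : measurable_fun setT p).
Hypothesis mE : forall A, measurable A -> m A = \int[mu]_(x in A) (p x)%:E.

Let mpE : measurable_fun setT (EFin \o p).
Proof. exact/measurable_EFinP. Qed.

Let density_indic A : measurable A ->
  \int[m]_x (\1_A x)%:E = \int[mu]_x ((\1_A x)%:E * (p x)%:E).
Proof.
move=> mA; rewrite integral_indic// setIT mE// integral_mkcond.
apply: eq_integral => x _; rewrite patchE indicE.
by case: ifPn => xA; rewrite ?mul1e ?mul0e.
Qed.

Let density_nnsfun (f : {nnsfun T >-> R}) :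
  \int[m]_x (f x)%:E = \int[mu]_x ((f x)%:E * (p x)%:E).
Proof.
have mind r : measurable_fun setT (fun x => (r * \1_(f @^-1` [set r]) x)%:E).
  by apply/measurable_EFinP/measurable_funM.
under eq_integral do rewrite fimfunE -fsumEFin//.
rewrite ge0_integral_fsum//; last first.
  by move=> r x _; rewrite nnfun_muleindic_ge0.
transitivity (\int[mu]_x \sum_(r \in range f)
    ((r * \1_(f @^-1` [set r]) x)%:E * (p x)%:E)); last first.
  apply: eq_integral => x _; rewrite [in RHS]fimfunE -fsumEFin//.
  rewrite ge0_mule_fsuml// => r; exact: nnfun_muleindic_ge0.
rewrite ge0_integral_fsum//; last 2 first.
- by move=> r; exact: emeasurable_funM.
- by move=> r x _; rewrite mule_ge0// ?nnfun_muleindic_ge0// lee_fin.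
apply: eq_fsbigr => r /[1!inE] -[t _ <-].
under eq_integral do rewrite EFinM.
have mI : measurable_fun setT (fun x => (\1_(f @^-1` [set f t]) x)%:E : \bar R).
  exact/measurable_EFinP.
rewrite ge0_integralZl//; last by rewrite lee_fin.
rewrite density_indic// -ge0_integralZl//.
- by apply: eq_integral => x _; rewrite EFinM muleA.
- exact: emeasurable_funM.
- by move=> x _; rewrite mule_ge0// lee_fin.
- by rewrite lee_fin.
Qed.

Lemma integral_density (f : T -> \bar R) : measurable_fun setT f ->
  (forall x, 0 <= f x) -> \int[m]_x f x = \int[mu]_x (f x * (p x)%:E).
Proof.
move=> mf f0; pose f_ := nnsfun_approx measurableT mf.
have mf_ n : measurable_fun setT (fun x => (f_ n x)%:E).
  exact/measurable_EFinP.
have f_cvg x : (f_ n x)%:E @[n --> \oo] --> f x by exact: cvg_nnsfun_approx.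
have f_nd x : {homo (fun n => (f_ n x)%:E) : n k / (n <= k)%N >-> n <= k}.
  by move=> n k nk; rewrite lee_fin; exact/lefP/nd_nnsfun_approx.
transitivity (lim (\int[m]_x (f_ n x)%:E @[n --> \oo])).
  rewrite -monotone_convergence//.
    by apply: eq_integral => x _; apply/esym/cvg_lim.
  by move=> n x _; rewrite lee_fin.
under eq_fun do rewrite density_nnsfun.
rewrite -monotone_convergence//.
- apply: eq_integral => x _; apply/cvg_lim => //.
  by apply: cvgeZr => //; exact: f_cvg.
- by move=> n; exact: emeasurable_funM.
- by move=> n x _; rewrite mule_ge0// lee_fin.
- by move=> x _ n k nk; apply: lee_wpmul2r; rewrite ?lee_fin//; exact/lefP/nd_nnsfun_approx.
Qed.

End density.

Section affine_change.
Context {R : realType}.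
Local Notation mu := (@lebesgue_measure R).
Variables (m s : R).
Hypothesis s0 : s != 0.

Let aff : measurableTypeR R -> measurableTypeR R := fun x => m + s * x.

Let maff : measurable_fun setT aff.
Proof.
exact: (@measurable_funD _ (measurableTypeR R) R).
Qed.

Local Notation pushfwd m mf :=
  (measure_function_pushforward__canonical__measure_function_Measure m mf).

Let absS : {nonneg R} := NngNum (normr_ge0 s).

Lemma lebesgue_affine (A : set R) : measurable A ->
  (`|s|%:E * mu (aff @^-1` A) = mu A)%E.
Proof.
move=> mA; apply/esym.
apply: (lebesgue_measure_unique (mu := mscale absS (pushfwd mu maff))) => //.
move=> _ [[a b] _ <-] /=; rewrite /mscale/= /pushforward/=.
have [sgt|sle] := ltP 0 s.
  rewrite (_ : aff @^-1` _ = `](a - m) / s, (b - m) / s]%classic); last first.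
    apply/seteqP; split => x /=; rewrite !in_itv/= /aff ltr_pdivrMr// ler_pdivlMr//;
    by move=> /andP[h1 h2]; apply/andP; split; lra.
  rewrite !lebesgue_measure_itv/= !lte_fin ltr_pM2r ?invr_gt0// ltrD2r.
  case: ifPn => _; last by rewrite mule0.
  rewrite gtr0_norm// -!EFinB -EFinM; congr EFin; field; lra.
have slt : s < 0 by rewrite lt_neqAle s0.
rewrite (_ : aff @^-1` _ = `[(b - m) / s, (a - m) / s[%classic); last first.
  apply/seteqP; split => x /=; rewrite !in_itv/= /aff ler_ndivrMr// ltr_ndivlMr//;
  by move=> /andP[h1 h2]; apply/andP; split; lra.
rewrite !lebesgue_measure_itv/= !lte_fin ltr_nM2r ?invr_lt0// ltrD2r.
case: ifPn => _; last by rewrite mule0.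
rewrite ltr0_norm// -!EFinB -EFinM; congr EFin; field; lra.
Qed.

Lemma ge0_integral_affine (f : R -> \bar R) : measurable_fun setT f ->
  (forall x, 0 <= f x)%E ->
  (`|s|%:E * \int[mu]_x f (m + s * x)%R = \int[mu]_x f x)%E.
Proof.
move=> mf f0.
transitivity (\int[mscale absS (pushfwd mu maff)]_x f x)%E; last first.
  by apply: eq_measure_integral => A mA _; exact: lebesgue_affine.
rewrite ge0_integral_mscale//; congr (_ * _)%E.
by rewrite ge0_integral_pushforward.
Qed.

End affine_change.

(** * Rotation invariance of the normal law *)

Section equality_in_law.
Context {R : realType} d1 d2 d (T1 : measurableType d1)
  (T2 : measurableType d2) (S : measurableType d)
  (P : probability T1 R) (Q : probability T2 R) (f : T1 -> S) (g : T2 -> S).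
Hypotheses (mf : measurable_fun setT f) (mg : measurable_fun setT g).
Hypothesis PQ : forall A, measurable A -> P (f @^-1` A) = Q (g @^-1` A).

Lemma Ex_eq_law_integrable (h : S -> R) : measurable_fun setT h ->
  P.-integrable setT (EFin \o (h \o f)) ->
  Q.-integrable setT (EFin \o (h \o g)) ->
  \int[P]_x h (f x) = \int[Q]_y h (g y).
Proof.
move=> mh hf hg; rewrite /Rintegral; congr fine.
have mhE : measurable_fun setT (EFin \o h) by exact/measurable_EFinP.
pose m1 := measure_function_pushforward__canonical__measure_function_Measure P mf.
pose m2 := measure_function_pushforward__canonical__measure_function_Measure Q mg.
transitivity (\int[m1]_y (h y)%:E)%E.
  by rewrite integral_pushforward//= preimage_setT.
transitivity (\int[m2]_y (h y)%:E)%E.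
  by apply: eq_measure_integral => A mA _; exact: PQ.
by rewrite integral_pushforward//= preimage_setT.
Qed.

Lemma Ex_eq_law (h : S -> R) : bmf h -> \int[P]_x h (f x) = \int[Q]_y h (g y).
Proof.
move=> bh; apply: Ex_eq_law_integrable; first exact: bmf_meas.
- exact: bmf_integrable (bmf_comp mf bh).
- exact: bmf_integrable (bmf_comp mg bh).
Qed.

End equality_in_law.

Section standard_normal.
Context {R : realType}.
Local Notation mu := (@lebesgue_measure R).
Local Notation RR := (measurableTypeR R).

Definition gauss1 : probability RR R := normal_prob 0 1.

Let measurable_affine (m s : R) : @measurable_fun _ _ RR RR setT (fun x => m + s * x).
Proof. exact: (@measurable_funD _ RR R). Qed.

Lemma normal_peakE :
  exists2 K : R, 0 < K & forall s, normal_peak s = (`|s| * K)^-1.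
Proof.
have pi2 : 0 < (pi : R) *+ 2 by rewrite mulrn_wgt0 ?pi_gt0.
exists (Num.sqrt (pi *+ 2)); first by rewrite sqrtr_gt0.
move=> s; rewrite /normal_peak (_ : s ^+ 2 * pi *+ 2 = s ^+ 2 * (pi *+ 2)).
  by rewrite sqrtrM ?sqr_ge0// sqrtr_sqr.
by rewrite [RHS]mulrnAr.
Qed.

Lemma normal_pdf_affine (m b z : R) : b != 0 ->
  `|b| * normal_pdf m b (m + b * z) = normal_pdf 0 1 z.
Proof.
move=> b0; rewrite !normal_pdfE ?oner_eq0// mulrA; congr (_ * _); last first.
  rewrite /normal_fun expr1n subr0 addrAC subrr add0r; congr expR.
  by rewrite exprMn; field.
have [K K0 peakE] := normal_peakE; rewrite !peakE normr1 mul1r.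
by field; rewrite normr_eq0 b0 gt_eqF.
Qed.

Let normal_probE s t A :
  normal_prob s t A = (\int[mu]_u ((normal_pdf s t u)%:E * (\1_A u)%:E))%E.
Proof.
rewrite /normal_prob integral_mkcond; apply: eq_integral => u _.
by rewrite patchE indicE; case: ifPn; rewrite ?mule1 ?mule0.
Qed.

Let measurable_pdf_indic s t A : @measurable _ RR A ->
  @measurable_fun _ _ RR _ setT
    (fun u => ((normal_pdf s t u)%:E * (\1_A u)%:E)%E).
Proof.
move=> mA; apply: emeasurable_funM; apply/measurable_EFinP.
  exact: measurable_normal_pdf.
exact: measurable_indic.
Qed.

Lemma normal_prob_affine (m b : R) (A : set R) : b != 0 -> measurable A ->
  gauss1 [set z | A (m + b * z)] = normal_prob m b A.
Proof.
move=> b0 mA; rewrite /gauss1/= !normal_probE.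
rewrite -[RHS](ge0_integral_affine m b0); last 2 first.
- exact: (measurable_pdf_indic m b mA).
- by move=> x; rewrite mule_ge0// lee_fin normal_pdf_ge0.
rewrite -ge0_integralZl//.
- apply: eq_integral => x _.
  rewrite [RHS]muleA -[in RHS]EFinM normal_pdf_affine// !indicE.
- exact: measurableT_comp (measurable_pdf_indic m b mA) (measurable_affine m b).
- by move=> x _; rewrite mule_ge0// lee_fin normal_pdf_ge0.
Qed.

(** Completing the square: the joint density of a standard normal x and of
    u = a x + b y is the density of u times the conditional density of x given
    u. *)
Lemma normal_pdf_mul (a b c x u : R) : b != 0 -> c ^+ 2 = a ^+ 2 + b ^+ 2 ->
  normal_pdf (a * x) b u * normal_pdf 0 1 x =
  normal_pdf 0 c u * normal_pdf (a * u / c ^+ 2) (b / c) x.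
Proof.
move=> b0 c2.
have b2 : 0 < b ^+ 2 by rewrite exprn_even_gt0/=.
have ab0 : a ^+ 2 + b ^+ 2 != 0 by rewrite gt_eqF// ltr_wpDl ?sqr_ge0.
have c0 : c != 0 by rewrite -sqrf_eq0 c2.
rewrite !normal_pdfE ?oner_eq0 ?mulf_neq0 ?invr_eq0//.
rewrite mulrACA [RHS]mulrACA; congr (_ * _).
  have [K K0 peakE] := normal_peakE; rewrite !peakE normr1 normf_div.
  by field; rewrite !normr_eq0 b0 c0 gt_eqF.
rewrite /normal_fun -!expRD; congr expR.
rewrite exprMn exprVn c2 expr1n; field.
by rewrite b0 ab0.
Qed.

Let measurable_normal_pdf2 (a b : R) :
  measurable_fun setT (fun p : RR * RR => normal_pdf (a * p.1) b p.2).
Proof.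
have -> : (fun p : RR * RR => normal_pdf (a * p.1) b p.2) =
    if b == 0 then (\1_`[0, 1]%classic) \o snd
    else (normal_pdf 0 b) \o (fun p => p.2 - a * p.1).
  apply/funext => -[x u] /=; rewrite /normal_pdf.
  by case: ifPn => // _; rewrite /normal_fun/= subr0.
case: ifPn => _.
  by apply: measurableT_comp => //; exact: measurable_indic.
apply: measurableT_comp; first exact: measurable_normal_pdf.
apply: (@measurable_funB _ (RR * RR)%type R); first exact: measurable_snd.
by apply: (@measurable_funM _ (RR * RR)%type R) => //; exact: measurable_fst.
Qed.

(** By [normal_pdf_mul] the integral over x is that of a normal density. *)
Lemma normal_convolution (a b c : R) (A : set R) : b != 0 ->
  c ^+ 2 = a ^+ 2 + b ^+ 2 -> measurable A ->
  (\int[gauss1]_x normal_prob (a * x) b A = normal_prob 0 c A)%E.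
Proof.
move=> b0 c2 mA.
have b2 : 0 < b ^+ 2 by rewrite exprn_even_gt0/=.
have c0 : c != 0.
  by rewrite -sqrf_eq0 c2 gt_eqF// ltr_wpDl ?sqr_ge0.
pose F (p : RR * RR) : \bar R :=
  ((normal_pdf (a * p.1) b p.2)%:E * (\1_A p.2)%:E)%E.
have mI : measurable_fun setT (fun p : RR * RR => (\1_A p.2)%:E : \bar R).
  apply/measurable_EFinP.
  exact: measurableT_comp (@measurable_indic _ RR _ setT _ mA) measurable_snd.
have mF : measurable_fun setT F.
  by apply: emeasurable_funM => //; exact/measurable_EFinP.
have F0 p : (0 <= F p)%E by rewrite mule_ge0// lee_fin ?normal_pdf_ge0.
have pdf0 s t u : (0 <= (normal_pdf s t u)%:E :> \bar R)%E.
  by rewrite lee_fin normal_pdf_ge0.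
rewrite (@integral_density R _ RR mu gauss1 (normal_pdf 0 1)); first last.
- by move=> x.
- have := measurable_fun_fubini_tonelli_F (m2 := mu) F mF F0.
  apply: eq_measurable_fun => x _; rewrite /fubini_F /F/= normal_probE.
  by [].
- by [].
- exact: measurable_normal_pdf.
- by move=> x; exact: normal_pdf_ge0.
pose G (p : RR * RR) : \bar R := (F p * (normal_pdf 0 1 p.1)%:E)%E.
have mG : measurable_fun setT G.
  apply: emeasurable_funM => //; apply/measurable_EFinP.
  apply: (measurableT_comp (f := normal_pdf 0 1 : RR -> R)) => //.
  exact: measurable_normal_pdf.
have G0 p : (0 <= G p)%E by rewrite mule_ge0.
transitivity (\int[mu]_x \int[mu]_u G (x, u))%E.
  apply: eq_integral => x _; rewrite normal_probE -ge0_integralZr//.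
  - apply: emeasurable_funM.
      by apply/measurable_EFinP; exact: measurable_normal_pdf.
    by apply/measurable_EFinP; exact: measurable_indic.
  - by move=> u _; rewrite mule_ge0// lee_fin.
rewrite (@fubini_tonelli _ _ RR RR R mu mu G mG G0) normal_probE; apply: eq_integral => u _.
transitivity (\int[mu]_x (((normal_pdf 0 c u)%:E * (\1_A u)%:E) *
    (normal_pdf (a * u / c ^+ 2) (b / c) x)%:E))%E.
  apply: eq_integral => x _; rewrite /G /F/= muleAC -EFinM (normal_pdf_mul _ _ b0 c2).
  by rewrite EFinM muleAC.
rewrite ge0_integralZl//.
- by rewrite integral_normal_pdf mule1.
- by apply/measurable_EFinP; exact: measurable_normal_pdf.
- by rewrite mule_ge0// lee_fin.
Qed.

(** Stability is, besides the moments, the only property of the normal law that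
    the central limit theorem relies on. *)
Lemma Ex_gauss_rotation (a b c : R) (f : RR -> R) :
  c ^+ 2 = a ^+ 2 + b ^+ 2 -> bmf f ->
  \int[gauss1]_x \int[gauss1]_y f (a * x + b * y) = \int[gauss1]_z f (c * z).
Proof.
move=> c2 bf.
have lin (k : R) : @measurable_fun _ _ RR RR setT ( *%R k).
  exact: (@measurable_funM _ RR R).
have lawE (k l : R) (h : RR -> R) : k ^+ 2 = l ^+ 2 -> bmf h ->
    \int[gauss1]_z h (k * z) = \int[gauss1]_z h (l * z).
  move=> kl bh; have [k0|k0] := eqVneq k 0.
    suff -> : l = 0 by rewrite k0.
    by apply/eqP; rewrite -sqrf_eq0 -kl k0 expr0n.
  have l0 : l != 0 by rewrite -sqrf_eq0 -kl sqrf_eq0.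
  apply: (Ex_eq_law (lin k) (lin l)) => // A mA.
  have := normal_prob_affine 0 k0 mA; have := normal_prob_affine 0 l0 mA.
  rewrite (_ : [set z | A (0 + l * z)] = ( *%R l) @^-1` A); last first.
    by apply/seteqP; split => z /=; rewrite add0r.
  rewrite (_ : [set z | A (0 + k * z)] = ( *%R k) @^-1` A); last first.
    by apply/seteqP; split => z /=; rewrite add0r.
  move=> -> ->; rewrite /normal_prob.
  apply: eq_integral => z _; rewrite !normal_pdfE// /normal_fun kl.
  by rewrite /normal_peak kl.
have [b0|b0] := eqVneq b 0.
  transitivity (\int[gauss1]_x f (a * x)).
    apply: eq_Rintegral => x _; rewrite -[RHS](Ex_cst gauss1).
    by apply: eq_Rintegral => y _; rewrite b0 mul0r addr0.
  by apply: lawE => //; rewrite c2 b0 expr0n addr0.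
have c0 : c != 0.
  by rewrite -sqrf_eq0 c2 gt_eqF// ltr_wpDl ?sqr_ge0// exprn_even_gt0/=.
have mab : measurable_fun setT (fun p : RR * RR => a * p.1 + b * p.2 : RR).
  apply: (@measurable_funD _ (RR * RR)%type R).
    by apply: (@measurable_funM _ (RR * RR)%type R) => //; exact: measurable_fst.
  by apply: (@measurable_funM _ (RR * RR)%type R) => //; exact: measurable_snd.
rewrite -(Ex_prod gauss1 gauss1 (bmf_comp mab bf)).
apply: (Ex_eq_law mab (lin c)) => // A mA.
transitivity (normal_prob 0 c A); last first.
  have := normal_prob_affine 0 c0 mA; move=> <-.
  by congr (gauss1 _); apply/seteqP; split => z /=; rewrite add0r.
transitivity (\int[gauss1]_x normal_prob (a * x) b A)%E; last first.
  exact: normal_convolution.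
rewrite /product_measure1; apply: eq_integral => x _ /=.
have := normal_prob_affine (a * x) b0 mA; move=> <-.
by congr (gauss1 _); apply/seteqP; split => y; rewrite /xsection/= inE.
Qed.

End standard_normal.

(** * Moments of the standard normal law *)

Section normal_moments.
Context {R : realType}.
Local Notation mu := (@lebesgue_measure R).
Local Notation RR := (measurableTypeR R).
Local Notation g1 := (@gauss1 R).
Local Notation p := (normal_pdf 0 1 : R -> R).

Let pE (x : R) : p x = normal_peak 1 * expR (- (x ^+ 2 / 2)).
Proof.
by rewrite normal_pdfE ?oner_eq0// /normal_fun subr0 expr1n mulNr.
Qed.

Let is_derive_p (x : R) : is_derive x 1 p (- (x * p x)).
Proof.
rewrite (_ : p = fun x => normal_peak 1 * expR (- (x ^+ 2 / 2))); last first.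
  by apply/funext => y; rewrite pE.
apply: is_derive_eq.
by rewrite /GRing.scale/=; field.
Qed.

Let F (x : R) := - (x * p x).

Let is_derive_F (x : R) : is_derive x 1 F ((x ^+ 2 - 1) * p x).
Proof.
have h := is_derive_p x.
apply: is_derive_eq.
by rewrite /GRing.scale/=; field.
Qed.

Let p0 x : 0 <= p x. Proof. exact: normal_pdf_ge0. Qed.

Let cont_p : continuous p.
Proof. by apply: continuous_normal_pdf; rewrite oner_eq0. Qed.

Let meas_p : @measurable_fun _ _ RR RR setT p.
Proof. exact: measurable_normal_pdf. Qed.

(* Comparison with the normal density of variance 2 yields the integrability of
   the moments up to the fourth; 64 leaves room for (1 + y/2)^2 to dominate
   1 + x^4 with y = x^2/4. *)
Let quartic_p_le (x : R) : (1 + x ^+ 4) * p x <=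
  64 * (normal_peak 1 / normal_peak (Num.sqrt 2)) * normal_pdf 0 (Num.sqrt 2) x.
Proof.
have s20 : Num.sqrt 2 != 0 :> R by rewrite gt_eqF// sqrtr_gt0.
have k0 := normal_peak_gt0 s20; have k1 := normal_peak_gt0 (oner_neq0 R).
rewrite pE normal_pdfE// /normal_fun subr0 sqr_sqrtr//.
set E1 := expR _; set E2 := expR _.
rewrite (_ : (1 + x ^+ 4) * _ = normal_peak 1 * ((1 + x ^+ 4) * E1)); last by ring.
rewrite (_ : 64 * _ * _ = normal_peak 1 * (64 * E2)); last first.
  by field; rewrite gt_eqF.
rewrite ler_pM2l// /E1 /E2.
set y := x ^+ 2 / 4.
have -> : - x ^+ 2 / (2 *+ 2) = - y.
  by rewrite /y -mulr_natl mulNr; congr (- (_ / _)); ring.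
have -> : - (x ^+ 2 / 2) = - y + (- (y / 2) - (y / 2)) by rewrite /y; field.
rewrite expRD mulrCA [leRHS]mulrC ler_pM2l ?expR_gt0//.
have y0 : 0 <= y by rewrite /y divr_ge0 ?sqr_ge0.
rewrite expRD expRN -invfM ler_pdivrMr ?mulr_gt0 ?expR_gt0//.
have e1 : 1 + y / 2 <= expR (y / 2) by exact: expR_ge1Dx.
apply: (@le_trans _ _ (64 * ((1 + y / 2) * (1 + y / 2)))); last first.
  by rewrite ler_pM2l// ler_pM// addr_ge0// divr_ge0.
rewrite (_ : 64 * _ = 64 + 16 * x ^+ 2 + x ^+ 4).
  by have := sqr_ge0 x; move: (x ^+ 2) (x ^+ 4) => a b a0; lra.
by rewrite /y; field.
Qed.

Lemma gauss_integrable (h : R -> R) : @measurable_fun _ _ RR RR setT h ->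
  (forall x, `|h x| <= 1 + x ^+ 4) -> g1.-integrable setT (EFin \o h).
Proof.
move=> mh hle; apply/integrableP; split; first exact/measurable_EFinP.
rewrite (@integral_density R _ RR mu g1 p); first last.
- by move=> x.
- by apply: measurableT_comp => //; exact/measurable_EFinP.
- by [].
- exact: meas_p.
- exact: p0.
pose k : R := 64 * (normal_peak 1 / normal_peak (Num.sqrt 2)).
apply: (@le_lt_trans _ _ (\int[mu]_x (k%:E * (normal_pdf 0 (Num.sqrt 2) x)%:E))%E).
  apply: ge0_le_integral => //.
  - by move=> x _; rewrite mule_ge0// lee_fin.
  - apply: emeasurable_funM; last by apply/measurable_EFinP; exact: meas_p.
    by apply: measurableT_comp => //; exact/measurable_EFinP.
  - by apply: emeasurable_funM => //; apply/measurable_EFinP; exact: measurable_normal_pdf.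
  move=> x _; rewrite /= -EFinM lee_fin; apply: le_trans (quartic_p_le x).
  by rewrite ler_wpM2r.
rewrite ge0_integralZl//.
- by rewrite integral_normal_pdf mule1 ltry.
- by apply/measurable_EFinP; exact: measurable_normal_pdf.
- by move=> x _; rewrite lee_fin normal_pdf_ge0.
- by rewrite lee_fin mulr_ge0// divr_ge0// normal_peak_ge0.
Qed.

Let le1D4 (x : R) : `|x| <= 1 + x ^+ 4 /\ x ^+ 2 <= 1 + x ^+ 4 /\ `|x| ^+ 3 <= 1 + x ^+ 4.
Proof.
have -> : x ^+ 4 = `|x| ^+ 4.
  by rewrite -normrX ger0_norm// exprn_even_ge0.
rewrite -(real_normK (num_real x)).
have := normr_ge0 x; set t := `|x| => t0.
have [t1|t1] := leP t 1.
  have h n : t ^+ n <= 1 + t ^+ 4.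
    by rewrite -[leLHS]addr0 lerD ?exprn_ge0// exprn_ile1.
  by split; [exact: (h 1%N)|split; exact: h].
have h n : (n <= 4)%N -> t ^+ n <= 1 + t ^+ 4.
  by move=> n4; rewrite -[leLHS]add0r lerD// ler_eXn2l.
by split; [exact: (h 1%N)|split; exact: h].
Qed.

Lemma gauss_integrable1 : g1.-integrable setT (EFin \o (fun z : R => z)).
Proof. by apply: gauss_integrable => // x; case: (le1D4 x). Qed.

Lemma gauss_integrable2 : g1.-integrable setT (EFin \o (fun z : R => z ^+ 2)).
Proof.
apply: gauss_integrable => [|x]; first exact: (@measurable_funX _ RR R).
by rewrite ger0_norm ?sqr_ge0//; case: (le1D4 x) => _ [].
Qed.

Lemma gauss_integrable3 : g1.-integrable setT (EFin \o (fun z : R => `|z| ^+ 3)).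
Proof.
apply: gauss_integrable => [|x].
  by apply: (@measurable_funX _ RR R); exact: normr_measurable.
by rewrite ger0_norm ?exprn_ge0//; case: (le1D4 x) => _ [].
Qed.

(** The law is symmetric. *)
Lemma gauss_mean : \int[g1]_z z = 0.
Proof.
have m1 : @measurable_fun _ _ RR RR setT (fun z => 0 + (-1) * z).
  exact: (@measurable_funD _ RR R).
have : \int[g1]_z (0 + (-1) * z) = \int[g1]_z z.
  apply: (Ex_eq_law_integrable m1 (@measurable_id _ RR setT) _ (h := fun z : RR => z)) => //.
  - move=> A mA; have := normal_prob_affine 0 (_ : -1 != 0) mA.
    rewrite oppr_eq0 oner_eq0 => /(_ isT) e; rewrite [LHS]e /= /normal_prob.
    apply: eq_integral => z _; rewrite !normal_pdfE ?oppr_eq0 ?oner_eq0//.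
    by rewrite /normal_peak /normal_fun sqrrN.
  - rewrite (_ : _ \o _ = fun z => (-1)%:E * (EFin \o (fun z : R => z)) z)%E.
      by apply: integrableZl => //; exact: gauss_integrable1.
    by apply/funext => z; rewrite /= add0r EFinM.
  - exact: gauss_integrable1.
under eq_Rintegral do rewrite add0r.
rewrite RintegralZl//; last exact: gauss_integrable1.
by move=> e; lra.
Qed.

Let xp_cvg0 : F x @[x --> +oo] --> (0 : R).
Proof.
apply/cvgrPdist_lt => e e0; near=> x.
have x0 : 0 < x by near: x; exact: nbhs_pinfty_gt.
rewrite sub0r /F opprK ger0_norm ?(mulr_ge0 (ltW x0) (p0 x))// pE.
have k1 := normal_peak_gt0 (oner_neq0 R).
have x2 : 0 < x ^+ 2 / 2 by rewrite divr_gt0// exprn_gt0.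
have ex : (expR (x ^+ 2 / 2))^-1 <= (x ^+ 2 / 2)^-1.
  rewrite lef_pV2 ?posrE ?expR_gt0//; apply: le_trans (expR_ge1Dx _).
  by rewrite lerDr.
rewrite expRN; apply: (@le_lt_trans _ _ (x * (normal_peak 1 * (x ^+ 2 / 2)^-1))).
  by rewrite !ler_pM2l.
rewrite (_ : x * _ = 2 * normal_peak 1 / x); last by field; rewrite gt_eqF.
rewrite ltr_pdivrMr// -ltr_pdivrMl//.
near: x; apply: nbhs_pinfty_gt; exact: num_real.
Unshelve. all: by end_near. Qed.

Let cont_f : continuous (fun x : R => (x ^+ 2 - 1) * p x).
Proof.
move=> x; apply: cvgM; last exact: cont_p.
by apply: cvgB; [exact: exprn_continuous|exact: cvg_cst].
Qed.

Let cont_F : continuous F.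
Proof.
move=> x; apply: cvgN; apply: cvgM; first exact: cvg_id.
exact: cont_p.
Qed.

Let tail_part : (\int[mu]_(x in `[1%R, +oo[) ((x ^+ 2 - 1) * p x)%:E = (p 1)%:E)%E.
Proof.
rewrite (@ge0_continuous_FTC2y R _ F _ 0).
- by rewrite /F mul1r -EFinB opprK add0r.
- move=> x x1; rewrite mulr_ge0// subr_ge0 exprn_ege1//.
- exact: continuous_subspaceT.
- exact: xp_cvg0.
- by move=> x _; have [] := is_derive_F x.
- by apply: cvg_at_right_filter; exact: cont_F.
- by move=> x _; rewrite derive1E; have [] := is_derive_F x.
Qed.

Let head_part : (\int[mu]_(x in `[0%R, 1%R]) ((x ^+ 2 - 1) * p x)%:E = - (p 1)%:E)%E.
Proof.
rewrite (@continuous_FTC2 R _ F).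
- by rewrite /F mul1r mul0r -EFinB oppr0 subr0.
- exact: ltr01.
- exact: continuous_subspaceT.
- split.
  + by move=> x _; have [] := is_derive_F x.
  + by apply: cvg_at_right_filter; exact: cont_F.
  + by apply: cvg_at_left_filter; exact: cont_F.
- by move=> x _; rewrite derive1E; have [] := is_derive_F x.
Qed.

Let q2 (x : R) := x ^+ 2 * p x.

Let int_p : mu.-integrable setT (EFin \o p).
Proof. exact: integrable_normal_pdf. Qed.

Let meas_q2 : @measurable_fun _ _ RR RR setT q2.
Proof.
apply: (@measurable_funM _ RR R); last exact: meas_p.
exact: (@measurable_funX _ RR R).
Qed.

Let q20 x : 0 <= q2 x. Proof. by rewrite mulr_ge0 ?sqr_ge0. Qed.

Let gauss_q2 : (\int[g1]_x (x ^+ 2)%:E = \int[mu]_x (q2 x)%:E)%E.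
Proof.
rewrite (@integral_density R _ RR mu g1 p) //.
- by apply/measurable_EFinP; exact: (@measurable_funX _ RR R).
- by move=> x; rewrite lee_fin sqr_ge0.
Qed.

Let int_q2 : mu.-integrable setT (EFin \o q2).
Proof.
apply/integrableP; split; first by apply/measurable_EFinP.
have /integrableP[_] := gauss_integrable2; apply: le_lt_trans.
have -> : (\int[mu]_x `|(EFin \o q2) x| = \int[mu]_x (q2 x)%:E)%E.
  by apply: eq_integral => x _; rewrite /= ger0_norm.
rewrite -gauss_q2.
have -> // : (\int[g1]_x (x ^+ 2)%:E =
    \int[g1]_x `|(EFin \o (fun z : R => (z ^+ 2)%R)) x|)%E.
by apply: eq_integral => x _; rewrite /= ger0_norm ?sqr_ge0.
Qed.

(** The function - x p(x) vanishes at 0 and at infinity and its derivative is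
    (x^2 - 1) p(x), so x^2 and 1 have the same integral against p on the
    half-line. The half-line is cut at 1, beyond which the derivative is
    nonnegative. *)
Lemma gauss_variance : \int[g1]_z (z ^+ 2) = 1.
Proof.
have sym (f : R -> R) : (forall x, 0 <= f x) -> continuous f ->
    (forall x, f (- x) = f x) -> (\int[mu]_x (f x)%:E =
    2%:E * \int[mu]_(x in `[0%R, +oo[) (f x)%:E)%E.
  move=> f0 cf fN; rewrite ge0_symfun_integralT//.
    by rewrite set_itvcy.
  by move=> x /=; rewrite fN.
have pN x : p (- x) = p x by rewrite !pE sqrrN.
have cq2 : continuous q2.
  by move=> x; apply: cvgM; [exact: exprn_continuous|exact: cont_p].
have intS f : mu.-integrable setT (EFin \o f) -> mu.-integrable `[0, +oo[ (EFin \o f).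
  by move=> /integrableS; apply => //.
have intf : mu.-integrable setT (EFin \o (fun x => (x ^+ 2 - 1) * p x)).
  rewrite (_ : _ \o _ = (EFin \o q2) \- (EFin \o p))%E.
    exact: integrableB.
  by apply/funext => x; rewrite /= -EFinB /q2 mulrBl mul1r.
have split01 : `[0, +oo[%classic = `[0, 1]%classic `|` `]1, +oo[%classic :> set R.
  apply/seteqP; split => x /=; rewrite !in_itv/= !andbT.
    by move=> x0; have [x1|x1] := leP x 1; [left; rewrite x0|right].
  by move=> [/andP[]|/ltW]// /(le_trans ler01).
have zero : \int[mu]_(x in `[0, +oo[) ((x ^+ 2 - 1) * p x) = 0.
  rewrite split01 Rintegral_setU//; last 2 first.
  - by rewrite -split01; exact: intS intf.
  - rewrite disj_set2E; apply/eqP/seteqP; split => x //=; rewrite !in_itv/= andbT.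
    by move=> [/andP[_ x1]]; rewrite ltNge x1.
  rewrite /Rintegral head_part integral_itv_obnd_cbnd ?tail_part/=; first by rewrite addNr.
  by apply: measurable_funTS; exact: (measurable_int _ intf).
have AB : \int[mu]_(x in `[0, +oo[) q2 x = \int[mu]_(x in `[0, +oo[) p x.
  apply/eqP; rewrite -subr_eq0 -RintegralB//; [|exact: intS|exact: intS].
  apply/eqP; rewrite -[RHS]zero; apply: eq_Rintegral => x _.
  by rewrite /q2 mulrBl mul1r.
rewrite /Rintegral gauss_q2 sym//; last by move=> x; rewrite /q2 sqrrN pN.
have := integral_normal_pdf (0 : R) 1; rewrite (sym p)//.
have finI f : mu.-integrable setT (EFin \o f) ->
    (\int[mu]_(x in `[0%R, +oo[) (f x)%:E)%E \is a fin_num.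
  by move=> /intS /integrable_fin_num; apply.
rewrite -(fineK (finI _ int_p)) -(fineK (finI _ int_q2)).
by rewrite -[fine (\int[mu]_(x in _) (q2 x)%:E)%E]/(\int[mu]_(x in `[0, +oo[) q2 x) AB => ->.
Qed.

End normal_moments.

(** * Square roots of positive semidefinite matrices *)

Section cholesky.
Context {R : rcfType}.

(** One step of the Cholesky decomposition, followed by induction on the Schur
    complement. When the corner a is zero, positivity on the vectors (t, b)
    forces b = 0; so b = a w for some w in every case, and no invertibility is
    required. *)
Lemma psd_factor n (S : 'M[R]_n) : S^T = S ->
  (forall v : 'rV_n, 0 <= (v *m S *m v^T) 0 0) ->
  exists A : 'M[R]_n, S = A *m A^T.
Proof.
elim: n S => [|n IH].
  by move=> S _ _; exists 0; apply/matrixP => -[].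
change (forall S : 'M[R]_(1 + n), S^T = S ->
  (forall v : 'rV_(1 + n), 0 <= (v *m S *m v^T) 0 0) ->
  exists A : 'M[R]_(1 + n), S = A *m A^T).
move=> S Ssym Spsd.
pose a := S 0 0; pose b : 'rV_n := ursubmx S; pose D : 'M[R]_n := drsubmx S.
have SE : S = block_mx a%:M b b^T D.
  rewrite -[LHS]submxK; congr block_mx.
    by apply/matrixP => i j; rewrite !mxE !ord1 !eqxx mulr1n; congr (S _ _); apply/val_inj.
  by rewrite /b trmx_ursub Ssym.
have Dsym : D^T = D by rewrite /D trmx_drsub Ssym.
clearbody a b D.
have quad (t : R) (v : 'rV_n) :
    0 <= t ^+ 2 * a + 2 * t * ((b *m v^T) 0 0) + (v *m D *m v^T) 0 0.
  have := Spsd (row_mx t%:M v); rewrite SE mul_row_block tr_row_mx mul_row_col.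
  rewrite tr_scalar_mx !mulmxDl -!scalar_mxM !mul_scalar_mx mul_mx_scalar.
  have vb : (v *m b^T) 0 0 = (b *m v^T) 0 0.
    by rewrite -[v *m b^T]trmxK trmx_mul trmxK [LHS]mxE.
  rewrite -scalemxAl; move: (v *m b^T) (b *m v^T) (v *m D *m v^T) vb => X Y Z vb.
  rewrite !mxE eqxx mulr1n vb; congr (_ <= _); ring.
have a0 : 0 <= a.
  by have := quad 1 0; rewrite trmx0 mulmx0 mul0mx mul0mx !mxE expr1n mulr0 !addr0 mul1r.
have [w Sw] : exists w : 'rV_n, b = a *: w.
  have [a_eq0|a_neq0] := eqVneq a 0; last first.
    by exists (a^-1 *: b); rewrite scalerA divff// scale1r.
  exists 0; rewrite a_eq0 scale0r.
  pose c := (b *m b^T) 0 0; pose e := (b *m D *m b^T) 0 0.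
  have c0 : 0 <= c.
    by rewrite /c mxE sumr_ge0// => i _; rewrite [b^T _ _]mxE -expr2 sqr_ge0.
  have {}quad t : 0 <= 2 * t * c + e.
    by have := quad t b; rewrite a_eq0 mulr0 add0r.
  have c_eq0 : c = 0.
    apply/eqP/negPn/negP => c_neq0.
    have := quad (- (e + 1) / (2 * c)).
    rewrite (_ : 2 * _ * c = - (e + 1)); last by field.
    lra.
  apply/matrixP => i j; rewrite ord1 mxE; apply/eqP.
  move/eqP: c_eq0; rewrite /c mxE psumr_eq0; last first.
    by move=> k _; rewrite [b^T _ _]mxE -expr2 sqr_ge0.
  by move=> /allP /(_ j (mem_index_enum _)); rewrite [b^T _ _]mxE mulf_eq0 orbb.
have [A' A'E] : exists A' : 'M[R]_n, D - a *: (w^T *m w) = A' *m A'^T.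
  apply: IH.
    rewrite linearB linearZ/= trmx_mul trmxK.
    by rewrite Dsym.
  move=> v; have := quad (- (w *m v^T) 0 0) v.
  rewrite Sw mulmxBr mulmxBl -scalemxAr -!scalemxAl mulmxA -(mulmxA _ w).
  have wv : (v *m w^T) 0 0 = (w *m v^T) 0 0.
    by rewrite -[v *m w^T]trmxK trmx_mul trmxK [LHS]mxE.
  move: (v *m w^T) (w *m v^T) (v *m D *m v^T) wv => X Y Z wv.
  rewrite !mxE big_ord1 wv; congr (_ <= _); ring.
exists (block_mx (Num.sqrt a)%:M 0 (Num.sqrt a *: w^T) A').
rewrite tr_block_mx mulmx_block SE tr_scalar_mx !linearZ/= !trmxK trmx0.
rewrite !mulmx0 !mul0mx !addr0 -scalar_mxM -!scalemxAl -A'E.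
rewrite mul_scalar_mx mul_mx_scalar !scalerA -!expr2 sqr_sqrtr//.
by rewrite Sw linearZ/= addrC subrK.
Qed.

End cholesky.

(** * Gaussian tuples and their linear forms *)

Section integrable_law.
Context {R : realType} d1 d2 d (T1 : measurableType d1)
  (T2 : measurableType d2) (S : measurableType d)
  (P : probability T1 R) (Q : probability T2 R) (f : T1 -> S) (g : T2 -> S).
Hypotheses (mf : measurable_fun setT f) (mg : measurable_fun setT g).
Hypothesis PQ : forall A, measurable A -> P (f @^-1` A) = Q (g @^-1` A).

Lemma integrable_eq_law (h : S -> R) : measurable_fun setT h ->
  Q.-integrable setT (EFin \o (h \o g)) -> P.-integrable setT (EFin \o (h \o f)).
Proof.
move=> mh hg; apply/integrableP; split.
  by apply/measurable_EFinP; exact: measurableT_comp.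
have mabs : measurable_fun setT (fun y => `|(h y)%:E|%E).
  by apply: measurableT_comp => //; exact/measurable_EFinP.
pose m1 := measure_function_pushforward__canonical__measure_function_Measure P mf.
pose m2 := measure_function_pushforward__canonical__measure_function_Measure Q mg.
have /integrableP[_] := hg; apply: le_lt_trans.
rewrite le_eqVlt; apply/orP; left; apply/eqP.
transitivity (\int[m1]_y `|(h y)%:E|)%E.
  by rewrite ge0_integral_pushforward.
transitivity (\int[m2]_y `|(h y)%:E|)%E.
  by apply: eq_measure_integral => A mA _; exact: PQ.
by rewrite ge0_integral_pushforward.
Qed.

End integrable_law.

Section gaussian_tuples.
Context {R : realType}.
Local Notation RR := (measurableTypeR R).
Local Notation g1 := (@gauss1 R).
Local Notation gN N := (iid_law g1 N).

Let mlin (k : R) : @measurable_fun _ _ RR RR setT ( *%R k).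
Proof. exact: (@measurable_funM _ RR R). Qed.

Definition tuple_lin2 N (a b : R) (s t : N.-tuple RR) : N.-tuple RR :=
  [tuple a * tnth s i + b * tnth t i | i < N].

Definition tuple_scale N (c : R) (s : N.-tuple RR) : N.-tuple RR :=
  [tuple c * tnth s i | i < N].

Lemma measurable_tuple_lin2 N (a b : R) :
  measurable_fun setT (fun p : N.-tuple RR * N.-tuple RR => tuple_lin2 a b p.1 p.2).
Proof.
apply/measurable_fun_tnthP => i /=.
rewrite (_ : _ \o _ = fun p : N.-tuple RR * N.-tuple RR =>
    a * tnth p.1 i + b * tnth p.2 i); last by apply/funext => p /=; rewrite tnth_mktuple.
have m1 : measurable_fun setT (fun p : N.-tuple RR * N.-tuple RR => tnth p.1 i).
  by apply: measurableT_comp (measurable_tnth i) measurable_fst.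
have m2 : measurable_fun setT (fun p : N.-tuple RR * N.-tuple RR => tnth p.2 i).
  by apply: measurableT_comp (measurable_tnth i) measurable_snd.
by apply: (@measurable_funD _ (N.-tuple RR * N.-tuple RR)%type R);
  apply: (@measurable_funM _ (N.-tuple RR * N.-tuple RR)%type R).
Qed.

Lemma measurable_tuple_scale N (c : R) :
  measurable_fun setT (tuple_scale c : N.-tuple RR -> N.-tuple RR).
Proof.
apply/measurable_fun_tnthP => i /=.
rewrite (_ : _ \o _ = fun s : N.-tuple RR => c * tnth s i); last first.
  by apply/funext => p /=; rewrite tnth_mktuple.
apply: (@measurable_funM _ (N.-tuple RR)%type R) => //; exact: measurable_tnth.
Qed.

Lemma tuple_lin2_cons N (a b w w' : R) (s s' : N.-tuple RR) :
  tuple_lin2 a b (tuple_cons (w, s)) (tuple_cons (w', s')) =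
  tuple_cons (a * w + b * w' : RR, tuple_lin2 a b s s').
Proof.
apply: eq_from_tnth => i; rewrite tnth_mktuple.
by case: (unliftP ord0 i) => [j ->|->];
  rewrite ?tnth_tuple_consS ?tnth_tuple_cons0 ?tnth_mktuple.
Qed.

Lemma tuple_scale_cons N (c w : R) (s : N.-tuple RR) :
  tuple_scale c (tuple_cons (w, s)) =
  tuple_cons (c * w : RR, tuple_scale c s).
Proof.
apply: eq_from_tnth => i; rewrite tnth_mktuple.
by case: (unliftP ord0 i) => [j ->|->];
  rewrite ?tnth_tuple_consS ?tnth_tuple_cons0 ?tnth_mktuple.
Qed.

Ltac measurable_shuffle := repeat first
  [ exact: measurable_cst | exact: measurable_id
  | exact: measurable_fst | exact: measurable_snd
  | exact: (measurableT_comp measurable_fst measurable_fst)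
  | exact: (measurableT_comp measurable_fst measurable_snd)
  | exact: (measurableT_comp measurable_snd measurable_fst)
  | exact: (measurableT_comp measurable_snd measurable_snd)
  | apply: measurable_fun_pair ].

Lemma Ex_gauss_tuple_rotation N (a b c : R) (f : N.-tuple RR -> R) :
  c ^+ 2 = a ^+ 2 + b ^+ 2 -> bmf f ->
  \int[gN N]_s \int[gN N]_t f (tuple_lin2 a b s t) =
  \int[gN N]_s f (tuple_scale c s).
Proof.
move=> c2; elim: N f => [|N IH] f bf.
  rewrite -[RHS](Ex_cst (gN 0)); apply: eq_Rintegral => s _.
  by rewrite !Ex_iid0; congr f; rewrite [LHS]tuple0 [RHS]tuple0.
have bF : bmf (fun p : N.+1.-tuple RR * N.+1.-tuple RR => f (tuple_lin2 a b p.1 p.2)).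
  exact: bmf_comp (measurable_tuple_lin2 _ _) bf.
pose H (p : (RR * RR) * (N.-tuple RR * N.-tuple RR)) :=
  f (tuple_cons (a * p.1.1 + b * p.1.2 : RR, tuple_lin2 a b p.2.1 p.2.2)).
have mlin2 : measurable_fun setT (fun u : RR * RR => a * u.1 + b * u.2 : RR).
  apply: (@measurable_funD _ (RR * RR)%type R).
    by apply: (@measurable_funM _ (RR * RR)%type R) => //; exact: measurable_fst.
  by apply: (@measurable_funM _ (RR * RR)%type R) => //; exact: measurable_snd.
have bH : bmf H.
  apply: bmf_comp bf.
  exact: (measurable_cons (measurableT_comp mlin2 measurable_fst)
    (measurableT_comp (measurable_tuple_lin2 a b) measurable_snd)).
transitivity (\int[g1]_w \int[gN N]_s \int[g1]_w' \int[gN N]_t H ((w, w'), (s, t))).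
  rewrite (Ex_iidS g1 (bmf_Ex_snd (gN N.+1) (gN N.+1) bF)).
  apply: eq_Rintegral => w _; apply: eq_Rintegral => s _.
  rewrite (Ex_iidS g1 (bmf_snd _ bF)).
  apply: eq_Rintegral => w' _; apply: eq_Rintegral => t _.
  by rewrite tuple_lin2_cons.
pose K (p : (RR * RR) * N.-tuple RR) :=
  f (tuple_cons (a * p.1.1 + b * p.1.2 : RR, tuple_scale c p.2)).
have bK : bmf K.
  apply: bmf_comp bf.
  exact: (measurable_cons (measurableT_comp mlin2 measurable_fst)
    (measurableT_comp (measurable_tuple_scale c) measurable_snd)).
transitivity (\int[g1]_w \int[g1]_w' \int[gN N]_s K ((w, w'), s)).
  apply: eq_Rintegral => w _.
  have bH' : bmf (fun q : (N.-tuple RR * RR) * N.-tuple RR =>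
      H ((w, q.1.2), (q.1.1, q.2))).
    by apply: bmf_comp bH; measurable_shuffle.
  rewrite (Ex_swap (gN N) g1 (bmf_Ex_snd (gN N \x g1)%E (gN N) bH')).
  apply: eq_Rintegral => w' _ /=.
  rewrite -(IH (fun s => f (tuple_cons (a * w + b * w' : RR, s))))//.
  apply: bmf_comp bf.
  exact: (measurable_cons (measurable_cst _) (@measurable_id _ _ setT)).
transitivity (\int[g1]_w \int[gN N]_s \int[g1]_w' K ((w, w'), s)).
  apply: eq_Rintegral => w _.
  have bK' : bmf (fun q : RR * N.-tuple RR => K ((w, q.1), q.2)).
    by apply: bmf_comp bK; measurable_shuffle.
  exact: (Ex_swap g1 (gN N) bK').
have bK2 : bmf (fun q : (RR * N.-tuple RR) * RR => K ((q.1.1, q.2), q.1.2)).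
  by apply: bmf_comp bK; measurable_shuffle.
rewrite (Ex_swap g1 (gN N) (bmf_Ex_snd (g1 \x gN N)%E g1 bK2)).
rewrite (Ex_iidS_swap g1 (bmf_comp (measurable_tuple_scale c) bf)).
apply: eq_Rintegral => s _ /=.
pose g u := f (tuple_cons (u : RR, tuple_scale c s)).
transitivity (\int[g1]_w g (c * w)); last first.
  by apply: eq_Rintegral => w _; rewrite tuple_scale_cons.
rewrite -(Ex_gauss_rotation (a := a) (b := b))//.
apply: bmf_comp bf.
exact: (measurable_cons (@measurable_id _ _ setT) (measurable_cst _)).
Qed.

Definition lin_form N (b : 'I_N -> R) (s : N.-tuple RR) : R :=
  \sum_i b i * tnth s i.

Lemma measurable_lin_form N (b : 'I_N -> R) :
  @measurable_fun _ _ (N.-tuple RR) RR setT (lin_form b).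
Proof.
apply: (@measurable_sum _ (N.-tuple RR) R) => i.
by apply: (@measurable_funM _ (N.-tuple RR)%type R) => //; exact: measurable_tnth.
Qed.

(** A linear form of independent standard normal variables is distributed as a
    multiple of one of them, by repeated use of stability. *)
Lemma Ex_lin_form N (b : 'I_N -> R) (c : R) (h : RR -> R) :
  c ^+ 2 = \sum_i b i ^+ 2 -> bmf h ->
  \int[gN N]_s h (lin_form b s) = \int[g1]_z h (c * z).
Proof.
elim: N b c h => [|N IH] b c h c2 bh.
  rewrite Ex_iid0 /lin_form big_ord0; move/eqP: c2.
  rewrite big_ord0 sqrf_eq0 => /eqP ->; rewrite -[LHS](Ex_cst g1).
  by apply: eq_Rintegral => z _; rewrite mul0r.
rewrite Ex_iidS; last exact: bmf_comp (measurable_lin_form b) bh.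
pose c' := Num.sqrt (\sum_(i < N) b (lift ord0 i) ^+ 2).
have c'2 : c' ^+ 2 = \sum_(i < N) b (lift ord0 i) ^+ 2.
  by rewrite sqr_sqrtr// sumr_ge0// => i _; rewrite sqr_ge0.
rewrite -(Ex_gauss_rotation (a := b ord0) (b := c'))//; last first.
  by rewrite c2 big_ord_recl c'2.
apply: eq_Rintegral => w _.
rewrite -(IH (fun i => b (lift ord0 i)) c' (fun u => h (b ord0 * w + u)))//.
  apply: eq_Rintegral => s _; congr h; rewrite /lin_form big_ord_recl tnth_tuple_cons0.
  by congr (_ + _); apply: eq_bigr => i _; rewrite tnth_tuple_consS.
apply: bmf_comp bh; exact: (@measurable_funD _ RR R).
Qed.

Lemma lin_form_law N (b : 'I_N -> R) (c : R) (A : set R) :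
  c ^+ 2 = \sum_i b i ^+ 2 -> measurable A ->
  gN N (lin_form b @^-1` A) = g1 ( *%R c @^-1` A).
Proof.
move=> c2 mA.
have mA1 : measurable (lin_form b @^-1` A).
  by rewrite -[X in measurable X]setTI; exact: measurable_lin_form.
have mA2 : @measurable _ RR ( *%R c @^-1` A).
  by rewrite -[X in measurable X]setTI; exact: mlin.
have := @Ex_lin_form N b c \1_A c2 (bmf_indic mA).
have -> : \int[gN N]_s \1_A (lin_form b s) = fine (gN N (lin_form b @^-1` A)).
  by rewrite -Ex_indic.
have -> : \int[g1]_z \1_A (c * z) = fine (g1 ( *%R c @^-1` A)).
  by rewrite -Ex_indic.
move=> e; rewrite -[LHS]fineK ?fin_num_measure// e fineK//.
exact: fin_num_measure.
Qed.

End gaussian_tuples.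

Section lin_form_moments.
Context {R : realType} (N : nat).
Local Notation RR := (measurableTypeR R).
Local Notation g1 := (@gauss1 R).
Local Notation gN := (iid_law g1 N).
Implicit Types b : 'I_N -> R.

Let sd b := Num.sqrt (\sum_i b i ^+ 2).

Let sd2 b : sd b ^+ 2 = \sum_i b i ^+ 2.
Proof. by rewrite sqr_sqrtr// sumr_ge0// => i _; rewrite sqr_ge0. Qed.

Let mlin (k : R) : @measurable_fun _ _ RR RR setT ( *%R k).
Proof. exact: (@measurable_funM _ RR R). Qed.

Let law b A (mA : measurable A) := lin_form_law (sd2 b) mA.

Lemma lin_form_integrable1 b : gN.-integrable setT (EFin \o lin_form b).
Proof.
apply: (integrable_eq_law (measurable_lin_form b) (mlin (sd b)) (@law b)
  (h := fun z : RR => z)) => //.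
rewrite (_ : _ \o _ = fun z => (sd b)%:E * (EFin \o (fun z : R => z)) z)%E.
  by apply: integrableZl => //; exact: gauss_integrable1.
by apply/funext => z; rewrite /= EFinM.
Qed.

Let msqr : @measurable_fun _ _ RR RR setT (fun z => z ^+ 2).
Proof. exact: (@measurable_funX _ RR R). Qed.

Let int_sqr (k : R) : g1.-integrable setT (EFin \o ((fun z : R => z ^+ 2) \o *%R k)).
Proof.
rewrite (_ : _ \o _ = fun z => (k ^+ 2)%:E * (EFin \o (fun z : R => (z ^+ 2)%R)) z)%E.
  by apply: integrableZl => //; exact: gauss_integrable2.
by apply/funext => z; rewrite /= exprMn EFinM.
Qed.

Lemma lin_form_integrable2 b :
  gN.-integrable setT (EFin \o (fun s => lin_form b s ^+ 2)).
Proof.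
exact: (integrable_eq_law (measurable_lin_form b) (mlin (sd b)) (@law b)
  (h := fun z : RR => z ^+ 2) msqr (int_sqr _)).
Qed.

Lemma lin_form_integrable3 b :
  gN.-integrable setT (EFin \o (fun s => `|lin_form b s| ^+ 3)).
Proof.
apply: (integrable_eq_law (measurable_lin_form b) (mlin (sd b)) (@law b)
  (h := fun z : RR => `|z| ^+ 3)).
  by apply: (@measurable_funX _ RR R); exact: normr_measurable.
rewrite (_ : _ \o _ = fun z => (sd b ^+ 3)%:E * (EFin \o (fun z : R => (`|z| ^+ 3)%R)) z)%E.
  by apply: integrableZl => //; exact: gauss_integrable3.
by apply/funext => z; rewrite /= normrM exprMn (ger0_norm (sqrtr_ge0 _)) EFinM.
Qed.

Lemma Ex_lin_form_id b : \int[gN]_s lin_form b s = 0.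
Proof.
rewrite (Ex_eq_law_integrable (measurable_lin_form b) (mlin (sd b)) (@law b)
  (h := fun z : RR => z)) //.
- by rewrite RintegralZl//; [rewrite gauss_mean mulr0|exact: gauss_integrable1].
- exact: lin_form_integrable1.
rewrite (_ : _ \o _ = fun z => (sd b)%:E * (EFin \o (fun z : R => z)) z)%E.
  by apply: integrableZl => //; exact: gauss_integrable1.
by apply/funext => z; rewrite /= EFinM.
Qed.

Lemma Ex_lin_form_sqr b : \int[gN]_s (lin_form b s ^+ 2) = \sum_i b i ^+ 2.
Proof.
rewrite (Ex_eq_law_integrable (measurable_lin_form b) (mlin (sd b)) (@law b)
  (h := fun z : RR => z ^+ 2)) //.
- under eq_Rintegral do rewrite exprMn.
  by rewrite RintegralZl//; [rewrite gauss_variance mulr1 sd2|exact: gauss_integrable2].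
- exact: lin_form_integrable2.
Qed.

Let prodE b b' s : lin_form b s * lin_form b' s =
  4^-1 * (lin_form (fun i => b i + b' i) s ^+ 2 - lin_form (fun i => b i - b' i) s ^+ 2).
Proof.
have -> : lin_form (fun i => b i + b' i) s = lin_form b s + lin_form b' s.
  by rewrite /lin_form -big_split/=; apply: eq_bigr => i _; rewrite mulrDl.
have -> : lin_form (fun i => b i - b' i) s = lin_form b s - lin_form b' s.
  by rewrite /lin_form -sumrB; apply: eq_bigr => i _; rewrite mulrBl.
by field.
Qed.

Lemma lin_form_integrable11 b b' :
  gN.-integrable setT (EFin \o (fun s => lin_form b s * lin_form b' s)).
Proof.
rewrite (_ : _ \o _ = fun s => (4^-1)%:E *
  ((EFin \o (fun s => lin_form (fun i => b i + b' i) s ^+ 2)%R) \-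
   (EFin \o (fun s => lin_form (fun i => b i - b' i) s ^+ 2)%R)) s)%E.
  by apply: integrableZl => //; apply: integrableB => //; exact: lin_form_integrable2.
by apply/funext => s; rewrite /= prodE EFinM EFinB.
Qed.

Lemma Ex_lin_form_mul b b' :
  \int[gN]_s (lin_form b s * lin_form b' s) = \sum_i b i * b' i.
Proof.
under eq_Rintegral do rewrite prodE.
have i2 b1 := lin_form_integrable2 b1.
rewrite RintegralZl//; last first.
  rewrite (_ : _ \o _ = (EFin \o (fun s => lin_form (fun i => b i + b' i) s ^+ 2)%R) \-
   (EFin \o (fun s => lin_form (fun i => b i - b' i) s ^+ 2)%R))%E.
    by apply: integrableB => //; exact: i2.
  by apply/funext => s; rewrite /= EFinB.
rewrite RintegralB//.
rewrite !Ex_lin_form_sqr -sumrB mulr_sumr; apply: eq_bigr => i _.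
by field.
Qed.

End lin_form_moments.

(** * Random matrices *)

Section borel_matrices.
Context {R : realType} (q : nat).

Lemma open_mx_box (U : set 'M[R]_q) (x : 'M[R]_q) : open U -> U x ->
  exists e : R, 0 < e /\ forall y : 'M[R]_q,
    (forall k l, `|x k l - y k l| < e) -> U y.
Proof.
move=> oU Ux; have /nbhs_ballP[e /= e0 eU] : nbhs x U by exact: open_nbhs_nbhs.
exists e; split => // y xy; apply: eU.
by split => // k l; exact: xy.
Qed.

(** An open set of matrices is a countable union of boxes with rational
    corners. *)
Lemma measurable_mx d (T : measurableType d) (V : T -> 'M[R]_q) :
  (forall k l, measurable_fun setT (fun t => V t k l)) ->
  measurable_fun setT (V : T -> borel_mx R q).
Proof.
move=> mV; apply: (@measurability _ _ T (borel_mx R q) setT V (@open 'M[R]_q)) => // _ [U oU <-].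
rewrite setTI.
pose box (ab : 'M[rat]_q * 'M[rat]_q) : set 'M[R]_q :=
  [set y | forall k l, ratr (ab.1 k l) < y k l < ratr (ab.2 k l)].
have -> : V @^-1` U = \bigcup_ab (if `[< box ab `<=` U >] then V @^-1` box ab else set0).
  apply/seteqP; split => [t Ut|t [ab _]]; last first.
    by case: asboolP => // + h; apply.
  have [e [e0 eU]] := open_mx_box oU Ut.
  have lo k l : exists r : rat, V t k l - e < ratr r < V t k l.
    have [|r] := @rat_in_itvoo R (V t k l - e) (V t k l).
      by rewrite ltrBlDr ltrDl.
    by rewrite in_itv/=; exists r.
  have hi k l : exists r : rat, V t k l < ratr r < V t k l + e.
    have [|r] := @rat_in_itvoo R (V t k l) (V t k l + e); first by rewrite ltrDl.
    by rewrite in_itv/=; exists r.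
  exists (\matrix_(k, l) sval (cid (lo k l)), \matrix_(k, l) sval (cid (hi k l))) => //.
  case: asboolP => [_|]; last first.
    case=> y yb; apply: eU => k l; have := yb k l; rewrite /= !mxE.
    case: cid => r1 /= /andP[r1a r1b]; case: cid => r2 /= /andP[r2a r2b] /andP[h1 h2].
    by rewrite ltr_norml; apply/andP; split; lra.
  move=> k l; rewrite /= !mxE.
  case: cid => r1 /= /andP[r1a r1b]; case: cid => r2 /= /andP[r2a r2b].
  by rewrite r1b r2a.
apply: countable_bigcupT_measurable => [|ab]; first exact: countableP.
case: asboolP => // _.
rewrite (_ : V @^-1` _ = \bigcap_(kl : 'I_q * 'I_q)
    ((fun t => V t kl.1 kl.2) @^-1` `]ratr (ab.1 kl.1 kl.2), ratr (ab.2 kl.1 kl.2)[%classic)).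
  apply: fin_bigcap_measurable => // kl _; rewrite -[X in measurable X]setTI.
  exact: mV.
apply/seteqP; split => t h; first by move=> [k l] _; rewrite /= in_itv/=; exact: h.
by move=> k l; have := h (k, l) I; rewrite /= in_itv.
Qed.

Lemma measurable_cont_mx (f : 'M[R]_q -> R) : continuous f ->
  measurable_fun setT (f : borel_mx R q -> R).
Proof.
move=> /continuousP cf; apply: (measurability _ (RGenOpens.measurableE R)).
move=> _ [_ [a [b ->]] <-]; rewrite setTI; apply: sub_sigma_algebra.
by apply: cf; exact: itv_open.
Qed.

Lemma measurable_cont_comp d (T : measurableType d) (V : T -> 'M[R]_q)
    (f : 'M[R]_q -> R) : continuous f ->
  (forall k l, measurable_fun setT (fun t => V t k l)) ->
  measurable_fun setT (fun t => f (V t)).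
Proof.
move=> cf mV; exact: (measurableT_comp (measurable_cont_mx cf) (measurable_mx mV)).
Qed.

End borel_matrices.

(** * The Gaussian matrix *)

Section gaussian_matrix.
Context {R : realType} (q : nat) (A : 'M[R]_q).
Local Notation RR := (measurableTypeR R).
Local Notation gN := (iid_law (@gauss1 R) (q * q)).

(** The coefficients of the entry (k, l) of A G A^T in the entries of G; here G
    is flattened into a tuple. *)
Definition gcoef (k l : 'I_q) (m : 'I_(q * q)) : R :=
  mxvec (\matrix_(i, j) (A k i * A l j)) 0 m.

Definition gmx (s : (q * q).-tuple RR) : 'M[R]_q :=
  \matrix_(k, l) lin_form (gcoef k l) s.

Lemma measurable_gmx_entry k l : measurable_fun setT (fun s => gmx s k l).
Proof.
rewrite (_ : (fun s => _) = lin_form (gcoef k l)).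
  exact: measurable_lin_form.
by apply/funext => s; rewrite mxE.
Qed.

Lemma measurable_gmx : measurable_fun setT (gmx : _ -> borel_mx R q).
Proof. by apply: measurable_mx => k l; exact: measurable_gmx_entry. Qed.

HB.instance Definition _ := isMeasurableFun.Build _ _ _ (borel_mx R q)
  (gmx : _ -> borel_mx R q) measurable_gmx.

Definition gauss_mx : probability (borel_mx R q) R :=
  distribution gN (gmx : _ -> borel_mx R q).

Lemma sum_mxvec (f : 'I_(q * q) -> R) :
  \sum_m f m = \sum_i \sum_j f (mxvec_index i j).
Proof.
rewrite (reindex (uncurry (@mxvec_index q q))); last exact: curry_mxvec_bij.
by rewrite pair_big/=; apply: eq_bigr => -[i j].
Qed.

Lemma gcoef_dot k l s t :
  \sum_m gcoef k l m * gcoef s t m = (A *m A^T) k s * (A *m A^T) l t.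
Proof.
rewrite sum_mxvec !mxE mulr_suml; apply: eq_bigr => i _.
rewrite mulr_sumr; apply: eq_bigr => j _.
by rewrite /gcoef !mxvecE !mxE mulrACA.
Qed.

Lemma integral_gauss_mx (f : 'M[R]_q -> R) :
  measurable_fun setT (f : borel_mx R q -> R) ->
  gN.-integrable setT (EFin \o (fun s => f (gmx s))) ->
  (\int[gauss_mx]_x (f x)%:E = (\int[gN]_s f (gmx s))%:E)%E.
Proof.
move=> mf If; rewrite EFin_Ex// /gauss_mx integral_distribution//.
exact/measurable_EFinP.
Qed.

(** The Gaussian matrix inherits stability from the tuple it is linear in. *)
Lemma Ex_gmx_rotation (a b c : R) (x : 'M[R]_q) (f : 'M[R]_q -> R) :
  c ^+ 2 = a ^+ 2 + b ^+ 2 -> continuous f -> (exists B, forall x, `|f x| <= B) ->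
  \int[gN]_s \int[gN]_t f (x + (a *: gmx s + b *: gmx t)) =
  \int[gN]_s f (x + c *: gmx s).
Proof.
move=> c2 cf [B fB].
have linE s t : gmx (tuple_lin2 a b s t) = a *: gmx s + b *: gmx t.
  apply/matrixP => k l; rewrite !mxE /lin_form !mulr_sumr -big_split/=.
  by apply: eq_bigr => i _; rewrite tnth_mktuple; ring.
have scE s : gmx (tuple_scale c s) = c *: gmx s.
  apply/matrixP => k l; rewrite !mxE /lin_form !mulr_sumr.
  by apply: eq_bigr => i _; rewrite tnth_mktuple; ring.
have bf : bmf (fun s => f (x + gmx s)).
  split; last by exists B.
  apply: measurable_cont_comp cf _ => k l.
  under eq_fun do rewrite mxE.
  apply: (@measurable_funD _ _ R) => //; exact: measurable_gmx_entry.
have := Ex_gauss_tuple_rotation c2 bf.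
under eq_Rintegral do under eq_Rintegral do rewrite linE.
by under [RHS]eq_Rintegral do rewrite scE.
Qed.

Lemma gauss_mx_centered :
  centered_gaussian gauss_mx (fun k l s t => (A *m A^T) k s * (A *m A^T) l t).
Proof.
have mentry k l : measurable_fun setT (@mx_entry R q k l).
  exact: (measurable_cont_mx (@coord_continuous R q q k l)).
have entryE k l s : mx_entry k l (gmx s) = lin_form (gcoef k l) s.
  by rewrite /mx_entry mxE.
have int1 k l : gN.-integrable setT (EFin \o (fun s => mx_entry k l (gmx s))).
  rewrite (_ : _ \o _ = EFin \o lin_form (gcoef k l)).
    exact: lin_form_integrable1.
  by apply/funext => s; rewrite /= entryE.
have mean0 k l : ('E_gauss_mx[mx_entry k l] = 0)%E.
  rewrite unlock (integral_gauss_mx (f := @mx_entry R q k l))//.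
  under eq_Rintegral do rewrite entryE.
  by rewrite Ex_lin_form_id.
split=> // [a|k l s t].
- pose b m := \sum_k \sum_l a k l * gcoef k l m.
  pose c := Num.sqrt (\sum_m b m ^+ 2).
  have c2 : c ^+ 2 = \sum_m b m ^+ 2.
    by rewrite sqr_sqrtr// sumr_ge0// => i _; rewrite sqr_ge0.
  have combE s : \sum_k \sum_l a k l * mx_entry k l (gmx s) = lin_form b s.
    rewrite /lin_form /b; under [RHS]eq_bigr do rewrite mulr_suml.
    rewrite [RHS]exchange_big/=; apply: eq_bigr => k _.
    under [RHS]eq_bigr do rewrite mulr_suml.
    rewrite [RHS]exchange_big/=; apply: eq_bigr => l _.
    by rewrite entryE mulr_sumr; apply: eq_bigr => m _; rewrite mulrA.
  exists 0, c => B mB.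
  rewrite /gauss_mx/= /distribution /pushforward/=.
  transitivity (gN (lin_form b @^-1` B)).
    by congr (gN _); apply/seteqP; split => s /=; rewrite combE.
  rewrite (lin_form_law c2 mB) /normal_law; case: eqVneq => [c0|c0].
    rewrite diracE; have [B0|B0] := boolP (0 \in B).
      rewrite (_ : _ @^-1` B = setT) ?probability_setT//.
      by apply/seteqP; split => // z _; rewrite /= c0 mul0r; exact/set_mem.
    rewrite (_ : _ @^-1` B = set0) ?measure0//.
    apply/seteqP; split => // z /=; rewrite c0 mul0r => B0'.
    by move/negP: B0; apply; rewrite inE.
  have := normal_prob_affine 0 c0 mB; move=> <-.
  by congr (gauss1 _); apply/seteqP; split => z /=; rewrite add0r.
- rewrite covariance.unlock !mean0/= -gcoef_dot -Ex_lin_form_mul unlock.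
  transitivity (\int[gauss_mx]_x (mx_entry k l x * mx_entry s t x)%:E)%E.
    apply: eq_integral => x _; congr EFin.
    by rewrite /= /GRing.mul/= !subr0.
  rewrite (integral_gauss_mx (f := fun x => mx_entry k l x * mx_entry s t x)).
  + by congr EFin; apply: eq_Rintegral => u _; rewrite !entryE.
  + exact: (@measurable_funM _ (borel_mx R q) R).
  rewrite (_ : _ \o _ = EFin \o (fun u => lin_form (gcoef k l) u * lin_form (gcoef s t) u)).
    exact: lin_form_integrable11.
  by apply/funext => u; rewrite /= !entryE.
Qed.

End gaussian_matrix.

(** * Bernstein operators *)

Section bernstein.
Context {R : realFieldType}.

(** The expectation of F at a binomial variable with parameters m and v; the
    recursion conditions upon one trial. *)
Fixpoint bern (m : nat) (F : nat -> R) (v : R) : R :=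
  if m is m'.+1 then v * bern m' (fun k => F k.+1) v + (1 - v) * bern m' F v
  else F 0%N.

Lemma bern_le m F G v : 0 <= v <= 1 -> (forall k, F k <= G k) ->
  bern m F v <= bern m G v.
Proof.
move=> /andP[v0 v1]; elim: m F G => [|m IH] F G FG //=.
by rewrite lerD// ler_wpM2l ?subr_ge0//; apply: IH.
Qed.

Lemma bern_aff m F v (a b : R) :
  bern m (fun k => a + b * F k) v = a + b * bern m F v.
Proof. by elim: m F => [|m IH] F //=; rewrite !IH; ring. Qed.

Lemma bern_cst m (c v : R) : bern m (fun=> c) v = c.
Proof. by elim: m => [|m IH] //=; rewrite !IH; ring. Qed.

(** The binomial variance; the shift c is what the induction on m needs. *)
Lemma bern_sqr m v (c : R) :
  bern m (fun k => (k%:R + c - m%:R * v) ^+ 2) v = m%:R * (v * (1 - v)) + c ^+ 2.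
Proof.
elim: m c => [|m IH] c /=; first by rewrite !mul0r add0r subr0 add0r.
rewrite (_ : (fun k => _) = fun k => (k%:R + (c + 1 - v) - m%:R * v) ^+ 2); last first.
  by apply/funext => k; rewrite -!natr1; congr (_ ^+ 2); ring.
rewrite (_ : (fun k => (k%:R + c - m.+1%:R * v) ^+ 2) = fun k => (k%:R + (c - v) - m%:R * v) ^+ 2); last first.
  by apply/funext => k; rewrite -!natr1; congr (_ ^+ 2); ring.
by rewrite !IH -natr1; ring.
Qed.

Lemma bern_sqr_le m v : (0 < m)%N -> 0 <= v <= 1 ->
  bern m (fun k => (k%:R / m%:R - v) ^+ 2) v <= m%:R^-1.
Proof.
move=> m0 /andP[v0 v1]; have m0' : m%:R != 0 :> R by rewrite pnatr_eq0 -lt0n.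
rewrite (_ : (fun k => _) = fun k => 0 + (m%:R ^- 2) * (k%:R + 0 - m%:R * v) ^+ 2).
  rewrite bern_aff bern_sqr expr0n addr0 add0r.
  rewrite (_ : _ * _ = (v * (1 - v)) * m%:R^-1); last by field.
  rewrite ler_piMl ?invr_ge0// mulr_ile1// ?subr_ge0//.
  by rewrite lerBlDr lerDl.
by apply/funext => k; field.
Qed.

Context {P : finType}.

Definition upd (kap : P -> nat) (p : P) (k : nat) : P -> nat :=
  fun p' => if p' == p then k else kap p'.

(** The Bernstein operator applied in turn to the coordinates listed in ps; the
    others are fixed by kap. *)
Fixpoint mbern (m : nat) (v : P -> R) (ps : seq P) (G : (P -> nat) -> R)
    (kap : P -> nat) : R :=
  if ps is p :: ps' then bern m (fun k => mbern m v ps' G (upd kap p k)) (v p)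
  else G kap.

Lemma mbern_aff m v ps G (a b : R) kap :
  mbern m v ps (fun kap => a + b * G kap) kap = a + b * mbern m v ps G kap.
Proof.
elim: ps kap => [|p ps IH] kap //=.
rewrite -bern_aff; congr (bern m _ _); apply/funext => k; exact: IH.
Qed.

Lemma mbern_le m v ps (G H : (P -> nat) -> R) kap :
  (forall p, 0 <= v p <= 1) -> (forall kap, G kap <= H kap) ->
  mbern m v ps G kap <= mbern m v ps H kap.
Proof.
move=> v01 GH; elim: ps kap => [|p ps IH] kap //=.
by apply: bern_le => // k; exact: IH.
Qed.

Lemma mbern_norm_le m v ps (G : (P -> nat) -> R) (B : R) kap :
  (forall p, 0 <= v p <= 1) -> (forall kap, `|G kap| <= B) ->
  `|mbern m v ps G kap| <= B.
Proof.
move=> v01 GB.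
have cst c : mbern m v ps (fun=> c) kap = c.
  elim: ps kap => [|p ps IH] kap //=.
  by under eq_fun do rewrite IH; rewrite bern_cst.
rewrite ler_norml -[X in X <= _]cst -[X in _ && (_ <= X)]cst.
by apply/andP; split; apply: mbern_le => // k; have := GB k; rewrite ler_norml => /andP[].
Qed.

Lemma mbern_sqr_le m v ps kap : (0 < m)%N -> (forall p, 0 <= v p <= 1) ->
  uniq ps ->
  mbern m v ps (fun kap => \sum_p ((kap p)%:R / m%:R - v p) ^+ 2) kap <=
  \sum_p (if p \in ps then m%:R^-1 else ((kap p)%:R / m%:R - v p) ^+ 2).
Proof.
move=> m0 v01; elim: ps kap => [|p ps IH] kap //=.
move=> /andP[pps ups].
pose C := \sum_(p' | p' != p) (if p' \in p :: ps then m%:R^-1 else ((kap p')%:R / m%:R - v p') ^+ 2).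
apply: (@le_trans _ _ (bern m (fun k => C + 1 * (k%:R / m%:R - v p) ^+ 2) (v p))).
  apply: bern_le => // k; apply: le_trans (IH _ ups) _.
  rewrite (bigD1 p)//= (negbTE pps) /upd eqxx mul1r addrC lerD2r.
  apply: ler_sum => p' p'p; rewrite inE (negbTE p'p)/=.
  by [].
rewrite bern_aff mul1r [leRHS](bigD1 p)//= inE eqxx/= [leRHS]addrC.
by apply: lerD => //; exact: bern_sqr_le.
Qed.

End bernstein.

(** * Test functions with a uniform third-order expansion *)

Section third_order_functions.
Context {R : realType} (q : nat).
Local Notation M := 'M[R]_q.
Local Notation P := ('I_q * 'I_q)%type.

Definition entry_count : R := #|{: P}|%:R.
Local Notation N := entry_count.

Definition lin_part (a : P -> R) (xi : M) : R := \sum_p a p * xi p.1 p.2.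

Definition quad_part (b : P -> P -> R) (xi : M) : R :=
  \sum_p \sum_p' b p p' * (xi p.1 p.2 * xi p'.1 p'.2).

Definition expansion3 (f : M -> R) (K : R) (x : M) (a : P -> R)
    (b : P -> P -> R) (xi : M) :=
  `|f (x + xi) - (f x + lin_part a xi + quad_part b xi)| <= K * `|xi| ^+ 3.

(** The test functions of Lindeberg's argument. One constant bounds the
    coefficients and the remainder at all points, so that every replacement
    costs the same; asking for an expansion instead of derivatives makes
    the stability under sums and products elementary. *)
Definition smooth3 (f : M -> R) := continuous f /\
  exists2 K : R, (forall x, `|f x| <= K) &
    forall x, exists a b, [/\ forall p, `|a p| <= K,
      forall p p', `|b p p'| <= K & forall xi, expansion3 f K x a b xi].

Lemma mx_entry_le_norm (x : M) k l : `|x k l| <= `|x|.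
Proof.
rewrite {2}/Num.norm/= mx_normrE.
by apply: le_bigmax (fun ij : P => `|x ij.1 ij.2|) (k, l).
Qed.

Lemma lin_part_le a xi (K : R) : (forall p, `|a p| <= K) ->
  `|lin_part a xi| <= N * (K * `|xi|).
Proof.
move=> aK; apply: le_trans (ler_norm_sum _ _ _) _.
rewrite (_ : N * _ = \sum_(p : P) K * `|xi|); last by rewrite sumr_const /entry_count -[RHS]mulr_natl.
by apply: ler_sum => p _; rewrite normrM ler_pM// ?mx_entry_le_norm.
Qed.

Lemma quad_part_le b xi (K : R) : (forall p p', `|b p p'| <= K) ->
  `|quad_part b xi| <= N * (N * (K * `|xi| ^+ 2)).
Proof.
move=> bK; apply: le_trans (ler_norm_sum _ _ _) _.
rewrite (_ : N * _ = \sum_(p : P) \sum_(p' : P) K * `|xi| ^+ 2); last first.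
  by rewrite sumr_const /entry_count -[RHS]mulr_natl; congr (_ * _); rewrite sumr_const -[RHS]mulr_natl.
apply: ler_sum => p _; apply: le_trans (ler_norm_sum _ _ _) _.
apply: ler_sum => p' _; rewrite !normrM ler_pM// ?mulr_ge0// expr2.
rewrite ler_pM //; exact: mx_entry_le_norm.
Qed.

Let N0 : 0 <= N. Proof. exact: ler0n. Qed.
#[local] Hint Resolve N0 : core.

(** For increments larger than 1, boundedness of f and of the coefficients gives
    the expansion with a larger constant. *)
Lemma smooth3_local f (K : R) : continuous f -> 0 <= K ->
  (forall x, `|f x| <= K) ->
  (forall x, exists a b, [/\ forall p, `|a p| <= K,
     forall p p', `|b p p'| <= K &
     forall xi, `|xi| <= 1 -> expansion3 f K x a b xi]) -> smooth3 f.
Proof.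
move=> cf K0 fK exp; split => //.
have KK' : K <= (2 + N + N * N) * K.
  by rewrite ler_peMl// -!addrA -[leLHS]addr0 lerD ?ler1n ?addr_ge0 ?mulr_ge0.
exists ((2 + N + N * N) * K) => [x|x]; first exact: le_trans (fK x) KK'.
have [a [b [aK bK ex]]] := exp x; exists a, b; split => [p|p p'|xi].
- exact: le_trans (aK p) KK'.
- exact: le_trans (bK p p') KK'.
have [x1|x1] := leP `|xi| 1.
  by apply: le_trans (ex _ x1) _; rewrite ler_wpM2r// exprn_ge0.
rewrite /expansion3.
have A := lin_part_le xi aK; have B := quad_part_le xi bK.
set m := `|xi| in A B x1 *.
have m1 : 1 <= m ^+ 3 by rewrite exprn_ege1// ltW.
have m2 : m <= m ^+ 3 by rewrite -[leLHS]expr1 ler_eXn2l.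
have m3 : m ^+ 2 <= m ^+ 3 by rewrite ler_eXn2l.
apply: (@le_trans _ _ (K + (K + N * (K * m) + N * (N * (K * m ^+ 2))))).
  by rewrite (le_trans (ler_normB _ _))// lerD// (le_trans (ler_normD _ _))// lerD//
    (le_trans (ler_normD _ _))// lerD.
rewrite (_ : _ * K * m ^+ 3 = K * m ^+ 3 + (K * m ^+ 3 + N * (K * m ^+ 3) +
  N * (N * (K * m ^+ 3)))); last by ring.
have KM : K <= K * m ^+ 3 by rewrite ler_peMr.
apply: lerD => //; apply: lerD; first apply: lerD => //; do ?(apply: ler_wpM2l => //).
Qed.

Lemma smooth3_cst c : smooth3 (fun=> c).
Proof.
split; first exact: cst_continuous.
exists `|c| => // x; exists (fun=> 0), (fun _ _ => 0); split => [p|p p'|xi].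
- by rewrite normr0.
- by rewrite normr0.
rewrite /expansion3 /lin_part /quad_part big1 => [|p _]; last by rewrite mul0r.
rewrite big1 => [|p _]; last by rewrite big1// => p' _; rewrite mul0r.
by rewrite !addr0 subrr normr0 mulr_ge0// exprn_ge0.
Qed.

Lemma smooth3D f g : smooth3 f -> smooth3 g -> smooth3 (fun x => f x + g x).
Proof.
move=> [cf [K fK fe]] [cg [L gL ge]]; split.
  by move=> x; exact: (continuousD (cf x) (cg x)).
exists (K + L) => [x|x]; first by rewrite (le_trans (ler_normD _ _))// lerD.
have [a [b [aK bK ea]]] := fe x; have [a' [b' [a'L b'L eb]]] := ge x.
exists (fun p => a p + a' p), (fun p p' => b p p' + b' p p'); split => [p|p p'|xi].
- by rewrite (le_trans (ler_normD _ _))// lerD.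
- by rewrite (le_trans (ler_normD _ _))// lerD.
rewrite /expansion3.
have -> : lin_part (fun p => a p + a' p) xi = lin_part a xi + lin_part a' xi.
  by rewrite /lin_part -big_split/=; apply: eq_bigr => p _; rewrite mulrDl.
have -> : quad_part (fun p p' => b p p' + b' p p') xi = quad_part b xi + quad_part b' xi.
  rewrite /quad_part -big_split/=; apply: eq_bigr => p _.
  by rewrite -big_split/=; apply: eq_bigr => p' _; rewrite mulrDl.
rewrite mulrDl; apply: le_trans (lerD (ea xi) (eb xi)).
by apply: le_trans (ler_normD _ _); rewrite le_eqVlt; apply/orP; left; apply/eqP; congr (`|_|); ring.
Qed.

Lemma smooth3_max f g : smooth3 f -> smooth3 g -> exists K, [/\ 0 <= K,
  (forall x, `|f x| <= K), (forall x, `|g x| <= K),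
  (forall x, exists a b, [/\ forall p, `|a p| <= K,
      forall p p', `|b p p'| <= K & forall xi, expansion3 f K x a b xi]) &
  (forall x, exists a b, [/\ forall p, `|a p| <= K,
      forall p p', `|b p p'| <= K & forall xi, expansion3 g K x a b xi])].
Proof.
move=> [cf [K fK fe]] [cg [L gL ge]]; exists (Num.max K L).
have KM : K <= Num.max K L by rewrite le_max lexx.
have LM : L <= Num.max K L by rewrite le_max lexx orbT.
split.
- by apply: le_trans KM; apply: le_trans (fK 0).
- by move=> x; exact: le_trans (fK x) KM.
- by move=> x; exact: le_trans (gL x) LM.
- move=> x; have [a [b [aK bK e]]] := fe x; exists a, b.
  split=> *; [exact: le_trans KM|exact: le_trans KM|].
  by apply: le_trans (e _) _; rewrite ler_wpM2r// exprn_ge0.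
- move=> x; have [a [b [aK bK e]]] := ge x; exists a, b.
  split=> *; [exact: le_trans LM|exact: le_trans LM|].
  by apply: le_trans (e _) _; rewrite ler_wpM2r// exprn_ge0.
Qed.

Lemma product_remainder (F G f g A A' B B' : R) :
  F * G - (f * g + (f * A' + g * A) + (f * B' + g * B + A * A')) =
  A * B' + B * A' + B * B' + (F - (f + A + B)) * G +
  (f + A + B) * (G - (g + A' + B')).
Proof. ring. Qed.

Lemma smooth3M f g : smooth3 f -> smooth3 g -> smooth3 (fun x => f x * g x).
Proof.
move=> sf sg; have [K [K0 fK gK fe ge]] := smooth3_max sf sg.
pose c := 3 + N + N ^+ 2 + 2 * N ^+ 3 + N ^+ 4.
have c3 : 3 <= c.
  rewrite -subr_ge0 (_ : c - 3 = N + N ^+ 2 + 2 * N ^+ 3 + N ^+ 4).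
    by do !apply: addr_ge0; rewrite ?mulr_ge0 ?exprn_ge0.
  by rewrite /c; ring.
have cK n : n <= 3 -> n * K ^+ 2 <= c * K ^+ 2.
  by move=> n3; rewrite ler_wpM2r ?exprn_ge0// (le_trans n3).
have KK y z : `|y| <= K -> `|z| <= K -> `|y * z| <= K ^+ 2.
  by move=> yK zK; rewrite normrM expr2 ler_pM.
apply: (@smooth3_local _ (c * K ^+ 2)).
- by move=> x; exact: (continuousM (sf.1 x) (sg.1 x)).
- by rewrite mulr_ge0 ?exprn_ge0// (le_trans _ c3).
- by move=> x; apply: le_trans (KK _ _ (fK x) (gK x)) _; rewrite -[leLHS]mul1r cK// ler1n.
move=> x; have [a [b [aK bK ea]]] := fe x; have [a' [b' [a'K b'K eb]]] := ge x.
exists (fun p => f x * a' p + g x * a p),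
  (fun p p' => f x * b' p p' + g x * b p p' + a p * a' p'); split.
- move=> p; apply: (@le_trans _ _ (2 * K ^+ 2)); last by apply: cK; rewrite ler_nat.
  by rewrite mulr2n mulrDl mul1r (le_trans (ler_normD _ _))// lerD// KK.
- move=> p p'; apply: (@le_trans _ _ (3 * K ^+ 2)); last exact: cK.
  rewrite (_ : 3 * _ = K ^+ 2 + K ^+ 2 + K ^+ 2); last by ring.
  apply: le_trans (ler_normD _ _) _; apply: lerD; last exact: KK.
  by apply: le_trans (ler_normD _ _) _; apply: lerD; exact: KK.
move=> xi xi1; rewrite /expansion3.
have -> : lin_part (fun p => f x * a' p + g x * a p) xi =
    f x * lin_part a' xi + g x * lin_part a xi.
  by rewrite /lin_part !mulr_sumr -big_split/=; apply: eq_bigr => p _; ring.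
have -> : quad_part (fun p p' => f x * b' p p' + g x * b p p' + a p * a' p') xi =
    f x * quad_part b' xi + g x * quad_part b xi + lin_part a xi * lin_part a' xi.
  rewrite /quad_part /lin_part mulr_suml !mulr_sumr -!big_split/=.
  apply: eq_bigr => p _; rewrite !mulr_sumr -!big_split/=.
  by apply: eq_bigr => p' _; ring.
have A := lin_part_le xi aK; have A' := lin_part_le xi a'K.
have B := quad_part_le xi bK; have B' := quad_part_le xi b'K.
have r := ea xi; have r' := eb xi; rewrite /expansion3 in r r'.
have gx := gK (x + xi).
move: (lin_part a xi) (lin_part a' xi) (quad_part b xi) (quad_part b' xi)
  A A' B B' r r' => A A' B B' hA hA' hB hB' r r'.
set rho := f (x + xi) - (f x + A + B) in r.
set rho' := g (x + xi) - (g x + A' + B') in r'.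
have m0 : 0 <= `|xi| by [].
set m := `|xi| in m0 xi1 hA hA' hB hB' r r' *.
rewrite (_ : _ - _ = A * B' + B * A' + B * B' + rho * g (x + xi) +
  (f x + A + B) * rho'); last first.
  exact: product_remainder.
have m43 : m ^+ 4 <= m ^+ 3 by rewrite exprS ler_piMl ?exprn_ge0.
have FAB : `|f x + A + B| <= K * (1 + N + N ^+ 2).
  rewrite !mulrDr mulr1; apply: le_trans (ler_normD _ _) _; apply: lerD.
    apply: le_trans (ler_normD _ _) _; apply: lerD => //.
    by apply: le_trans hA _; rewrite mulrCA ler_wpM2l// ler_piMr.
  apply: le_trans hB _; rewrite [leLHS](_ : _ = K * N ^+ 2 * m ^+ 2); last by ring.
  by rewrite ler_piMr ?mulr_ge0 ?exprn_ge0// exprn_ile1.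
apply: (@le_trans _ _ (N * (K * m) * (N * (N * (K * m ^+ 2))) +
   N * (N * (K * m ^+ 2)) * (N * (K * m)) +
   N * (N * (K * m ^+ 2)) * (N * (N * (K * m ^+ 2))) + K * m ^+ 3 * K +
   K * (1 + N + N ^+ 2) * (K * m ^+ 3))).
  do 4 (apply: le_trans (ler_normD _ _) _; apply: lerD; last by rewrite normrM ler_pM).
  by rewrite normrM ler_pM.
rewrite [leLHS](_ : _ = (2 + N + N ^+ 2 + 2 * N ^+ 3) * K ^+ 2 * m ^+ 3 +
  N ^+ 4 * K ^+ 2 * m ^+ 4); last by ring.
rewrite [leRHS](_ : _ = (3 + N + N ^+ 2 + 2 * N ^+ 3) * K ^+ 2 * m ^+ 3 +
  N ^+ 4 * K ^+ 2 * m ^+ 3); last by rewrite /c; ring.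
apply: lerD; last by rewrite ler_wpM2l// mulr_ge0// exprn_ge0.
rewrite ler_wpM2r ?exprn_ge0// ler_wpM2r ?exprn_ge0//.
by do 3 (apply: lerD; last by []); rewrite ler_nat.
Qed.

Lemma smooth3_lipschitz f : smooth3 f -> exists2 C, 0 <= C &
  forall x xi, `|f (x + xi) - f x| <= C * `|xi|.
Proof.
move=> sf; have [K [K0 fK _ fe _]] := smooth3_max sf sf.
exists ((2 + N + N ^+ 2) * K); first by rewrite mulr_ge0 ?addr_ge0 ?exprn_ge0.
move=> x xi; have [a [b [aK bK e]]] := fe x.
have A := lin_part_le xi aK; have B := quad_part_le xi bK.
have {e} := e xi; rewrite /expansion3.
move: (lin_part a xi) (quad_part b xi) A B => A B hA hB r.
have m0 : 0 <= `|xi| by [].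
have fx := fK x; have fxi := fK (x + xi).
set m := `|xi| in m0 hA hB r *.
have [m1|m1] := leP m 1; last first.
  apply: (@le_trans _ _ (2 * K)).
    by rewrite mulr2n mulrDl mul1r (le_trans (ler_normB _ _))// lerD.
  rewrite -mulrA; apply: ler_pM => //; last by rewrite ler_peMr// ltW.
  by rewrite -addrA lerDl addr_ge0// exprn_ge0.
rewrite (_ : _ - _ = (f (x + xi) - (f x + A + B)) + A + B); last by ring.
apply: (@le_trans _ _ (K * m ^+ 3 + N * (K * m) + N * (N * (K * m ^+ 2)))).
  by do 2 (apply: le_trans (ler_normD _ _) _; apply: lerD => //).
have m3 : m ^+ 3 <= m by rewrite exprSr ler_piMl// exprn_ile1.
have m2 : m ^+ 2 <= m by rewrite expr2 ler_piMl.
rewrite [leRHS](_ : _ = K * m + K * m + N * (K * m) + N * (N * (K * m))); last by ring.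
rewrite !lerD ?ler_wpM2l//.
by rewrite -[leLHS]addr0 lerD ?ler_wpM2l// mulr_ge0.
Qed.

End third_order_functions.

(** * Bounded smooth coordinates *)

Section smooth_squashing.
Context {R : realType}.

(** A bounded coordinate which is invertible on [-1, 1]. It is chosen rational
    so that the remainder of its expansion has a closed form. *)
Definition squash (t : R) : R := t / (1 + t ^+ 2).

Definition unsquash (u : R) : R := 2 * u / (1 + Num.sqrt (1 - 4 * u ^+ 2)).

Let D0 (t : R) : 0 < 1 + t ^+ 2.
Proof. by rewrite ltr_pwDl// sqr_ge0. Qed.

Let Dneq0 (t : R) : 1 + t ^+ 2 != 0.
Proof. by rewrite gt_eqF. Qed.

Lemma squash_le t : `|squash t| <= 2^-1.
Proof.
rewrite /squash normrM normfV (ger0_norm (ltW (D0 t))) ler_pdivrMr//.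
rewrite -(real_normK (num_real t)).
have := sqr_ge0 (`|t| - 1); nra.
Qed.

Lemma squashK t : `|t| <= 1 -> unsquash (squash t) = t.
Proof.
move=> t1; rewrite /unsquash /squash.
have t2 : t ^+ 2 <= 1 by rewrite -(real_normK (num_real t)) exprn_ile1.
rewrite (_ : 1 - 4 * _ = ((1 - t ^+ 2) / (1 + t ^+ 2)) ^+ 2); last first.
  by field; exact: Dneq0.
rewrite sqrtr_sqr ger0_norm; last by rewrite divr_ge0// ?subr_ge0// ltW.
field; rewrite Dneq0/=.
by rewrite (_ : _ + _ = 2) //; ring.
Qed.

Lemma continuous_unsquash : continuous unsquash.
Proof.
have csqr : continuous (fun u : R => 1 + Num.sqrt (1 - 4 * u ^+ 2)).
  move=> u; apply: cvgD; first exact: cvg_cst.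
  apply: continuous_comp; last exact: sqrt_continuous.
  apply: cvgB; first exact: cvg_cst.
  by apply: cvgM; [exact: cvg_cst|exact: exprn_continuous].
move=> u; apply: cvgM; first by apply: cvgM; [exact: cvg_cst|exact: cvg_id].
apply: cvgV; last exact: csqr.
by rewrite gt_eqF// ltr_pwDl// sqrtr_ge0.
Qed.

Lemma continuous_squash : continuous squash.
Proof.
move=> t; apply: cvgM; first exact: cvg_id.
apply: cvgV; first exact: Dneq0.
by apply: cvgD; [exact: cvg_cst|exact: exprn_continuous].
Qed.

Definition squash_d1 (t : R) := (1 - t ^+ 2) / (1 + t ^+ 2) ^+ 2.
Definition squash_d2 (t : R) := t * (t ^+ 2 - 3) / (1 + t ^+ 2) ^+ 3.

Let D1 (t : R) : 1 <= 1 + t ^+ 2.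
Proof. by rewrite lerDl sqr_ge0. Qed.

Lemma squash_d1_le t : `|squash_d1 t| <= 1.
Proof.
rewrite /squash_d1 normrM normfV (ger0_norm (exprn_ge0 _ (ltW (D0 t)))).
rewrite ler_pdivrMr ?exprn_gt0// mul1r ler_norml; have := sqr_ge0 t.
by move: (t ^+ 2) => x x0; apply/andP; split; nra.
Qed.

Let norm_le_sqr (x y : R) : 1 <= y -> x ^+ 2 <= y -> `|x| <= y.
Proof.
move=> y1 xy; have y0 : 0 <= y by rewrite (le_trans _ y1).
rewrite -ler_sqr ?nnegrE// real_normK ?num_real//.
by apply: le_trans xy _; rewrite expr2 ler_peMl.
Qed.

Lemma squash_d2_le t : `|squash_d2 t| <= 1.
Proof.
rewrite /squash_d2 normrM normfV (ger0_norm (exprn_ge0 _ (ltW (D0 t)))).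
rewrite ler_pdivrMr ?exprn_gt0// mul1r; apply: norm_le_sqr.
  exact: exprn_ege1.
rewrite -subr_ge0 (_ : _ - _ = (3 * t ^+ 2 - 1) ^+ 2) ?sqr_ge0//; ring.
Qed.

(** The remainder is - h^3 X / Q. By the Cauchy-Schwarz inequality X^2 <= Q,
    because (t^3 - 3 t)^2 + (3 t^2 - 1)^2 = (1 + t^2)^3. *)
Lemma squash_expansion t h :
  `|squash (t + h) - (squash t + squash_d1 t * h + squash_d2 t * (h * h))| <=
  `|h| ^+ 3.
Proof.
pose X := (t ^+ 3 - 3 * t) * (t + h) - (3 * t ^+ 2 - 1).
pose Q := (1 + t ^+ 2) ^+ 3 * (1 + (t + h) ^+ 2).
have Q1 : 1 <= Q by rewrite -[leLHS]mul1r ler_pM// exprn_ege1.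
have XQ : `|X| <= Q.
  apply: norm_le_sqr => //.
  rewrite -subr_ge0 (_ : _ - _ =
    ((t ^+ 3 - 3 * t) + (3 * t ^+ 2 - 1) * (t + h)) ^+ 2) ?sqr_ge0//.
  rewrite /Q /X; ring.
have Q0 : 0 < Q by rewrite (lt_le_trans _ Q1).
rewrite (_ : _ - _ = - h ^+ 3 * (X / Q)).
  rewrite normrM normrN normrX ler_piMr ?exprn_ge0//.
  by rewrite normrM normfV (gtr0_norm Q0) ler_pdivrMr// mul1r.
rewrite /squash /squash_d1 /squash_d2 /X /Q; field.
by rewrite !Dneq0.
Qed.

End smooth_squashing.

(** * Approximation of continuous functions by test functions *)

Section bernstein_approximation.
Context {R : realType}.

(** Small increments are handled by uniform continuity near the compact set A;
    for the others the quadratic term exceeds 2 B. The modulus is quadratic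
    because Bernstein operators have a small variance. *)
Lemma quadratic_modulus n (A : set 'rV[R]_n) (F : 'rV[R]_n -> R) (B e : R) :
  compact A -> continuous F -> (forall r, `|F r| <= B) -> 0 < e ->
  exists2 C, 0 <= C & forall r v, A v ->
    `|F r - F v| <= e + C * \sum_i (r ord0 i - v ord0 i) ^+ 2.
Proof.
move=> /compact_near_coveringP cA cF FB e0.
pose Q (C : R) (v : 'rV[R]_n) := forall r,
  `|F r - F v| <= e + C * \sum_i (r ord0 i - v ord0 i) ^+ 2.
suff [C [C0 QC]] : exists C, 0 <= C /\ A `<=` Q C.
  by exists C => // r v Av; exact: QC.
have B0 : 0 <= B by rewrite (le_trans _ (FB 0)).
have S0 (r v : 'rV[R]_n) : 0 <= \sum_i (r ord0 i - v ord0 i) ^+ 2.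
  by apply: sumr_ge0 => i _; exact: sqr_ge0.
have near_Q : \forall C \near +oo, A `<=` Q C.
  apply: (cA R (nbhs +oo) Q) => v Av.
  have /cvgrPdist_lt /(_ (e / 2)) := cF v; rewrite divr_gt0// => /(_ isT).
  move=> /nbhs_ballP[dl /= dl0 dlF].
  pose dl2 := dl / 2; have dl20 : 0 < dl2 by rewrite divr_gt0.
  exists (ball v dl2, [set C | 2 * B / dl2 ^+ 2 <= C]).
    split; first exact: nbhsx_ballx.
    by apply: nbhs_pinfty_ge; rewrite num_real.
  move=> [v' C] /= [vv' CB] r.
  have C0 : 0 <= C
    by apply: le_trans CB; apply: divr_ge0; [exact: mulr_ge0|exact: exprn_ge0 _ (ltW dl20)].
  have Fv' : `|F v - F v'| < e / 2.
    apply: dlF; apply: le_ball vv'; rewrite /dl2; lra.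
  have [close|/existsNP[i /negP far]] := pselect (forall i, `|v' ord0 i - r ord0 i| < dl2).
    have Fr : `|F v - F r| < e / 2.
      apply: dlF; rewrite (_ : dl = dl2 + dl2); last by rewrite /dl2; lra.
      apply: ball_triangle vv' _; split => // i j; rewrite !ord1; exact: close.
    have -> : F r - F v' = (F v - F v') - (F v - F r) by ring.
    apply: (@le_trans _ _ e); last by rewrite lerDl mulr_ge0.
    by apply: le_trans (ler_normB _ _) _; move: Fr Fv'; clear; lra.
  apply: (@le_trans _ _ (2 * B)).
    by rewrite mulr2n mulrDl mul1r (le_trans (ler_normB _ _))// lerD.
  apply: (@le_trans _ _ (C * dl2 ^+ 2)).
    by rewrite -ler_pdivrMr ?exprn_gt0.
  apply: (@le_trans _ _ (C * \sum_i (r ord0 i - v' ord0 i) ^+ 2)); last first.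
    by rewrite lerDr ltW.
  apply: ler_wpM2l => //; rewrite (bigD1 i)//=.
  apply: (@le_trans _ _ ((r ord0 i - v' ord0 i) ^+ 2)); last first.
    by rewrite lerDl; apply: sumr_ge0 => j _; exact: sqr_ge0.
  rewrite -(real_normK (num_real (r ord0 i - v' ord0 i))) distrC.
  by rewrite ler_sqr ?nnegrE ?(ltW dl20)// leNgt.
have : \forall C \near +oo, 0 <= C /\ A `<=` Q C.
  by apply: filterI => //; apply: nbhs_pinfty_ge; rewrite num_real.
by move=> /filter_ex.
Qed.

Context (q : nat).
Local Notation M := 'M[R]_q.
Local Notation P := ('I_q * 'I_q)%type.

Lemma continuous_entry (k l : 'I_q) : continuous (fun x : M => x k l).
Proof. exact: coord_continuous. Qed.

Lemma smooth3_squash_entry (kap : R) k l : 0 <= kap <= 1 ->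
  smooth3 (fun x : M => squash (kap * x k l)).
Proof.
move=> /andP[k0 k1]; split.
  move=> x; apply: (@continuous_comp _ _ _ (fun x : M => kap * x k l) squash).
    apply: continuousM; [exact: cst_continuous|exact: continuous_entry].
  exact: continuous_squash.
have kn (z : R) n : `|z| <= 1 -> `|z * kap ^+ n| <= 1.
  by move=> z1; rewrite normrM mulr_ile1// ger0_norm ?exprn_ge0// exprn_ile1.
exists 1 => [x|x]; first by rewrite (le_trans (squash_le _))// invf_le1// ler1n.
exists (fun p => if p == (k, l) then squash_d1 (kap * x k l) * kap ^+ 1 else 0).
exists (fun p p' => if (p == (k, l)) && (p' == (k, l)) then
  squash_d2 (kap * x k l) * kap ^+ 2 else 0); split.
- by move=> p; case: ifP => _; rewrite ?normr0// kn// squash_d1_le.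
- by move=> p p'; case: ifP => _; rewrite ?normr0// kn// squash_d2_le.
move=> xi; rewrite /expansion3 mul1r.
have -> : lin_part (fun p => if p == (k, l) then
    squash_d1 (kap * x k l) * kap ^+ 1 else 0) xi =
    squash_d1 (kap * x k l) * (kap * xi k l).
  rewrite /lin_part (bigD1 (k, l))//= eqxx big1 ?addr0.
    by rewrite expr1 mulrA.
  by move=> p /negbTE ->; rewrite mul0r.
have -> : quad_part (fun p p' => if (p == (k, l)) && (p' == (k, l)) then
    squash_d2 (kap * x k l) * kap ^+ 2 else 0) xi =
    squash_d2 (kap * x k l) * ((kap * xi k l) * (kap * xi k l)).
  rewrite /quad_part (bigD1 (k, l))//= [X in _ + X]big1 ?addr0; last first.
    by move=> p /negbTE ->; rewrite big1// => p' _; rewrite mul0r.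
  rewrite (bigD1 (k, l))//= !eqxx/= big1 ?addr0; first by ring.
  by move=> p /negbTE ->; rewrite mul0r.
rewrite mxE mulrDr; apply: le_trans (squash_expansion _ _) _.
apply: lerXn2r; rewrite ?nnegrE// normrM (ger0_norm k0).
by apply: le_trans (mx_entry_le_norm xi k l); rewrite ler_piMl.
Qed.

Lemma smooth3_bern m (F : nat -> M -> R) (v : M -> R) :
  (forall k, smooth3 (F k)) -> smooth3 v ->
  smooth3 (fun x => bern m (fun k => F k x) (v x)).
Proof.
move=> sF sv; elim: m F sF => [|m IH] F sF /=; first exact: sF.
apply: smooth3D; first by apply: smooth3M => //; apply: IH => k; exact: sF.
apply: smooth3M; last exact: IH.
under eq_fun do rewrite -mulN1r.
by apply: smooth3D; [exact: smooth3_cst|apply: smooth3M => //; exact: smooth3_cst].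
Qed.

Lemma smooth3_mbern (I : finType) m (v : M -> I -> R) (ps : seq I) G kap :
  (forall p, smooth3 (v ^~ p)) -> smooth3 (fun x => mbern m (v x) ps G kap).
Proof.
move=> sv; elim: ps kap => [|p ps IH] kap /=; first exact: smooth3_cst.
exact: (@smooth3_bern m (fun k x => mbern m (v x) ps G (upd kap p k))).
Qed.

Lemma continuous_mx (T : topologicalType) m n (V : T -> 'M[R]_(m, n)) :
  (forall k l, continuous (fun t => V t k l)) -> continuous V.
Proof.
move=> cV t A [/= U Unbhs UA].
apply: (@filterS _ _ _ [set t | forall kl, U kl.1 kl.2 (V t kl.1 kl.2)]).
  by move=> t' tU; apply: UA => k l; exact: (tU (k, l)).
by apply: filter_forall => -[k l]/=; apply: cV; exact: Unbhs.
Qed.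

(** On the ball, f is a continuous function F of the squashed coordinates of x,
    and the approximant is the Bernstein polynomial of F in these coordinates.
    It is an average of values of f, so that it keeps the bound B outside the
    ball. *)
Lemma smooth3_approx (f : M -> R) (B K e : R) : continuous f ->
  (forall x, `|f x| <= B) -> 0 < e ->
  exists g, [/\ smooth3 g, forall x, `|g x| <= B &
    forall x, `|x| <= K -> `|f x - g x| <= e].
Proof.
move=> cf fB e0.
pose L := Num.max 1 K.
have L1 : 1 <= L by rewrite le_max lexx.
have KL : K <= L by rewrite le_max lexx orbT.
have L0 : 0 < L by rewrite (lt_le_trans _ L1).
have Ln0 : L != 0 by rewrite gt_eqF.
(* the rescaled coordinates of the ball lie in [-1, 1], where squash is
   invertible; 1/2 brings its values into [0, 1] *)
pose v (x : M) (i : 'I_(q * q)) := squash (L^-1 * mxvec x ord0 i) + 2^-1.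
have v01 x i : 0 <= v x i <= 1.
  have := squash_le (L^-1 * mxvec x ord0 i); rewrite ler_norml /v; lra.
have sv i : smooth3 (v ^~ i).
  apply: smooth3D; last exact: smooth3_cst.
  have [k l] := mxvec_indexP i.
  under eq_fun do rewrite mxvecE.
  by apply: smooth3_squash_entry; rewrite invr_ge0 (ltW L0) invf_le1.
pose unv (r : 'rV[R]_(q * q)) : 'M[R]_q :=
  \matrix_(k, l) (L * unsquash (r ord0 (mxvec_index k l) - 2^-1)).
pose F r := f (unv r).
have cF : continuous F.
  move=> r; apply: (@continuous_comp _ _ _ unv f); last exact: cf.
  apply: continuous_mx => k l {}r; rewrite /unv.
  rewrite (_ : (fun t => _) = fun t : 'rV[R]_(q * q) =>
    L * unsquash (t ord0 (mxvec_index k l) - 2^-1)); last by apply/funext => t; rewrite mxE.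
  have cu : continuous (fun t : 'rV[R]_(q * q) => unsquash (t ord0 (mxvec_index k l) - 2^-1)).
    move=> t; apply: (@continuous_comp _ _ _
      (fun r : 'rV[R]_(q * q) => r ord0 (mxvec_index k l) - 2^-1) unsquash).
      apply: continuousB; [exact: coord_continuous|exact: cst_continuous].
    exact: continuous_unsquash.
  exact: (continuousM (@cst_continuous _ _ L _) (cu r)).
have unvK x : `|x| <= K -> unv (\row_i v x i) = x.
  move=> xK; apply/matrixP => k l; rewrite !mxE /v addrK squashK ?mulVKf//.
    by rewrite mxvecE.
  rewrite mxvecE normrM normfV (gtr0_norm L0) ler_pdivrMl// mulr1.
  exact: le_trans (mx_entry_le_norm _ _ _) (le_trans xK KL).
have cA : compact [set r : 'rV[R]_(q * q) | forall i, `[0, 1]%classic (r ord0 i)].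
  by apply: (@rV_compact R _ (fun=> `[0, 1]%classic)) => i; exact: segment_compact.
have e20 : 0 < e / 2 by rewrite divr_gt0.
have [C C0 FC] := quadratic_modulus cA cF (fun r => fB (unv r)) e20.
pose S : R := (q * q)%:R.
have [m m0 mC] : exists2 m, (0 < m)%N & C * (S * m%:R^-1) <= e / 2.
  exists (Num.bound ((e / 2)^-1 * (C * S))).+1 => //.
  rewrite mulrA ler_pdivrMr// -ler_pdivrMl//.
  apply: le_trans (ltW (archi_boundP _)) _; first by rewrite mulr_ge0 ?mulr_ge0 ?invr_ge0 ?(ltW e20) ?ler0n.
  by rewrite ler_nat.
pose G (kap : 'I_(q * q) -> nat) := F (\row_i ((kap i)%:R / m%:R)).
exists (fun x => mbern m (v x) (enum 'I_(q * q)) G (fun=> 0%N)); split.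
- exact: smooth3_mbern.
- by move=> x; apply: mbern_norm_le => // kap; exact: fB.
move=> x xK.
pose D (kap : 'I_(q * q) -> nat) := \sum_p ((kap p)%:R / m%:R - v x p) ^+ 2.
have GD kap : `|G kap - f x| <= e / 2 + C * D kap.
  rewrite -[in f x](unvK x xK); apply: le_trans (FC _ _ _) _.
    by move=> i /=; rewrite mxE in_itv/=; exact: v01.
  rewrite lerD2l; apply: ler_wpM2l => //.
  by rewrite le_eqVlt; apply/orP; left; apply/eqP; apply: eq_bigr => i _; rewrite !mxE.
have mD : mbern m (v x) (enum 'I_(q * q)) D (fun=> 0%N) <= S * m%:R^-1.
  apply: le_trans (mbern_sqr_le _ m0 (v01 x) (enum_uniq _)) _.
  under eq_bigr do rewrite mem_enum inE.
  by rewrite sumr_const card_ord -[leLHS]mulr_natl.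
set w0 := (fun=> 0%N) in mD *; set ps := enum _ in mD *.
have hi : mbern m (v x) ps G w0 <= f x + e.
  apply: (@le_trans _ _ (mbern m (v x) ps (fun kap => (f x + e / 2) + C * D kap) w0)).
    apply: mbern_le => // kap; have := GD kap; rewrite ler_norml; lra.
  by rewrite mbern_aff; move: (ler_wpM2l C0 mD) mC; lra.
have lo : f x - e <= mbern m (v x) ps G w0.
  apply: (@le_trans _ _ (mbern m (v x) ps (fun kap => (f x - e / 2) + (- C) * D kap) w0)).
    by rewrite mbern_aff; move: (ler_wpM2l C0 mD) mC; lra.
  apply: mbern_le => // kap; have := GD kap; rewrite ler_norml; lra.
by rewrite ler_norml; apply/andP; split; lra.
Qed.

End bernstein_approximation.

(** * One replacement step *)

Section integrable_sums.
Context {R : realType} d (T : measurableType d) (P : probability T R).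

Lemma integrableD_EFin (f g : T -> R) : P.-integrable setT (EFin \o f) ->
  P.-integrable setT (EFin \o g) ->
  P.-integrable setT (EFin \o (fun w => f w + g w)).
Proof.
move=> If Ig.
by rewrite (_ : _ \o _ = (EFin \o f) \+ (EFin \o g))%E//; exact: integrableD.
Qed.

Lemma integrableZ_EFin (c : R) (f : T -> R) : P.-integrable setT (EFin \o f) ->
  P.-integrable setT (EFin \o (fun w => c * f w)).
Proof.
move=> If; rewrite (_ : _ \o _ = fun w => (c%:E * (EFin \o f) w)%E)//.
exact: integrableZl.
Qed.

Lemma integrable_sum_EFin (I : Type) (r : seq I) (f : I -> T -> R) :
  (forall i, P.-integrable setT (EFin \o f i)) ->
  P.-integrable setT (EFin \o (fun w => \sum_(i <- r) f i w)).
Proof.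
move=> If; elim: r => [|i r IH].
  rewrite (_ : _ \o _ = EFin \o (fun=> 0)); first exact: (bmf_integrable P (bmf_cst _ 0)).
  by apply/funext => w /=; rewrite big_nil.
rewrite (_ : _ \o _ = EFin \o (fun w => f i w + \sum_(i <- r) f i w)).
  exact: integrableD_EFin.
by apply/funext => w /=; rewrite big_cons.
Qed.

Lemma Rintegral_sum (I : Type) (r : seq I) (f : I -> T -> R) :
  (forall i, P.-integrable setT (EFin \o f i)) ->
  \int[P]_w (\sum_(i <- r) f i w) = \sum_(i <- r) \int[P]_w f i w.
Proof.
move=> If; elim: r => [|i r IH].
  by under eq_Rintegral do rewrite big_nil; rewrite big_nil Ex_cst.
under eq_Rintegral do rewrite big_cons.
by rewrite big_cons RintegralD// ?IH//; exact: integrable_sum_EFin.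
Qed.

End integrable_sums.

Section matrix_random_variables.
Context {R : realType} (q : nat).
Local Notation M := 'M[R]_q.
Local Notation I2 := ('I_q * 'I_q)%type.

Lemma bmf_cont_comp d (T : measurableType d) (V : T -> M) (f : M -> R) :
  continuous f -> (exists B, forall x, `|f x| <= B) ->
  (forall k l, measurable_fun setT (fun t => V t k l)) ->
  bmf (fun t => f (V t)).
Proof.
move=> cf [B fB] mV; split; first exact: measurable_cont_comp.
by exists B.
Qed.

Lemma smooth3_bounded (f : M -> R) : smooth3 f ->
  exists B, forall x, `|f x| <= B.
Proof. by move=> [_ [K fK _]]; exists K. Qed.

Lemma mx_norm_pow_le (x : M) n : `|x| ^+ n.+1 <= \sum_(p : I2) `|x p.1 p.2| ^+ n.+1.
Proof.
rewrite {1}/Num.norm/= mx_normrE.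
elim: (index_enum _) => [|p r IH]; first by rewrite !big_nil expr0n.
rewrite !big_cons; set y := \big[Num.max/0]_(_ <- _) _ in IH *.
have S0 : 0 <= \sum_(j <- r) `|x j.1 j.2| ^+ n.+1.
  by apply: sumr_ge0 => j _; exact: exprn_ge0.
have [xy|yx] := leP `|x p.1 p.2| y; first by rewrite (le_trans IH)// lerDr exprn_ge0.
by rewrite lerDl.
Qed.

Lemma mx_norm_le (x : M) (B : R) : 0 <= B -> (forall k l, `|x k l| <= B) -> `|x| <= B.
Proof.
move=> B0 xB; rewrite {1}/Num.norm/= mx_normrE.
by apply/bigmax_leP; split => // -[k l] _; exact: xB.
Qed.

(** What a replacement step has to know about the law of V: the first two
    moments, and an integrable bound for the third power of the norm. *)
Record third_moment_law d (T : measurableType d) (P : probability T R)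
    (V : T -> M) (C : I2 -> I2 -> R) (h : T -> R) : Prop := ThirdMomentLaw {
  tml_measurable : forall k l, measurable_fun setT (fun w => V w k l) ;
  tml_integrable1 : forall p : I2, P.-integrable setT (EFin \o (fun w => V w p.1 p.2)) ;
  tml_integrable2 : forall p p' : I2,
    P.-integrable setT (EFin \o (fun w => V w p.1 p.2 * V w p'.1 p'.2)) ;
  tml_integrable3 : P.-integrable setT (EFin \o h) ;
  tml_mean : forall p : I2, \int[P]_w V w p.1 p.2 = 0 ;
  tml_cov : forall p p' : I2, \int[P]_w (V w p.1 p.2 * V w p'.1 p'.2) = C p p' ;
  tml_third : forall w, `|V w| ^+ 3 <= h w }.

(** The linear part of the expansion has mean zero and the quadratic part
    depends on the law of V only through C. *)
Lemma taylor_expectation d (T : measurableType d) (P : probability T R) V C h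
    (f : M -> R) (K : R) (x : M) (a : I2 -> R) (b : I2 -> I2 -> R) (c : R) :
  third_moment_law P V C h -> continuous f -> (exists B, forall x, `|f x| <= B) ->
  0 <= c -> 0 <= K -> (forall xi, expansion3 f K x a b xi) ->
  `|\int[P]_w f (x + c *: V w) - (f x + c ^+ 2 * \sum_p \sum_p' b p p' * C p p')| <=
  K * c ^+ 3 * \int[P]_w h w.
Proof.
move=> [mV I1 I2' I3 m0 mC hV] cf fB c0 K0 ex.
pose Lw w := lin_part a (c *: V w); pose Qw w := quad_part b (c *: V w).
have LE : Lw = fun w => \sum_p (c * a p) * V w p.1 p.2.
  by apply/funext => w; apply: eq_bigr => p _; rewrite mxE; ring.
have QE : Qw = fun w => \sum_p \sum_p' (c ^+ 2 * b p p') * (V w p.1 p.2 * V w p'.1 p'.2).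
  by apply/funext => w; apply: eq_bigr => p _; apply: eq_bigr => p' _; rewrite !mxE; ring.
have iL : P.-integrable setT (EFin \o Lw).
  by rewrite LE; apply: integrable_sum_EFin => p; exact: integrableZ_EFin.
have iQ : P.-integrable setT (EFin \o Qw).
  rewrite QE; apply: integrable_sum_EFin => p; apply: integrable_sum_EFin => p'.
  exact: integrableZ_EFin.
have EL : \int[P]_w Lw w = 0.
  rewrite LE Rintegral_sum => [|p]; last exact: integrableZ_EFin.
  by rewrite big1// => p _; rewrite RintegralZl// m0 mulr0.
have EQ : \int[P]_w Qw w = c ^+ 2 * \sum_p \sum_p' b p p' * C p p'.
  rewrite QE Rintegral_sum => [|p]; last first.
    by apply: integrable_sum_EFin => p'; exact: integrableZ_EFin.
  rewrite mulr_sumr; apply: eq_bigr => p _.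
  rewrite Rintegral_sum => [|p']; last exact: integrableZ_EFin.
  rewrite mulr_sumr; apply: eq_bigr => p' _.
  by rewrite RintegralZl// mC mulrA.
have bfx : bmf (fun w => f (x + c *: V w)).
  apply: bmf_cont_comp => // k l.
  under eq_fun do rewrite !mxE.
  by apply: measurable_funD => //; exact: measurable_funM.
have ifx := bmf_integrable P bfx.
pose rem w := f (x + c *: V w) - (f x + (Lw w + Qw w)).
have iLQ := integrableD_EFin iL iQ.
have ifLQ := integrableD_EFin (bmf_integrable P (bmf_cst _ (f x))) iLQ.
have irem : P.-integrable setT (EFin \o rem).
  rewrite (_ : _ \o _ = (EFin \o (fun w => f (x + c *: V w)%R)) \-
    (EFin \o (fun w => (f x + (Lw w + Qw w))%R)))%E//.
  exact: integrableB.
have Erem : \int[P]_w rem w =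
    \int[P]_w f (x + c *: V w) - (f x + c ^+ 2 * \sum_p \sum_p' b p p' * C p p').
  rewrite RintegralB// RintegralD//; last exact: (bmf_integrable P (bmf_cst _ (f x))).
  by rewrite (Ex_cst P (f x)) RintegralD// EL EQ add0r.
rewrite -Erem; apply: le_trans (le_normr_Rintegral _ irem) _ => //.
rewrite -RintegralZl//; apply: le_Rintegral => //.
- exact: (integrable_abse irem).
- exact: integrableZ_EFin.
move=> w _; rewrite /rem addrA.
apply: le_trans (ex _) _; rewrite normrZ exprMn (ger0_norm c0) mulrA.
by apply: ler_wpM2l => //; rewrite mulr_ge0// exprn_ge0.
Qed.

Lemma lindeberg_step d (T : measurableType d) (P : probability T R) V h
    d' (T' : measurableType d') (Q : probability T' R) W h' C (f : M -> R) :
  third_moment_law P V C h -> third_moment_law Q W C h' -> smooth3 f ->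
  forall K, (forall x, exists a b, forall xi, expansion3 f K x a b xi) -> 0 <= K ->
  forall (c : R) x, 0 <= c ->
  `|\int[P]_w f (x + c *: V w) - \int[Q]_w f (x + c *: W w)| <=
  K * c ^+ 3 * (\int[P]_w h w + \int[Q]_w h' w).
Proof.
move=> PV QW sf K fe K0 c x c0; have [a [b ex]] := fe x.
have fB := smooth3_bounded sf.
have A := taylor_expectation PV sf.1 fB c0 K0 ex.
have B := taylor_expectation QW sf.1 fB c0 K0 ex.
rewrite mulrDr; apply: le_trans (lerD A B).
set u := \int[P]_w _; set v := \int[Q]_w _; set m := f x + _.
by rewrite (_ : u - v = (u - m) - (v - m)) ?ler_normB//; ring.
Qed.

End matrix_random_variables.

(** * The telescoping sum *)

Section lindeberg.
Context {R : realType} (q : nat) (A : 'M[R]_q).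
Local Notation M := 'M[R]_q.
Local Notation I2 := ('I_q * 'I_q)%type.
Local Notation RR := (measurableTypeR R).
Local Notation gN := (iid_law (@gauss1 R) (q * q)).
Local Notation gm := (gmx A).

Definition kron_cov (p p' : I2) : R :=
  (A *m A^T) p.1 p'.1 * (A *m A^T) p.2 p'.2.

Definition cube_sum (x : M) : R := \sum_(p : I2) `|x p.1 p.2| ^+ 3.

Lemma gmxE s k l : gm s k l = lin_form (gcoef A k l) s.
Proof. by rewrite mxE. Qed.

Lemma gmx_third_moment_law :
  third_moment_law gN gm kron_cov (fun s => cube_sum (gm s)).
Proof.
split.
- exact: measurable_gmx_entry.
- move=> p; under eq_fun do rewrite gmxE; exact: lin_form_integrable1.
- move=> p p'; under eq_fun do rewrite !gmxE; exact: lin_form_integrable11.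
- apply: integrable_sum_EFin => p; under eq_fun do rewrite gmxE.
  exact: lin_form_integrable3.
- move=> p; under eq_Rintegral do rewrite gmxE; exact: Ex_lin_form_id.
- move=> p p'; under eq_Rintegral do rewrite !gmxE.
  by rewrite Ex_lin_form_mul gcoef_dot.
- move=> s; exact: mx_norm_pow_le.
Qed.

Section telescoping.
Context d (T : measurableType d) (P : probability T R) (V : T -> M) (h : T -> R).
Hypothesis PV : third_moment_law P V kron_cov h.

Lemma measurable_sum_entry n k l : measurable_fun setT
  (fun s : n.-tuple T => (\sum_(i < n) V (tnth s i)) k l).
Proof.
under eq_fun do rewrite summxE.
apply: measurable_sum => i.
apply: (measurableT_comp (tml_measurable PV k l)); exact: measurable_tnth.
Qed.

(** Induction on n: given the first summand, the others are replaced by a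
    Gaussian matrix by the induction hypothesis; then the first summand is
    replaced, and stability merges the two Gaussian matrices. *)
Lemma lindeberg_telescope (f : M -> R) (K c : R) n x : smooth3 f ->
  (forall x, exists a b, forall xi, expansion3 f K x a b xi) -> 0 <= K -> 0 <= c ->
  `|\int[iid_law P n]_s f (x + c *: \sum_(i < n) V (tnth s i)) -
    \int[gN]_t f (x + (c * Num.sqrt n%:R) *: gm t)| <=
  n%:R * (K * c ^+ 3 * (\int[P]_w h w + \int[gN]_s cube_sum (gm s))).
Proof.
move=> sf fe K0 c0; have fB := smooth3_bounded sf; have cf := sf.1.
set D := K * _ * _.
have mgm := measurable_gmx_entry A.
elim: n x => [|n IH] x.
  rewrite Ex_iid0 big_ord0 scaler0 addr0 sqrtr0 mulr0 mul0r.
  under eq_Rintegral do rewrite scale0r addr0.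
  by rewrite (Ex_cst gN (f x)) subrr normr0.
have mxc (y : M) k l d' (T' : measurableType d') (U : T' -> M) (e : R) :
    measurable_fun setT (fun t => U t k l) ->
    measurable_fun setT (fun t => (y + e *: U t) k l).
  move=> mU; under eq_fun do rewrite !mxE.
  by apply: measurable_funD => //; exact: measurable_funM.
rewrite Ex_iidS; last by apply: bmf_cont_comp => // k l; apply: mxc; exact: measurable_sum_entry.
have stepE w s : f (x + c *: \sum_(i < n.+1) V (tnth (tuple_cons (w, s)) i)) =
    f ((x + c *: V w) + c *: \sum_(i < n) V (tnth s i)).
  rewrite big_ord_recl tnth_tuple_cons0 scalerDr addrA.
  by congr (f (_ + _ *: _)); apply: eq_bigr => i _; rewrite tnth_tuple_consS.
set cn := c * Num.sqrt n%:R.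
have bf2 : bmf (fun p : T * (q * q).-tuple RR => f ((x + c *: V p.1) + cn *: gm p.2)).
  apply: bmf_cont_comp => // k l; under eq_fun do rewrite mxE [X in _ + X]mxE.
  apply: (@measurable_funD _ _ R).
    exact: (measurableT_comp (mxc x k l _ _ V c (tml_measurable PV k l)) measurable_fst).
  apply: (@measurable_funM _ _ R) => //.
  exact: (measurableT_comp (mgm k l) (@measurable_snd _ _ T ((q * q).-tuple RR))).
have bfs : bmf (fun p : T * n.-tuple T =>
    f ((x + c *: V p.1) + c *: \sum_(i < n) V (tnth p.2 i))).
  apply: bmf_cont_comp => // k l; under eq_fun do rewrite mxE [X in _ + X]mxE.
  apply: measurable_funD.
    apply: (measurableT_comp (mxc x k l _ _ V c (tml_measurable PV k l)) measurable_fst).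
  apply: measurable_funM => //.
  exact: (measurableT_comp (@measurable_sum_entry n k l) measurable_snd).
pose E1 := \int[P]_w \int[gN]_t f ((x + c *: V w) + cn *: gm t).
have first_part : `|\int[P]_w \int[iid_law P n]_s
     f (x + c *: \sum_(i < n.+1) V (tnth (tuple_cons (w, s)) i)) - E1| <= n%:R * D.
  have -> : \int[P]_w \int[iid_law P n]_s
      f (x + c *: \sum_(i < n.+1) V (tnth (tuple_cons (w, s)) i)) =
      \int[P]_w \int[iid_law P n]_s f ((x + c *: V w) + c *: \sum_(i < n) V (tnth s i)).
    by apply: eq_Rintegral => w _; apply: eq_Rintegral => s _; exact: stepE.
  rewrite /E1 -ExB; first last.
  - exact: (bmf_Ex_snd P gN bf2).
  - exact: (bmf_Ex_snd P (iid_law P n) bfs).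
  apply: Ex_bound => [|w]; last exact: IH.
  apply: bmfB; [exact: (bmf_Ex_snd P (iid_law P n) bfs)|exact: (bmf_Ex_snd P gN bf2)].
have E1E : E1 = \int[gN]_t \int[P]_w f ((x + cn *: gm t) + c *: V w).
  rewrite /E1 (Ex_swap P gN bf2).
  by apply: eq_Rintegral => t _; apply: eq_Rintegral => w _; rewrite addrAC.
have bf2' : bmf (fun p : (q * q).-tuple RR * T => f ((x + cn *: gm p.1) + c *: V p.2)).
  have := bmf_comp (@measurable_swap _ _ ((q * q).-tuple RR) T) bf2.
  by under eq_fun do rewrite /= addrAC.
have bfg : bmf (fun p : (q * q).-tuple RR * (q * q).-tuple RR =>
    f ((x + cn *: gm p.1) + c *: gm p.2)).
  apply: bmf_cont_comp => // k l; under eq_fun do rewrite mxE [X in _ + X]mxE.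
  apply: (@measurable_funD _ _ R).
    exact: (measurableT_comp (mxc x k l _ _ gm cn (mgm k l)) (@measurable_fst _ _ ((q * q).-tuple RR) ((q * q).-tuple RR))).
  apply: (@measurable_funM _ _ R) => //.
  exact: (measurableT_comp (mgm k l) (@measurable_snd _ _ ((q * q).-tuple RR) ((q * q).-tuple RR))).
have second_part : `|E1 - \int[gN]_t f (x + (c * Num.sqrt n.+1%:R) *: gm t)| <= D.
  have <- : \int[gN]_t \int[gN]_s f ((x + cn *: gm t) + c *: gm s) =
      \int[gN]_t f (x + (c * Num.sqrt n.+1%:R) *: gm t).
    rewrite -(@Ex_gmx_rotation _ _ A cn c); first last.
    - exact: fB.
    - exact: cf.
    - by rewrite !exprMn !sqr_sqrtr ?ler0n// -natr1 mulrDr mulr1.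
    by apply: eq_Rintegral => t _; apply: eq_Rintegral => s _; rewrite addrA.
  rewrite E1E -ExB; first last.
  - exact: (bmf_Ex_snd gN gN bfg).
  - exact: (bmf_Ex_snd gN P bf2').
  apply: Ex_bound => [|t].
    apply: bmfB; [exact: (bmf_Ex_snd gN P bf2')|exact: (bmf_Ex_snd gN gN bfg)].
  exact: (lindeberg_step PV gmx_third_moment_law sf fe K0 _ c0).
apply: le_trans (ler_distD E1 _ _) _; rewrite -[in leRHS]natr1 mulrDl mul1r.
exact: lerD first_part second_part.
Qed.

End telescoping.
End lindeberg.

(** * A uniform central limit theorem *)

Section uniform_clt.
Context {R : realType} (q : nat) (A : 'M[R]_q).
Local Notation M := 'M[R]_q.
Local Notation I2 := ('I_q * 'I_q)%type.
Local Notation RR := (measurableTypeR R).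
Local Notation gN := (iid_law (@gauss1 R) (q * q)).
Local Notation gm := (gmx A).

Definition sqr_sum (x : M) : R := \sum_(p : I2) x p.1 p.2 ^+ 2.

Lemma sqr_sum_ge0 x : 0 <= sqr_sum x.
Proof. by apply: sumr_ge0 => p _; exact: sqr_ge0. Qed.

Lemma norm_sqr_sum (x : M) : `|x| ^+ 2 <= sqr_sum x.
Proof.
apply: le_trans (mx_norm_pow_le x 1) _; apply: ler_sum => p _.
by rewrite real_normK ?num_real.
Qed.

(** If |x| > K + 1 then |y| > K and the quadratic term exceeds 2 B. It is stated
    in terms of a nearby y because the second moments are known for the
    normalised sum, not for the statistic. *)
Lemma approx_tail (f g : M -> R) (B K e : R) : 0 < K -> 0 <= e ->
  (forall x, `|f x| <= B) -> (forall x, `|g x| <= B) ->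
  (forall x, `|x| <= K + 1 -> `|f x - g x| <= e) ->
  forall x y, `|x - y| <= 1 -> `|f x - g x| <= e + 2 * B / K ^+ 2 * sqr_sum y.
Proof.
move=> K0 e0 fB gB fg x y xy.
have B0 : 0 <= B by rewrite (le_trans _ (fB 0)).
have k0 : 0 <= 2 * B / K ^+ 2 by rewrite divr_ge0 ?mulr_ge0 ?exprn_ge0 ?(ltW K0).
have [xK|xK] := leP `|x| (K + 1).
  by apply: le_trans (fg _ xK) _; rewrite lerDl mulr_ge0// sqr_sum_ge0.
have yK : K < `|y|.
  by have := ler_normD (x - y) y; rewrite subrK; move: xK xy; lra.
apply: (@le_trans _ _ (2 * B)).
  by rewrite mulr2n mulrDl mul1r (le_trans (ler_normB _ _))// lerD.
apply: (@le_trans _ _ (2 * B / K ^+ 2 * sqr_sum y)); last by rewrite lerDr.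
rewrite mulrAC ler_pdivlMr ?exprn_gt0//; apply: ler_wpM2l; first by rewrite mulr_ge0.
apply: le_trans (norm_sqr_sum y); apply: lerXn2r; rewrite ?nnegrE ?(ltW K0)//.
exact: ltW.
Qed.

Context d (T : measurableType d) (w0 : T).

Lemma bounded_third_moment_law (P : probability T R) (V : T -> M) (Bv : R) :
  0 <= Bv ->
  (forall k l, measurable_fun setT (fun w => V w k l)) ->
  (forall w k l, `|V w k l| <= Bv) ->
  (forall p : I2, \int[P]_w V w p.1 p.2 = 0) ->
  (forall p p' : I2, \int[P]_w (V w p.1 p.2 * V w p'.1 p'.2) = kron_cov A p p') ->
  third_moment_law P V (kron_cov A) (fun=> Bv ^+ 3).
Proof.
move=> B0 mV VB V0 VC.
have bV (p : I2) : bmf (fun w => V w p.1 p.2) by split => //; exists Bv.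
split => //.
- by move=> p; exact: bmf_integrable.
- by move=> p p'; apply: (bmf_integrable P); exact: bmfM.
- exact: (bmf_integrable P (bmf_cst _ _)).
- by move=> w; apply: lerXn2r; rewrite ?nnegrE//; exact: mx_norm_le.
Qed.

(** The law P and the summand V come after eta and n0, which makes the theorem
    uniform. As in Slutsky's lemma, X is only close in probability to the
    normalised sum. *)
Lemma uniform_clt (Bv : R) (f : M -> R) (B e : R) : continuous f ->
  (forall x, `|f x| <= B) -> 0 <= Bv -> 0 < e ->
  exists2 eta, 0 < eta & exists n0,
  forall (P : probability T R) (V : T -> M),
    (forall k l, measurable_fun setT (fun w => V w k l)) ->
    (forall w k l, `|V w k l| <= Bv) ->
    (forall p : I2, \int[P]_w V w p.1 p.2 = 0) ->
    (forall p p' : I2, \int[P]_w (V w p.1 p.2 * V w p'.1 p'.2) = kron_cov A p p') ->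
  forall n (X : n.-tuple T -> M), (n0 <= n)%N ->
    (forall k l, measurable_fun setT (fun s => X s k l)) ->
    (iid_law P n [set s | eta < `|X s - (Num.sqrt n%:R)^-1 *: \sum_(i < n) V (tnth s i)|]%R
       <= eta%:E)%E ->
    `|\int[iid_law P n]_s f (X s) - \int[gN]_t f (gm t)| <= e.
Proof.
move=> cf fB Bv0 e0; have B0 : 0 <= B by rewrite (le_trans _ (fB 0)).
(* One eighth of e bounds each of the errors: f against g on the ball, outside
   of it, the remainder on and off the event that it is at most eta, and the
   replacement; the first two occur again for the Gaussian matrix. *)
pose e8 := e / 8; have e80 : 0 < e8 by rewrite divr_gt0.
pose Q1 : R := entry_count q * Bv ^+ 2.
pose Q2 : R := \sum_p kron_cov A p p.
have Q10 : 0 <= Q1 by rewrite mulr_ge0 ?exprn_ge0// /entry_count ler0n.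
have Q20 : 0 <= Q2.
  by apply: sumr_ge0 => p _; rewrite /kron_cov -gcoef_dot; apply: sumr_ge0 => i _; rewrite -expr2 sqr_ge0.
pose K : R := 1 + 2 * B * (Q1 + Q2) / e8.
have K1 : 1 <= K.
  rewrite lerDl; apply: divr_ge0 (ltW e80).
  by apply: mulr_ge0; [exact: mulr_ge0|exact: addr_ge0].
have K0 : 0 < K by rewrite (lt_le_trans _ K1).
pose k2 := 2 * B / K ^+ 2.
have k20 : 0 <= k2 by rewrite divr_ge0 ?mulr_ge0 ?exprn_ge0 ?(ltW K0).
have kQ : k2 * (Q1 + Q2) <= e8.
  rewrite /k2 mulrAC ler_pdivrMr ?exprn_gt0// -ler_pdivrMl//.
  apply: (@le_trans _ _ K); first by rewrite /K [leLHS]mulrC lerDr.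
  by rewrite expr2 ler_peMl// ltW.
have kQ1 : k2 * Q1 <= e8 by apply: le_trans kQ; rewrite ler_wpM2l// lerDl.
have kQ2 : k2 * Q2 <= e8 by apply: le_trans kQ; rewrite ler_wpM2l// lerDr.
have [g [sg gB fg]] := smooth3_approx (K + 1) cf fB e80.
have [C C0 gC] := smooth3_lipschitz sg.
have [L [L0 _ _ gL _]] := smooth3_max sg sg.
pose Mom := Bv ^+ 3 + \int[gN]_s cube_sum (gm s).
have Mom0 : 0 <= Mom.
  rewrite addr_ge0 ?exprn_ge0//; apply: Rintegral_ge0 => s _.
  by apply: sumr_ge0 => p _; rewrite exprn_ge0.
pose eta := Num.min 1 (Num.min (e8 / (C + 1)) (e8 / (2 * B + 1))).
have C1 : 0 < C + 1 by rewrite ltr_wpDl.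
have B1 : 0 < 2 * B + 1 by rewrite ltr_wpDl// mulr_ge0.
have eta0 : 0 < eta by rewrite !lt_min ltr01 !divr_gt0.
have eta1 : eta <= 1 by rewrite ge_min lexx.
have etaC : C * eta <= e8.
  apply: (@le_trans _ _ ((C + 1) * eta)); first by rewrite ler_wpM2r ?lerDl// ltW.
  by rewrite mulrC -ler_pdivlMr// !ge_min lexx orbT.
have etaB : 2 * B * eta <= e8.
  apply: (@le_trans _ _ ((2 * B + 1) * eta)); first by rewrite ler_wpM2r ?lerDl// ltW.
  by rewrite mulrC -ler_pdivlMr// !ge_min lexx !orbT.
pose n0 := (Num.bound ((L * Mom / e8) ^+ 2)).+1.
exists eta => //; exists n0 => P V mV VB V0 VC n X n0n mX Peta.
have PV := bounded_third_moment_law Bv0 mV VB V0 VC.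
have n_gt0 : (0 < n)%N by exact: leq_trans n0n.
have sn0 : 0 < Num.sqrt n%:R :> R by rewrite sqrtr_gt0 ltr0n.
have sn2 : Num.sqrt n%:R ^+ 2 = n%:R :> R by rewrite sqr_sqrtr.
set c := (Num.sqrt n%:R)^-1 in Peta; have c0 : 0 < c by rewrite invr_gt0.
have c2n : c ^+ 2 * n%:R = 1 by rewrite exprVn sn2 mulVf// pnatr_eq0 -lt0n.
pose S (s : n.-tuple T) : M := c *: \sum_(i < n) V (tnth s i).
have mS k l : measurable_fun setT (fun s => S s k l).
  under eq_fun do rewrite mxE; apply: measurable_funM => //.
  exact: (measurable_sum_entry PV).
have bS (p : I2) : bmf (fun s => S s p.1 p.2).
  rewrite (_ : (fun s => _) = fun s => c * \sum_(i < n) V (tnth s i) p.1 p.2).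
    apply: bmfZ; apply: bmf_sum => i; apply: (bmf_tnth i (f := fun w => V w p.1 p.2)).
    by split => //; exists Bv.
  by apply/funext => s; rewrite mxE summxE.
have bsq : bmf (fun s => sqr_sum (S s)) by apply: bmf_sum => p; exact: bmf_exp.
have Esq : \int[iid_law P n]_s sqr_sum (S s) <= Q1.
  rewrite Ex_sum => [|p]; last exact: bmf_exp.
  have -> : Q1 = \sum_(p : I2) Bv ^+ 2 by rewrite sumr_const /Q1 /entry_count -[RHS]mulr_natl.
  apply: ler_sum => p _.
  have bV : bmf (fun w => V w p.1 p.2) by split => //; exists Bv.
  rewrite (_ : \int[_]_s _ = c ^+ 2 *
      \int[iid_law P n]_s ((\sum_(i < n) V (tnth s i) p.1 p.2) ^+ 2)).
    apply: (@le_trans _ _ (c ^+ 2 * (n%:R * Bv ^+ 2))).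
      apply: ler_wpM2l; first exact: sqr_ge0.
      exact: (Ex_iid_sum_sqr_le n w0 bV (V0 p) (fun w => VB w p.1 p.2)).
    by rewrite mulrA c2n mul1r.
  rewrite -ExZ; last first.
    by apply: bmf_exp; apply: bmf_sum => i; exact: (bmf_tnth i bV).
  by apply: eq_Rintegral => s _; rewrite mxE summxE exprMn.
pose Rn s := `|X s - S s|.
have mRn : measurable_fun setT Rn.
  apply: (@measurable_cont_comp _ _ _ _ (fun s => X s - S s) (fun x => `|x|)).
    exact: norm_continuous.
  move=> k l; under eq_fun do rewrite !mxE.
  by apply: measurable_funB => //; have := mS k l; under eq_fun do rewrite mxE.
pose D := [set s | eta < Rn s].
have mD : measurable D by exact: measurable_gt.
have bfX : bmf (fun s => f (X s)) by apply: bmf_cont_comp => //; exists B.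
have bgS : bmf (fun s => g (S s)) by apply: bmf_cont_comp => //; [exact: sg.1|exists B].
have b1D : bmf (\1_D : _ -> R) by exact: bmf_indic.
have Z0 : forall x, `|f x - g x| <= 2 * B.
  by move=> x; rewrite mulr2n mulrDl mul1r (le_trans (ler_normB _ _))// lerD.
pose dom s := (e8 + C * eta) + (k2 * sqr_sum (S s) + 2 * B * \1_D s).
have bdom : bmf dom by apply: bmfD; [exact: bmf_cst|apply: bmfD; exact: bmfZ].
have pointwise s : `|f (X s) - g (S s)| <= dom s.
  have k2S : 0 <= k2 * sqr_sum (S s) by rewrite mulr_ge0// sqr_sum_ge0.
  have Ce : 0 <= C * eta by rewrite mulr_ge0// ltW.
  rewrite /dom indicE; case: (boolP (s \in D)) => [sD|/negP sD].
    apply: (@le_trans _ _ (2 * B)); last first.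
      by rewrite mulr1; move: k2S Ce e80; clear; lra.
    by rewrite mulr2n mulrDl mul1r (le_trans (ler_normB _ _))// lerD.
  have XS : `|X s - S s| <= eta by rewrite leNgt; apply/negP => h; apply: sD; rewrite inE.
  have h1 := approx_tail K0 (ltW e80) fB gB fg (le_trans XS eta1).
  have h2 : `|g (X s) - g (S s)| <= C * eta.
    have := gC (S s) (X s - S s); rewrite [S s + _]addrC subrK => h.
    by apply: le_trans h _; rewrite ler_wpM2l.
  rewrite mulr0 addr0; have := ler_distD (g (X s)) (f (X s)) (g (S s)).
  by move: h1 h2; rewrite -/k2; lra.
have Edom : \int[iid_law P n]_s dom s <= 4 * e8.
  rewrite /dom ExD; [|exact: bmf_cst|by apply: bmfD; exact: bmfZ].
  rewrite (Ex_cst _ (e8 + C * eta)) ExD; [|exact: bmfZ|exact: bmfZ].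
  rewrite !ExZ// Ex_indic//.
  have h1 : 2 * B * fine (iid_law P n D) <= 2 * B * eta.
    apply: ler_wpM2l; first by rewrite mulr_ge0.
    rewrite -lee_fin fineK//; exact: fin_num_measure.
  have h2 := ler_wpM2l k20 Esq.
  by move: h1 h2 kQ1 etaC etaB; clear; lra.
have step1 : `|\int[iid_law P n]_s f (X s) - \int[iid_law P n]_s g (S s)| <= 4 * e8.
  rewrite -ExB//; apply: le_trans (Ex_norm_le _ (bmfB bfX bgS)) _.
  apply: le_trans Edom; apply: Ex_le => //; exact: bmf_norm (bmfB bfX bgS).
have step2 : `|\int[iid_law P n]_s g (S s) - \int[gN]_t g (gm t)| <= e8.
  have := lindeberg_telescope PV n 0 sg _ L0 (ltW c0).
  under eq_Rintegral do rewrite add0r.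
  under [X in _ - X]eq_Rintegral do rewrite add0r mulVf ?gt_eqF// scale1r.
  move=> h; apply: le_trans (h _) _; first by move=> x; have [a [b [_ _ ?]]] := gL x; exists a, b.
  rewrite (Ex_cst P (Bv ^+ 3)) -/Mom.
  rewrite (_ : _ * _ = (L * Mom) * c); last first.
    rewrite (_ : n%:R * _ = (c ^+ 2 * n%:R) * (L * Mom * c)); last by ring.
    by rewrite c2n mul1r.
  rewrite ler_pdivrMr// -ler_pdivrMl// [leLHS]mulrC.
  have LM0 : 0 <= L * Mom / e8 by apply: divr_ge0 (ltW e80); exact: mulr_ge0.
  rewrite -ler_sqr ?nnegrE ?(ltW sn0)// sn2.
  apply: le_trans (ltW (archi_boundP (sqr_ge0 _))) _.
  by rewrite ler_nat (leq_trans _ n0n).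
have bg1 (u : M -> R) : continuous u -> (forall x, `|u x| <= B) -> bmf (fun t => u (gm t)).
  by move=> cu uB; apply: bmf_cont_comp => //; [exists B|exact: measurable_gmx_entry].
have step3 : `|\int[gN]_t g (gm t) - \int[gN]_t f (gm t)| <= 2 * e8.
  have bg := bg1 g sg.1 gB; have bf := bg1 f cf fB.
  have isq : gN.-integrable setT (EFin \o (fun t => sqr_sum (gm t))).
    apply: integrable_sum_EFin => p; under eq_fun do rewrite expr2.
    exact: (tml_integrable2 (gmx_third_moment_law A) p p).
  have EsqG : \int[gN]_t sqr_sum (gm t) = Q2.
    rewrite Rintegral_sum => [|p]; last first.
      under eq_fun do rewrite expr2.
      exact: (tml_integrable2 (gmx_third_moment_law A) p p).
    apply: eq_bigr => p _; under eq_Rintegral do rewrite expr2.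
    exact: (tml_cov (gmx_third_moment_law A) p p).
  rewrite distrC -ExB//; apply: le_trans (Ex_norm_le _ (bmfB bf bg)) _.
  apply: (@le_trans _ _ (\int[gN]_t (e8 + k2 * sqr_sum (gm t)))); last first.
    rewrite RintegralD//; [|exact: (bmf_integrable gN (bmf_cst _ e8))|exact: integrableZ_EFin].
    by rewrite (Ex_cst gN e8) RintegralZl// EsqG; move: kQ2; clear; lra.
  apply: le_Rintegral => //.
  - exact: (bmf_integrable gN (bmf_norm (bmfB bf bg))).
  - apply: integrableD_EFin; [exact: (bmf_integrable gN (bmf_cst _ e8))|exact: integrableZ_EFin].
  move=> t _; apply: (approx_tail K0 (ltW e80) fB gB fg).
  by rewrite subrr normr0.
have -> : e = 8 * e8 by rewrite /e8; field.
have t1 := ler_distD (\int[iid_law P n]_s g (S s)) (\int[iid_law P n]_s f (X s)) (\int[gN]_t f (gm t)).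
have t2 := ler_distD (\int[gN]_t g (gm t)) (\int[iid_law P n]_s g (S s)) (\int[gN]_t f (gm t)).
apply: le_trans t1 _; apply: le_trans (lerD step1 (le_trans t2 (lerD step2 step3))) _.
rewrite (_ : _ + _ = 7 * e8); last by ring.
by rewrite ler_wpM2r ?ler_nat// ltW.
Qed.

End uniform_clt.

(** * Score functions *)

Section score_function_facts.
Context {R : realType} (q : nat) (phi : 'I_q -> R -> R).
Hypothesis hphi : score_functions phi.

Lemma score_out k u : u \notin `]0, 1[ -> phi k u = 0.
Proof.
move=> u01; apply/eqP; apply: contraNT u01 => phi_u.
by have [/(_ k)[_ sub] _ _ _ _] := hphi; apply: sub; exact: subset_closure.
Qed.

Let clip (u : R) := Num.max 0 (Num.min 1 u).

Let clip01 u : clip u \in `[0, 1].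
Proof. by rewrite in_itv/= le_max lexx/= ge_max ler01 ge_min lexx. Qed.

Let score_clip k u : phi k (clip u) = phi k u.
Proof.
rewrite /clip; have [u1|u1] := leP 1 u.
  rewrite max_r//.
  by rewrite !score_out// in_itv/= negb_and -!leNgt ?lexx ?u1 orbT.
have [u0|u0] := leP 0 u; first by [].
by rewrite !score_out// in_itv/= negb_and -!leNgt ?lexx ?(ltW u0).
Qed.

Let clip_lip u v : `|clip u - clip v| <= `|u - v|.
Proof.
wlog uv : u v / u <= v => [H|].
  by case/orP: (le_total u v) => [|vu]; [exact: H|rewrite distrC [leRHS]distrC; exact: H].
rewrite distrC [leRHS]distrC !ger0_norm ?subr_ge0//; last first.
  by rewrite /clip le_max2// le_min2.
rewrite /clip; have [] := leP 1 u; have [] := leP 1 v => v1 u1;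
  rewrite ?(max_r ler01); move: uv v1 u1.
- by rewrite subrr; lra.
- lra.
- by have [] := leP 0 u; lra.
- by have [] := leP 0 u; have [] := leP 0 v; lra.
Qed.

(** As phi k vanishes at 0 and 1 and outside of [0, 1], it is its own composition
    with the clipping onto [0, 1], where it is Lipschitz. *)
Lemma score_lipschitz : exists2 L : R, 0 <= L &
  (forall k u v, `|phi k u - phi k v| <= L * `|u - v|) /\
  (forall k u, `|phi k u| <= L).
Proof.
have [_ lip _ _ _] := hphi.
have lipk k : exists L : R, 0 <= L /\ forall u v, u \in `[0, 1] -> v \in `[0, 1] ->
    `|phi k u - phi k v| <= L * `|u - v|.
  have : \forall M \near +oo, 0 <= M /\ forall u v, u \in `[0, 1] -> v \in `[0, 1] ->
      `|phi k u - phi k v| <= M * `|u - v|.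
    apply: filterI; first by apply: nbhs_pinfty_ge; rewrite num_real.
    have := lip k; rewrite /lipschitz_on; apply: filterS => M HM u v u01 v01.
    by have := HM (u, v); apply.
  by move=> /filter_ex[L hL]; exists L.
pose L := \sum_k sval (cid (lipk k)).
have L0 k : 0 <= sval (cid (lipk k)) by case: cid => ? [].
have LL k : sval (cid (lipk k)) <= L.
  by rewrite /L (bigD1 k)//= lerDl sumr_ge0.
have lipL k u v : `|phi k u - phi k v| <= L * `|u - v|.
  rewrite -score_clip -(score_clip k v).
  apply: (@le_trans _ _ (sval (cid (lipk k)) * `|clip u - clip v|)).
    by case: cid => M /= [_]; apply.
  by apply: ler_pM.
exists L; first exact: sumr_ge0.
split => // k u; rewrite -score_clip.
have := lipL k (clip u) 0; rewrite (score_out k (u := 0)) ?in_itv/= ?ltxx// !subr0.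
move=> /le_trans; apply; rewrite ler_piMr ?sumr_ge0//.
by have := clip01 u; rewrite in_itv/= => /andP[c0 c1]; rewrite ger0_norm.
Qed.

Lemma measurable_score k : measurable_fun setT (phi k).
Proof.
have [L L0 [lip _]] := score_lipschitz.
apply: continuous_measurable_fun => u; apply/cvgrPdist_le => e e0.
have L1 : 0 < L + 1 by rewrite ltr_wpDl.
near=> v; apply: le_trans (lip _ _ _) _.
apply: (@le_trans _ _ ((L + 1) * `|u - v|)); first by rewrite ler_wpM2r// lerDl.
rewrite -ler_pdivlMl// mulrC.
near: v; apply: cvgr_dist_le; first exact: cvg_id.
by rewrite divr_gt0.
Unshelve. all: by end_near. Qed.

Lemma bmf_score k : bmf (phi k).
Proof.
split; first exact: measurable_score.
by have [L _ [_ bd]] := score_lipschitz; exists L.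
Qed.

Lemma score_tau k u : u <= tau_min phi \/ tau_max phi <= u -> phi k u = 0.
Proof.
pose U := \bigcup_k score_support phi k.
have U01 : U `<=` `[0, 1]%classic.
  move=> v [j _ jv]; have [/(_ j)[_ sub] _ _ _ _] := hphi.
  by move: (sub _ jv); rewrite /= !in_itv/= => /andP[/ltW -> /ltW ->].
have Ulb : has_lbound U by exists 0 => v /U01; rewrite /= in_itv/= => /andP[].
have Uub : has_ubound U by exists 1 => v /U01; rewrite /= in_itv/= => /andP[].
have inU v : phi k v != 0 -> U v by move=> v0; exists k => //; exact: subset_closure.
have strict v : v < tau_min phi \/ tau_max phi < v -> phi k v = 0.
  move=> h; apply/eqP; apply/negPn/negP => /inU Uv.
  case: h => h; first by have := ge_inf Ulb Uv; rewrite leNgt h.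
  by have := ub_le_sup Uub Uv; rewrite leNgt h.
have [L L0 [lip _]] := score_lipschitz.
(* the boundary value is a limit of values taken outside of the support *)
have lim v0 (s : R) : `|s| = 1 -> (forall e, 0 < e -> phi k (v0 + s * e) = 0) -> phi k v0 = 0.
  move=> s1 h; apply/eqP; rewrite -normr_le0; apply/ler_addgt0Pr => e e0; rewrite add0r.
  have L1 : 0 < L + 1 by rewrite ltr_wpDl.
  have e1 : 0 < e / (L + 1) by rewrite divr_gt0.
  have := lip k v0 (v0 + s * (e / (L + 1))); rewrite h// subr0 => /le_trans; apply.
  rewrite opprD addrA subrr sub0r normrN normrM s1 mul1r gtr0_norm//.
  rewrite mulrCA -[leRHS]mulr1 ler_wpM2l ?(ltW e0)// ler_pdivrMr// mul1r lerDl.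
  exact: ler01.
case; rewrite le_eqVlt => /predU1P[e|h].
- rewrite e; apply: (lim _ (-1)) => [|eps e0]; first by rewrite normrN normr1.
  by apply: strict; left; rewrite mulN1r ltrBlDr ltrDl.
- by apply: strict; left.
- rewrite -e; apply: (lim _ 1) => [|eps e0]; first by rewrite normr1.
  by apply: strict; right; rewrite mul1r ltrDl.
- by apply: strict; right.
Qed.

End score_function_facts.

Section score_covariance.
Context {R : realType} (q : nat) (phi : 'I_q -> R -> R).
Hypothesis hphi : score_functions phi.

(** The covariance of the scores is a Gram matrix. *)
Lemma score_cov_factor : exists A : 'M[R]_q, forall k s,
  (A *m A^T) k s = score_cov phi k s.
Proof.
pose S : 'M[R]_q := \matrix_(k, s) score_cov phi k s.
have bs k := bmf_score hphi k.
have SE k s : S k s = \int[uniform_prob (@ltr01 R)]_u (phi k u * phi s u).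
  by rewrite mxE /score_cov -Ex_uniform//; exact: bmfM (bs k) (bs s).
have ST : S^T = S.
  apply/matrixP => k s; rewrite mxE !SE; apply: eq_Rintegral => u _.
  by rewrite mulrC.
have Spsd (v : 'rV[R]_q) : 0 <= (v *m S *m v^T) 0 0.
  have -> : (v *m S *m v^T) 0 0 =
      \int[uniform_prob (@ltr01 R)]_u ((\sum_k v 0 k * phi k u) ^+ 2).
    have bkl s k : bmf (fun u => v 0 k * phi k u * (v 0 s * phi s u)).
      exact: bmfM (bmfZ _ (bs k)) (bmfZ _ (bs s)).
    rewrite mxE.
    transitivity (\sum_s \sum_k \int[uniform_prob (@ltr01 R)]_u
        (v 0 k * phi k u * (v 0 s * phi s u))).
      apply: eq_bigr => s _; rewrite !mxE mulr_suml; apply: eq_bigr => k _.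
      rewrite SE -ExZ; last exact: bmfM (bs k) (bs s).
      rewrite -ExZr; last exact: bmfZ _ (bmfM (bs k) (bs s)).
      by apply: eq_Rintegral => u _; ring.
    transitivity (\sum_s \int[uniform_prob (@ltr01 R)]_u
        (\sum_k v 0 k * phi k u * (v 0 s * phi s u))).
      apply: eq_bigr => s _.
      by rewrite (Ex_sum (uniform_prob (@ltr01 R)) _ (bkl s)).
    rewrite -Ex_sum; last by move=> s; apply: bmf_sum => k; exact: bkl.
    apply: eq_Rintegral => u _; rewrite expr2 mulr_sumr.
    by apply: eq_bigr => s _; rewrite mulr_suml.
  by apply: Rintegral_ge0 => u _; exact: sqr_ge0.
have [A SA] := psd_factor ST Spsd.
by exists A => k s; rewrite -SA mxE.
Qed.

End score_covariance.

(** * Quantiles and plug-in ranks *)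

Section quantiles.
Context {R : realType}.

Definition quantile (G : R -> R) (tau : R) : R :=
  inf [set t | t \in `[0, 1] /\ tau <= G t].

Variable G : R -> R.
Hypotheses (cG : continuous G) (G1 : G 1 = 1).

Let level (tau : R) : set R := [set t | t \in `[0, 1] /\ tau <= G t].

Let level_lb tau : has_lbound (level tau).
Proof. by exists 0 => t [/[!in_itv]/= /andP[]]. Qed.

Let level_neq0 tau : tau <= 1 -> level tau !=set0.
Proof. by move=> t1; exists 1; split; rewrite ?G1// in_itv/= lexx ler01. Qed.

Lemma quantile01 tau : tau <= 1 -> 0 <= quantile G tau <= 1.
Proof.
move=> t1; apply/andP; split.
  by apply: lb_le_inf; [exact: level_neq0|move=> t [/[!in_itv]/= /andP[]]].
by apply: (ge_inf (level_lb tau)); split; rewrite ?G1// in_itv/= lexx ler01.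
Qed.

Lemma quantile_le tau sig : tau <= sig -> sig <= 1 -> quantile G tau <= quantile G sig.
Proof.
move=> ts s1; apply: lb_le_inf; first exact: level_neq0.
move=> t [t01 st]; apply: (ge_inf (level_lb tau)); split => //.
exact: le_trans ts st.
Qed.

Lemma lt_quantile tau x : x \in `[0, 1] -> x < quantile G tau -> G x < tau.
Proof.
move=> x01 xq; rewrite ltNge; apply/negP => Gx.
have : quantile G tau <= x by apply: (ge_inf (level_lb tau)); split.
by rewrite leNgt xq.
Qed.

Lemma quantile_ge tau : tau <= 1 -> tau <= G (quantile G tau).
Proof.
move=> t1; rewrite leNgt; apply/negP => Gq.
have := @cG (quantile G tau); move/cvgrPdist_lt/(_ (tau - G (quantile G tau))).
rewrite subr_gt0 => /(_ Gq) /nbhs_ballP[dl /= dl0 h].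
have [t [t01 Gt] tq] := inf_adherent dl0 (conj (level_neq0 t1) (level_lb tau)).
have qt : quantile G tau <= t by apply: (ge_inf (level_lb tau)); split.
have /h : ball (quantile G tau) dl t.
  by rewrite /ball/= ler0_norm ?subr_le0//; move: tq; rewrite /quantile; lra.
by rewrite ltr_norml; move: Gt; lra.
Qed.

Lemma quantile_attained tau : tau <= 1 -> 0 < quantile G tau -> G (quantile G tau) <= tau.
Proof.
move=> t1 q0; rewrite leNgt; apply/negP => Gq.
have := @cG (quantile G tau); move/cvgrPdist_lt/(_ (G (quantile G tau) - tau)).
rewrite subr_gt0 => /(_ Gq) /nbhs_ballP[dl /= dl0 h].
have /andP[_ q1] := quantile01 t1.
pose t := Num.max 0 (quantile G tau - dl / 2).
have tq : t < quantile G tau by rewrite gt_max q0/= ltrBlDr ltrDl divr_gt0.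
have t0 : 0 <= t by rewrite le_max lexx.
have td : quantile G tau - dl / 2 <= t by rewrite le_max lexx orbT.
have /h : ball (quantile G tau) dl t.
  by rewrite /ball/= gtr0_norm ?subr_gt0//; move: td dl0; lra.
have := @lt_quantile tau t _ tq; rewrite in_itv/= t0 (ltW (lt_le_trans tq q1)).
by move=> /(_ isT); rewrite ltr_norml; lra.
Qed.

End quantiles.

Section plug_in_error.
Context {R : realType}.

(** Outside the quantile range the score of the true rank vanishes; there,
    monotonicity carries the error bound at the nearest end of the range over
    to the estimated rank, so that the estimated rank is nearly beyond the
    level where the score starts to vanish. *)
Lemma plug_in_score (psi : R -> R) (L tmin tmax a : R) (F Fh : R -> R) (x : R) :
  0 <= L -> (forall u v, `|psi u - psi v| <= L * `|u - v|) ->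
  (forall u, u <= tmin \/ tmax <= u -> psi u = 0) ->
  tmin <= tmax -> tmax <= 1 -> continuous F -> {homo F : s t / s <= t} -> F 1 = 1 ->
  {in `[0, 1] &, {homo Fh : s t / s <= t}} ->
  (forall t, quantile F tmin <= t <= quantile F tmax -> `|F t - Fh t| <= a) ->
  x \in `[0, 1] -> `|psi (Fh x) - psi (F x)| <= L * a.
Proof.
move=> L0 lip psi0 tt t1 cF Fmono F1 Fhmono Fa x01.
have tmin1 := le_trans tt t1.
set Qm := quantile F tmin in Fa *; set QM := quantile F tmax in Fa *.
have QmM : Qm <= QM by exact: quantile_le.
have Qm01 : Qm \in `[0, 1] by rewrite in_itv/=; exact: quantile01.
have QM01 : QM \in `[0, 1] by rewrite in_itv/=; exact: quantile01.
have FQm : `|F Qm - Fh Qm| <= a by apply: Fa; rewrite lexx.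
have FQM : `|F QM - Fh QM| <= a by apply: Fa; rewrite lexx andbT.
have a0 : 0 <= a by rewrite (le_trans _ FQm).
have [xm|xm] := ltP x Qm.
  have Fx : F x < tmin by exact: lt_quantile xm.
  rewrite (psi0 (F x)); last by left; exact: ltW.
  have [Fhx|Fhx] := leP (Fh x) tmin.
    by rewrite (psi0 (Fh x)) ?subrr ?normr0 ?mulr_ge0//; left.
  rewrite -(psi0 tmin); last by left.
  apply: le_trans (lip _ _) _; apply: ler_wpM2l => //.
  rewrite gtr0_norm ?subr_gt0//.
  have Qm0 : 0 < Qm by move: x01 xm; rewrite in_itv/= => /andP[x0 _]; exact: le_lt_trans.
  have h1 : F Qm <= tmin by exact: quantile_attained.
  have h2 : Fh x <= Fh Qm by apply: Fhmono => //; exact: ltW.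
  by move: FQm; rewrite ler_norml; lra.
have [xM|xM] := leP x QM.
  apply: le_trans (lip _ _) _; apply: ler_wpM2l => //.
  by rewrite distrC; apply: Fa; rewrite xm xM.
have h0 : tmax <= F QM by exact: quantile_ge.
have Fx : tmax <= F x by apply: le_trans h0 _; apply: Fmono; exact: ltW.
rewrite (psi0 (F x)); last by right.
have [Fhx|Fhx] := leP tmax (Fh x).
  by rewrite (psi0 (Fh x)) ?subrr ?normr0 ?mulr_ge0//; right.
rewrite -(psi0 tmax); last by right.
apply: le_trans (lip _ _) _; apply: ler_wpM2l => //.
rewrite ltr0_norm ?subr_lt0// opprB.
have h2 : Fh QM <= Fh x by apply: Fhmono => //; exact: ltW.
by move: FQM; rewrite ler_norml; lra.
Qed.

End plug_in_error.

(** * Estimated scores *)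

Section plug_in_scores.
Context {R : realType} (d q : nat) (phi : 'I_q -> R -> R).
Hypothesis hphi : score_functions phi.
Local Notation Z := (d.-tuple R).
Local Notation obsT := (obs R d).

(** V is one of the two observed coordinates. *)
Variable V : obsT -> R.
Hypothesis mV : measurable_fun setT V.
Hypothesis V01 : forall w, unit_obs w -> V w \in `[0, 1].

Definition coord_sample n (s : n.-tuple obsT) : n.-tuple (R * Z) :=
  [tuple of map (fun w => (V w, w.2)) s].

Lemma measurable_coord_sample n :
  measurable_fun setT (@coord_sample n).
Proof.
apply/measurable_fun_tnthP => i /=.
rewrite (_ : _ \o _ = fun s : n.-tuple obsT => (V (tnth s i), (tnth s i).2)).
  apply: measurable_fun_pair.
    exact: (measurableT_comp mV (measurable_tnth i)).
  exact: (measurableT_comp (@measurable_zcoord R d) (measurable_tnth i)).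
by apply/funext => s /=; rewrite tnth_map.
Qed.

Variable F : forall n, n.-tuple (R * Z) -> R -> Z -> R.
Hypothesis hF : estimator F.

Definition est_rank n (i : 'I_n) (s : n.-tuple obsT) : R :=
  F (coord_sample s) (V (tnth s i)) (tnth s i).2.

Lemma measurable_est_rank n (i : 'I_n) : measurable_fun setT (est_rank i).
Proof.
have := measurableT_comp (hF.2 n i) (@measurable_coord_sample n).
by congr measurable_fun; apply/funext => s /=; rewrite /est_rank tnth_map.
Qed.

Lemma bmf_est_score n (i : 'I_n) k : bmf (fun s => phi k (est_rank i s)).
Proof. exact: bmf_comp (@measurable_est_rank n i) (bmf_score hphi k). Qed.

Section one_law.
Variable kern : R.-pker Z ~> R.

Definition true_rank (w : obsT) : R := cond_cdf kern (V w) w.2.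

Lemma bmf_true_score k : bmf (fun w => phi k (true_rank w)).
Proof. exact: bmf_comp (measurable_cond_cdf kern mV) (bmf_score hphi k). Qed.

Definition score_err n (k : 'I_q) (i : 'I_n) (s : n.-tuple obsT) : R :=
  phi k (est_rank i s) - phi k (true_rank (tnth s i)).

Lemma bmf_score_err n k (i : 'I_n) : bmf (score_err k i).
Proof.
apply: bmfB; first exact: bmf_est_score.
exact: (bmf_tnth i (bmf_true_score k)).
Qed.

Definition large_err n (t : R) : set (n.-tuple obsT) :=
  \bigcup_(ik : 'I_n * 'I_q) [set s | t < `|score_err ik.2 ik.1 s|].

Lemma measurable_large_err n t : measurable (large_err t : set (n.-tuple obsT)).
Proof.
apply: fin_bigcup_measurable => // -[i k] _ /=.
exact: measurable_tail (bmf_score_err k i).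
Qed.

Let kern_le1 z A : measurable A -> (kern z A <= 1)%E.
Proof.
by move=> mA; rewrite -(prob_kernel (s := kern) z); apply: le_measure; rewrite ?inE.
Qed.

Let kern_fin z A : measurable A -> kern z A \is a fin_num.
Proof.
by move=> mA; rewrite ge0_fin_numE//; apply: le_lt_trans (ltry 1); exact: kern_le1.
Qed.

Lemma cond_cdf_homo z : {homo (fun t => cond_cdf kern t z) : s t / s <= t}.
Proof.
move=> s t st; rewrite /cond_cdf; apply: fine_le.
- exact: kern_fin.
- exact: kern_fin.
apply: le_measure; rewrite ?inE//.
by move=> u /=; rewrite !in_itv/= => us; exact: le_trans st.
Qed.

Lemma cond_cdf1 z : kern z `[0, 1]%classic = 1%E -> cond_cdf kern 1 z = 1.
Proof.
move=> k1; rewrite /cond_cdf (_ : kern z _ = 1%E)//.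
apply/eqP; rewrite eq_le kern_le1//= -k1.
apply: le_measure; rewrite ?inE//.
by move=> u /=; rewrite !in_itv/= => /andP[].
Qed.

Lemma tau_order : (0 < q)%N -> tau_min phi <= tau_max phi /\ tau_max phi <= 1.
Proof.
move=> q0; pose k := Ordinal q0.
pose U := \bigcup_k score_support phi k.
have U01 : U `<=` `[0, 1]%classic.
  move=> v [j _ jv]; have [/(_ j)[_ sub] _ _ _ _] := hphi.
  by move: (sub _ jv); rewrite /= !in_itv/= => /andP[/ltW -> /ltW ->].
have [v phiv] : exists v, phi k v != 0.
  have [//|h] := pselect (exists v, phi k v != 0).
  have [_ _ _ /(_ k) h1 _] := hphi; move: h1.
  rewrite (_ : (fun u => phi k u ^+ 2) = fun=> 0).
    by rewrite /Rintegral integral0 => /eqP; rewrite eq_sym oner_eq0.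
  apply/funext => u; apply/eqP; rewrite expf_eq0/=; apply/negPn/negP => u0.
  by apply: h; exists u.
have Uv : U v by exists k => //; exact: subset_closure.
have Ulb : has_lbound U by exists 0 => u /U01; rewrite /= in_itv/= => /andP[].
have Uub : has_ubound U by exists 1 => u /U01; rewrite /= in_itv/= => /andP[].
split; first exact: le_trans (ge_inf Ulb Uv) (ub_le_sup Uub Uv).
by apply: ge_sup; [exists v|move=> u /U01; rewrite /= in_itv/= => /andP[]].
Qed.

Hypothesis q_gt0 : (0 < q)%N.
Hypothesis kern_good : forall z, cube z ->
  kern z `[0, 1]%classic = 1%E /\ continuous (fun t => cond_cdf kern t z).

Lemma score_err_le (L a : R) n (s : n.-tuple obsT) :
  0 <= L -> (forall k u v, `|phi k u - phi k v| <= L * `|u - v|) ->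
  (forall i, unit_obs (tnth s i)) ->
  (forall z t, cube z -> quantile_range kern (tau_min phi) (tau_max phi) z t ->
     `|cond_cdf kern t z - F (coord_sample s) t z| <= a) ->
  forall i k, `|score_err k i s| <= L * a.
Proof.
move=> L0 lip s01 Fa i k.
have [tmM tM1] := tau_order q_gt0.
have zi : cube (tnth s i).2 by have [] := s01 i.
have [k1 ck] := kern_good zi.
have [_ homoF _ _] : [/\ {within `[0, 1], continuous (fun t => F (coord_sample s) t (tnth s i).2)},
    {in `[0, 1] &, {homo (fun t => F (coord_sample s) t (tnth s i).2) : t u / t <= u}},
    F (coord_sample s) 0 (tnth s i).2 = 0 & F (coord_sample s) 1 (tnth s i).2 = 1].
  apply: hF.1 => // j; rewrite tnth_map /=; split; first exact: V01.
  by have [] := s01 j.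
apply: (@plug_in_score R (phi k) L (tau_min phi) (tau_max phi) a
  (fun t => cond_cdf kern t (tnth s i).2) (fun t => F (coord_sample s) t (tnth s i).2)) => //.
- by move=> u; exact: score_tau.
- exact: cond_cdf_homo.
- exact: cond_cdf1.
- by move=> t tq; apply: Fa => //; rewrite /quantile_range /= in_itv.
- exact: V01.
Qed.

End one_law.
End plug_in_scores.

(** * Bounds on the estimation errors *)

Section stochastic_bounds.
Context {R : realType} (d q : nat) (phi : 'I_q -> R -> R).
Hypotheses (q_gt0 : (0 < q)%N) (hphi : score_functions phi).
Local Notation Z := (d.-tuple R).
Local Notation obsT := (obs R d).
Variable L : R.
Hypotheses (L0 : 0 <= L) (lip : forall k u v, `|phi k u - phi k v| <= L * `|u - v|)
  (phiL : forall k u, `|phi k u| <= L).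

Section one_coordinate.
Variable V : obsT -> R.
Hypothesis mV : measurable_fun setT V.
Hypothesis V01 : forall w, unit_obs w -> V w \in `[0, 1].
Variable F : forall n, n.-tuple (R * Z) -> R -> Z -> R.
Hypothesis hF : estimator F.

Lemma sup_norm_on_le (D : Z -> set R) (f : R -> Z -> R) (g B : R) : g != 0 ->
  (`|sup_norm_on D f * (g^-1)%:E| <= B%:E)%E ->
  forall z t, cube z -> D z t -> `|f t z| <= B * `|g|.
Proof.
move=> g0 AB z t cz Dt; rewrite -ler_pdivrMr ?normr_gt0//.
rewrite -lee_fin; apply: le_trans AB.
rewrite abseM EFinM; apply: lee_pmul => //; last by rewrite /= normfV.
apply: le_trans (lee_abs _); apply: le_trans (ereal_sup_ubound _); last by exists z.
by apply: ereal_sup_ubound; exists t.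
Qed.

(** The assumption bounds an outer measure, which is only known to be monotone.
    The event of a large error is measurable, and on samples in the unit cube,
    which have probability one, it is contained in the exceptional set of the
    assumption. *)
Lemma large_err_prob (M : set (probability obsT R))
    (kern : probability obsT R -> R.-pker Z ~> R) (g : nat -> R) :
  M `<=` @abs_cont_laws R d -> (forall P, M P -> cond_dist P V (kern P)) ->
  unif_bigO M (fun P n s =>
     sup_norm_on (quantile_range (kern P) (tau_min phi) (tau_max phi))
       (fun t z => cond_cdf (kern P) t z - F (coord_sample V s) t z)) g ->
  forall dl, 0 < dl -> exists2 B, 0 < B & forall P n, M P -> (0 < n)%N ->
    (iid_law P n (large_err phi V F (kern P) (L * (B * `|g n|))) <= dl%:E)%E.
Proof.
move=> Mac Mk [g0 bigO] dl dl0; have [B B0 supB] := bigO dl dl0.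
exists B => // P n MP n0.
set E := large_err _ _ _ _ _.
have mE : measurable E by exact: measurable_large_err.
pose G := [set s : n.-tuple obsT | forall i, unit_obs (tnth s i)].
have mG : measurable G.
  rewrite (_ : G = \bigcap_(i : 'I_n) ((fun s => tnth s i) @^-1` @unit_obs R d)).
    apply: fin_bigcap_measurable => // i _; rewrite -[X in measurable X]setTI.
    by apply: measurable_tnth => //; exact: measurable_unit_obs.
  by apply/seteqP; split => s h i; [move=> _; exact: h|exact: (h i)].
have PG : iid_law P n G = 1%E.
  by apply: iid_law_all; [exact: measurable_unit_obs|have [] := Mac P MP].
rewrite -(measure_setI_full mE mG PG).
rewrite -(measurable_mu_extE (iid_law P n) (measurableI _ _ mE mG)).
apply: le_trans (ltW supB).
pose A (s : n.-tuple obsT) := sup_norm_on (quantile_range (kern P) (tau_min phi) (tau_max phi))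
       (fun t z => cond_cdf (kern P) t z - F (coord_sample V s) t z).
apply: (@le_trans _ _ (((iid_law P n)^*)%mu [set s | B%:E < `|A s * ((g n)^-1)%:E|]%E)).
  apply: le_mu_ext => s [Es Gs]; rewrite /= ltNge; apply/negP => AB.
  have [[i k] _ /=] := Es; rewrite ltNge => /negP; apply.
  apply: (score_err_le hphi V01 hF q_gt0 (Mk P MP).2 L0 lip Gs).
  exact: (sup_norm_on_le (g0 _ n0) AB).
apply: le_trans (ereal_sup_ubound _); last by right; exists n.
by apply: ereal_sup_ubound; right; exists P.
Qed.

Variable kern : R.-pker Z ~> R.
Local Notation err := (score_err phi V F kern).

Lemma score_err_bound n k (i : 'I_n) s : `|err k i s| <= 2 * L.
Proof. by rewrite mulr2n mulrDl mul1r (le_trans (ler_normB _ _))// lerD. Qed.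

Variables (V' : obsT -> R) (kern' : R.-pker Z ~> R).
Hypothesis mV' : measurable_fun setT V'.
Variable P : probability obsT R.
Hypothesis acP : abs_cont_laws P.
Hypotheses (dk : cond_dist P V kern) (dk' : cond_dist P V' kern').
Hypothesis indep : forall A B, measurable A -> measurable B -> forall p r,
  cond_prob_version P (V @^-1` A) p -> cond_prob_version P (V' @^-1` B) r ->
  cond_prob_version P (V @^-1` A `&` V' @^-1` B) (p \* r).
Variable mk : R * Z -> obsT.
Hypotheses (mmk : measurable_fun setT mk) (mkK : cancel mk (fun w => (V w, w.2))).

(** The estimation errors of the ranks of V are functions of the sample of
    (V, Z); given it, the scores of the ranks of V' remain independent and
    centred, so that the cross products cancel in the second moment. *)
Lemma cross_term_sqr n k l (t dl : R) : 0 <= t ->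
  (iid_law P n (large_err phi V F kern t) <= dl%:E)%E ->
  \int[iid_law P n]_s
     ((\sum_(i < n) err k i s * phi l (true_rank V' kern' (tnth s i))) ^+ 2) <=
  n%:R * (L ^+ 2 * (t ^+ 2 + 4 * L ^+ 2 * dl)).
Proof.
move=> t0 Edl.
pose W (w : obsT) := (V w, w.2).
pose psi w := phi l (true_rank V' kern' w).
have bpsi : bmf psi by exact: bmf_true_score.
have psi0 (G : R * Z -> R) : bmf G -> \int[P]_w (G (W w) * psi w) = 0.
  move=> bG; rewrite (Ex_cond_indep_gen acP mV mV' dk dk' indep bG (bmf_score hphi l)).
  by have [_ _ -> _ _] := hphi; rewrite mulr0.
have berr i : bmf (err k i : n.-tuple obsT -> R) by exact: bmf_score_err.
have depD i (s s' : n.-tuple obsT) : (forall j, W (tnth s j) = W (tnth s' j)) ->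
    err k i s = err k i s'.
  move=> ss'; have cs : coord_sample V s = coord_sample V s'.
    by apply: eq_from_tnth => j; rewrite !tnth_map; exact: ss'.
  have [v2 z2] : V (tnth s i) = V (tnth s' i) /\ (tnth s i).2 = (tnth s' i).2.
    by have [] := ss' i.
  by rewrite /score_err /est_rank /true_rank cs v2 z2.
rewrite (Ex_iid_sum_sqr mmk mkK bpsi psi0 berr depD).
set E := large_err _ _ _ _ _ in Edl.
have mE : measurable E by exact: measurable_large_err.
have b1 : bmf (\1_E : n.-tuple obsT -> R) by exact: bmf_indic.
rewrite (_ : n%:R * _ = \sum_(i < n) (L ^+ 2 * (t ^+ 2 + 4 * L ^+ 2 * dl))); last first.
  by rewrite sumr_const card_ord -[RHS]mulr_natl.
apply: ler_sum => i _.
pose dom s := L ^+ 2 * (t ^+ 2 + 4 * L ^+ 2 * \1_E s).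
have bdom : bmf dom by apply: bmfZ; apply: bmfD; [exact: bmf_cst|exact: bmfZ].
apply: (@le_trans _ _ (\int[iid_law P n]_s dom s)); last first.
  rewrite /dom ExZ; last by apply: bmfD; [exact: bmf_cst|exact: bmfZ].
  rewrite ExD; [|exact: bmf_cst|exact: bmfZ].
  rewrite (Ex_cst _ (t ^+ 2)) ExZ// Ex_indic//.
  apply: ler_wpM2l; first exact: sqr_ge0.
  rewrite lerD2l; apply: ler_wpM2l; first by rewrite mulr_ge0 ?sqr_ge0.
  rewrite -lee_fin fineK//; exact: fin_num_measure.
apply: Ex_le => //.
  by apply: bmfM; apply: bmf_exp; [exact: berr|exact: (bmf_tnth i bpsi)].
move=> s; rewrite /dom mulrC; apply: ler_pM; rewrite ?sqr_ge0//.
  rewrite -(real_normK (num_real (psi _))); apply: lerXn2r; rewrite ?nnegrE//.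
  exact: phiL.
rewrite -(real_normK (num_real (err k i s))) indicE.
case: (boolP (s \in E)) => [sE|/negP sE].
  apply: (@le_trans _ _ ((2 * L) ^+ 2)).
    by apply: lerXn2r; rewrite ?nnegrE ?mulr_ge0//; exact: score_err_bound.
  by rewrite mulr1 exprMn (_ : 2 ^+ 2 = 4) ?lerDr ?sqr_ge0//; rewrite expr2; ring.
rewrite mulr0 addr0; apply: lerXn2r; rewrite ?nnegrE//.
by rewrite leNgt; apply/negP => h; apply: sE; rewrite inE; exists (i, k).
Qed.

End one_coordinate.
End stochastic_bounds.

Section uniform_limits.
Context {R : realType} (T : Type).

Lemma nng_sup_cvg0 (M : set T) (Y : T -> nat -> \bar R) :
  (forall e : R, 0 < e -> exists n0, forall n, (n0 <= n)%N ->
     forall P, M P -> (Y P n <= e%:E)%E) ->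
  nng_sup [set Y P n | P in M] @[n --> \oo] --> 0%E.
Proof.
move=> H.
have sup0 n : (0 <= nng_sup [set Y P n | P in M])%E.
  by apply: ereal_sup_ubound; left.
have sup_le e : 0 < e -> \forall n \near \oo, (nng_sup [set Y P n | P in M] <= e%:E)%E.
  move=> e0; have [n0 h] := H e e0; exists n0 => // n /= n0n.
  apply: ge_ereal_sup => _ [->|[P MP <-]]; first by rewrite lee_fin ltW.
  exact: h.
have fin e n : (nng_sup [set Y P n | P in M] <= e%:E)%E ->
    nng_sup [set Y P n | P in M] \is a fin_num.
  by move=> h; rewrite ge0_fin_numE//; exact: le_lt_trans h (ltry _).
apply/fine_cvgP; split.
  by have := sup_le 1 ltr01; apply: filterS => n; exact: fin.
apply/cvgrPdist_le => e e0; have := sup_le e e0; apply: filterS => n h.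
rewrite /= sub0r normrN ger0_norm ?fine_ge0//.
by rewrite -lee_fin fineK//; exact: fin h.
Qed.

End uniform_limits.

(** * The statistic under one law *)

Section statistic.
Context {R : realType} (d q : nat) (phi : 'I_q -> R -> R).
Hypothesis hphi : score_functions phi.
Local Notation Z := (d.-tuple R).
Local Notation obsT := (obs R d).
Variable L : R.
Hypotheses (L0 : 0 <= L) (lip : forall k u v, `|phi k u - phi k v| <= L * `|u - v|)
  (phiL : forall k u, `|phi k u| <= L).
Variables (FX FY : forall n, n.-tuple (R * Z) -> R -> Z -> R).
Hypotheses (hFX : estimator FX) (hFY : estimator FY).

Local Notation X := (@xcoord R d).
Local Notation Y := (@ycoord R d).
Let mX := @measurable_xcoord R d.
Let mY := @measurable_ycoord R d.

Lemma xcoord01 w : unit_obs w -> X w \in `[0, 1]. Proof. by case. Qed.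
Lemma ycoord01 w : unit_obs w -> Y w \in `[0, 1]. Proof. by case. Qed.

(** These complete (x, z), respectively (y, z), to an observation; the value of
    the missing coordinate is immaterial. *)
Definition with_x (p : R * Z) : obsT := ((p.1, 0), p.2).
Definition with_y (p : R * Z) : obsT := ((0, p.1), p.2).

Lemma measurable_with_x : measurable_fun setT with_x.
Proof.
apply: measurable_fun_pair; last exact: measurable_snd.
by apply: measurable_fun_pair; [exact: measurable_fst|exact: measurable_cst].
Qed.

Lemma measurable_with_y : measurable_fun setT with_y.
Proof.
apply: measurable_fun_pair; last exact: measurable_snd.
by apply: measurable_fun_pair; [exact: measurable_cst|exact: measurable_fst].
Qed.

Lemma rho_hatE n (s : n.-tuple obsT) k l : rho_hat FX FY phi s k l =
  n%:R^-1 * \sum_(i < n) phi k (est_rank X FX i s) * phi l (est_rank Y FY i s).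
Proof. by rewrite mxE. Qed.

Lemma bmf_rho_hat n k l : bmf (fun s : n.-tuple obsT => rho_hat FX FY phi s k l).
Proof.
rewrite (_ : (fun s => _) = fun s : n.-tuple obsT =>
  n%:R^-1 * \sum_(i < n) phi k (est_rank X FX i s) * phi l (est_rank Y FY i s)).
  apply: bmfZ; apply: bmf_sum => i.
  exact: bmfM (bmf_est_score hphi mX hFX i k) (bmf_est_score hphi mY hFY i l).
by apply/funext => s; rewrite rho_hatE.
Qed.

Section one_law.
Variables (kX kY : R.-pker Z ~> R) (P : probability obsT R).
Local Notation tx := (true_rank X kX).
Local Notation ty := (true_rank Y kY).
Local Notation ex := (score_err phi X FX kX).
Local Notation ey := (score_err phi Y FY kY).

Definition score_mx (w : obsT) : 'M[R]_q := \matrix_(k, l) (phi k (tx w) * phi l (ty w)).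

Lemma bmf_score_mx k l : bmf (fun w => phi k (tx w) * phi l (ty w)).
Proof. exact: bmfM (bmf_true_score hphi mX kX k) (bmf_true_score hphi mY kY l). Qed.

Lemma score_mx_le w k l : `|phi k (tx w) * phi l (ty w)| <= L ^+ 2.
Proof. by rewrite normrM expr2 ler_pM. Qed.

Lemma product_error n (s : n.-tuple obsT) i k l :
  phi k (est_rank X FX i s) * phi l (est_rank Y FY i s) =
  phi k (tx (tnth s i)) * phi l (ty (tnth s i)) +
  (ex k i s * phi l (ty (tnth s i)) + ey l i s * phi k (tx (tnth s i)) +
   ex k i s * ey l i s).
Proof. by rewrite /score_err; ring. Qed.

(** Off the events of a large error, the statistic is within e / 2 of the oracle
    average, to which Chebyshev's inequality applies. *)
Lemma rho_hat_prob n (tX tY dl e : R) k l : 0 < e -> (0 < n)%N ->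
  (iid_law P n (large_err phi X FX kX tX) <= dl%:E)%E ->
  (iid_law P n (large_err phi Y FY kY tY) <= dl%:E)%E ->
  L * (tX + tY) <= e / 2 ->
  (iid_law P n [set s | e < `|rho_hat FX FY phi s k l - rho kX kY phi P k l|]%R <=
    (2 * dl + 16 * L ^+ 4 / (n%:R * e ^+ 2))%:E)%E.
Proof.
move=> e0 n0 PX PY Lte.
have nR : 0 < n%:R :> R by rewrite ltr0n.
pose r := rho kX kY phi P k l.
have rE : r = \int[P]_w (phi k (tx w) * phi l (ty w)) by rewrite /r mxE.
pose f w := phi k (tx w) * phi l (ty w) - r.
have bkl := bmf_score_mx k l.
have bf : bmf f by apply: bmfB => //; exact: bmf_cst.
have Ef : \int[P]_w f w = 0.
  by rewrite ExB//; [rewrite (Ex_cst P r) rE subrr|exact: bmf_cst].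
have rL : `|r| <= L ^+ 2 by rewrite rE; apply: Ex_bound => // w; exact: score_mx_le.
have fL w : `|f w| <= 2 * L ^+ 2.
  by rewrite mulr2n mulrDl mul1r (le_trans (ler_normB _ _))// lerD// score_mx_le.
have w0 : obsT := ((0, 0), [tuple of nseq d 0]).
pose sumf (s : n.-tuple obsT) := \sum_(i < n) f (tnth s i).
have bsum : bmf sumf by apply: bmf_sum => i; exact: (bmf_tnth i bf).
have ne0 : 0 < n%:R * (e / 2) by rewrite mulr_gt0// divr_gt0.
pose C := [set s | n%:R * (e / 2) < `|sumf s|].
have PC : (iid_law P n C <= (16 * L ^+ 4 / (n%:R * e ^+ 2))%:E)%E.
  apply: le_trans (markov_sqr (iid_law P n) ne0 bsum) _; rewrite lee_fin.
  rewrite ler_pdivrMr ?exprn_gt0//.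
  apply: le_trans (Ex_iid_sum_sqr_le n w0 bf Ef fL) _.
  by rewrite le_eqVlt; apply/orP; left; apply/eqP; field; rewrite !gt_eqF.
set EX := large_err _ _ _ _ _ in PX; set EY := large_err _ _ _ _ _ in PY.
have mEX : measurable EX by exact: measurable_large_err.
have mEY : measurable EY by exact: measurable_large_err.
have mC : measurable C by exact: measurable_tail.
set D := [set s | _].
have mD : measurable D.
  apply: (measurable_tail e (f := fun s : n.-tuple obsT => rho_hat FX FY phi s k l - r)).
  by apply: bmfB; [exact: bmf_rho_hat|exact: bmf_cst].
have DE : D `<=` (EX `|` EY) `|` C.
  move=> s Ds; have [|nE] := pselect ((EX `|` EY) s); [by left|right].
  have eX i : `|ex k i s| <= tX.
    by rewrite leNgt; apply/negP => h; apply: nE; left; exists (i, k).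
  have eY i : `|ey l i s| <= tY.
    by rewrite leNgt; apply/negP => h; apply: nE; right; exists (i, l).
  rewrite /C/= ltNge; apply/negP => sC; move: Ds; rewrite /D/= ltNge => /negP; apply.
  have -> : rho_hat FX FY phi s k l - r = n%:R^-1 * (sumf s +
      \sum_(i < n) (phi k (est_rank X FX i s) * phi l (est_rank Y FY i s) -
        phi k (tx (tnth s i)) * phi l (ty (tnth s i)))).
    rewrite rho_hatE /sumf -big_split/=.
    rewrite [in RHS](eq_bigr (fun i =>
      phi k (est_rank X FX i s) * phi l (est_rank Y FY i s) - r)); last first.
      by move=> i _; rewrite /f; ring.
    rewrite sumrB sumr_const card_ord mulrBr -[r *+ n]mulr_natl mulrA mulVf ?gt_eqF//.
    by rewrite mul1r.
  rewrite normrM ger0_norm ?invr_ge0 ?ler0n// ler_pdivrMl//.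
  apply: le_trans (ler_normD _ _) _.
  rewrite (_ : n%:R * e = n%:R * (e / 2) + \sum_(i < n) (e / 2)); last first.
    by rewrite sumr_const card_ord -[X in _ + X]mulr_natl -mulrDr; congr (_ * _); field.
  apply: lerD => //; apply: le_trans (ler_norm_sum _ _ _) _; apply: ler_sum => i _.
  apply: le_trans Lte.
  rewrite (_ : _ - _ = ex k i s * phi l (est_rank Y FY i s) +
    phi k (tx (tnth s i)) * ey l i s); last by rewrite /score_err; ring.
  apply: le_trans (ler_normD _ _) _; rewrite (_ : L * (tX + tY) = tX * L + L * tY); last by ring.
  by apply: lerD; rewrite normrM ler_pM.
apply: le_trans (le_measure _ _ _ DE) _; rewrite ?inE//.
  by apply: measurableU => //; exact: measurableU.
apply: le_trans (measureU2 _ (measurableU _ _ mEX mEY) mC) _.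
rewrite EFinD; apply: leeD => //.
apply: le_trans (measureU2 _ mEX mEY) _.
by rewrite mulr2n mulrDl mul1r EFinD; exact: leeD.
Qed.

Hypothesis acP : abs_cont_laws P.
Hypotheses (dkX : cond_dist P X kX) (dkY : cond_dist P Y kY).
Hypothesis ciP : cond_indep_laws P.

(** The two terms of [product_error] that are linear in one error are small in
    the second moment by [cross_term_sqr]; this is the only place where
    conditional independence is used on the estimated scores. The product of
    the errors is bounded off the events of a large error. *)
Lemma remainder_prob n (tX tY dl e : R) k l : 0 <= tX -> 0 <= tY -> 0 < e -> (0 < n)%N ->
  (iid_law P n (large_err phi X FX kX tX) <= dl%:E)%E ->
  (iid_law P n (large_err phi Y FY kY tY) <= dl%:E)%E ->
  Num.sqrt n%:R * (tX * tY) <= e / 3 ->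
  (iid_law P n [set s | e < `|(Num.sqrt n%:R *: rho_hat FX FY phi s -
       (Num.sqrt n%:R)^-1 *: \sum_(i < n) score_mx (tnth s i)) k l|]%R <=
    (9 * L ^+ 2 / e ^+ 2 * (tX ^+ 2 + tY ^+ 2 + 8 * L ^+ 2 * dl) + 2 * dl)%:E)%E.
Proof.
move=> tX0 tY0 e0 n0 PX PY tXY.
have nR : 0 < n%:R :> R by rewrite ltr0n.
set r := Num.sqrt n%:R in tXY *; have r0 : 0 < r by rewrite sqrtr_gt0.
have r2 : r ^+ 2 = n%:R by rewrite sqr_sqrtr ?ler0n.
pose bX (s : n.-tuple obsT) := \sum_(i < n) ex k i s * phi l (ty (tnth s i)).
pose bY (s : n.-tuple obsT) := \sum_(i < n) ey l i s * phi k (tx (tnth s i)).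
pose bXY (s : n.-tuple obsT) := \sum_(i < n) ex k i s * ey l i s.
have bbX : bmf bX.
  apply: bmf_sum => i; apply: bmfM; first exact: (bmf_score_err hphi mX hFX kX k i).
  exact: (bmf_tnth i (bmf_true_score hphi mY kY l)).
have bbY : bmf bY.
  apply: bmf_sum => i; apply: bmfM; first exact: (bmf_score_err hphi mY hFY kY l i).
  exact: (bmf_tnth i (bmf_true_score hphi mX kX k)).
have EbX := cross_term_sqr hphi L0 phiL mX hFX mY acP dkX dkY ciP
  measurable_with_x (fun p => let: (x, z) := p in erefl) k l tX0 PX.
have EbY := cross_term_sqr hphi L0 phiL mY hFY mX acP dkY dkX
  (fun A B mA mB p r hp hr => cond_indep_swap mA mB ciP hp hr)
  measurable_with_y (fun p => let: (x, z) := p in erefl) l k tY0 PY.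
have re0 : 0 < r * (e / 3) by rewrite mulr_gt0// divr_gt0.
have tail (b : n.-tuple obsT -> R) (t : R) : bmf b ->
    \int[iid_law P n]_s (b s ^+ 2) <= n%:R * (L ^+ 2 * (t ^+ 2 + 4 * L ^+ 2 * dl)) ->
    (iid_law P n [set s | r * (e / 3) < `|b s|]%R <=
      (9 * L ^+ 2 / e ^+ 2 * (t ^+ 2 + 4 * L ^+ 2 * dl))%:E)%E.
  move=> bb Eb; apply: le_trans (markov_sqr (iid_law P n) re0 bb) _; rewrite lee_fin.
  rewrite ler_pdivrMr ?exprn_gt0//; apply: le_trans Eb _.
  rewrite exprMn r2 le_eqVlt; apply/orP; left; apply/eqP; field.
  by rewrite gt_eqF.
pose CX := [set s | r * (e / 3) < `|bX s|]; pose CY := [set s | r * (e / 3) < `|bY s|].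
have PCX := tail bX tX bbX EbX; have PCY := tail bY tY bbY EbY.
have mCX := measurable_tail (r * (e / 3)) bbX.
have mCY := measurable_tail (r * (e / 3)) bbY.
set EX := large_err _ _ _ _ _ in PX; set EY := large_err _ _ _ _ _ in PY.
have mEX : measurable EX by exact: measurable_large_err.
have mEY : measurable EY by exact: measurable_large_err.
have diffE (s : n.-tuple obsT) : (r *: rho_hat FX FY phi s -
     r^-1 *: \sum_(i < n) score_mx (tnth s i)) k l = r^-1 * (bX s + bY s + bXY s).
  have -> : (r *: rho_hat FX FY phi s - r^-1 *: \sum_(i < n) score_mx (tnth s i)) k l =
      r * rho_hat FX FY phi s k l -
      r^-1 * \sum_(i < n) phi k (tx (tnth s i)) * phi l (ty (tnth s i)).
    rewrite !mxE summxE; congr (_ - _ * _).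
    by apply: eq_bigr => i _; rewrite mxE.
  rewrite rho_hatE; under eq_bigr do rewrite product_error.
  rewrite /bX /bY /bXY !big_split/= mulrA.
  rewrite (_ : r * n%:R^-1 = r^-1); last by rewrite -r2; field; rewrite gt_eqF.
  by rewrite -mulrBr; congr (_ * _); rewrite [LHS]addrAC subrr add0r.
set D := [set s | _].
have mD : measurable D.
  rewrite /D; under eq_set do rewrite diffE.
  apply: (measurable_tail e (f := fun s => r^-1 * (bX s + bY s + bXY s))).
  apply: bmfZ; apply: bmfD; first exact: bmfD.
  apply: bmf_sum => i; apply: bmfM; first exact: (bmf_score_err hphi mX hFX kX k i).
  exact: (bmf_score_err hphi mY hFY kY l i).
have DE : D `<=` (CX `|` CY) `|` (EX `|` EY).
  move=> s Ds; have [|nE] := pselect ((EX `|` EY) s); [by right|left].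
  have eX i : `|ex k i s| <= tX.
    by rewrite leNgt; apply/negP => h; apply: nE; left; exists (i, k).
  have eY i : `|ey l i s| <= tY.
    by rewrite leNgt; apply/negP => h; apply: nE; right; exists (i, l).
  have XY : `|bXY s| <= r * (e / 3).
    apply: (@le_trans _ _ (\sum_(i < n) tX * tY)).
      apply: le_trans (ler_norm_sum _ _ _) _; apply: ler_sum => i _.
      by rewrite normrM ler_pM.
    rewrite sumr_const card_ord -[leLHS]mulr_natl -r2 expr2 -mulrA.
    by rewrite ler_wpM2l// ltW.
  have [?|/negP cx] := boolP (r * (e / 3) < `|bX s|); [by left|right].
  rewrite /CY/= ltNge; apply/negP => cy; move: Ds; rewrite /D/= diffE.
  rewrite normrM normfV (gtr0_norm r0) ltNge => /negP; apply.
  rewrite ler_pdivrMl// (_ : r * e = r * (e / 3) + r * (e / 3) + r * (e / 3)); last by field.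
  apply: le_trans (ler_normD _ _) _; apply: lerD => //.
  apply: le_trans (ler_normD _ _) _; apply: lerD => //.
  by rewrite leNgt; exact/negP.
apply: le_trans (le_measure _ _ _ DE) _; rewrite ?inE//.
  by apply: measurableU; exact: measurableU.
apply: le_trans (measureU2 _ (measurableU _ _ mCX mCY) (measurableU _ _ mEX mEY)) _.
rewrite EFinD; apply: leeD; last first.
  apply: le_trans (measureU2 _ mEX mEY) _.
  by rewrite mulr2n mulrDl mul1r EFinD; exact: leeD.
apply: le_trans (measureU2 _ mCX mCY) _.
rewrite (_ : tX ^+ 2 + _ + _ = (tX ^+ 2 + 4 * L ^+ 2 * dl) + (tY ^+ 2 + 4 * L ^+ 2 * dl)); last by ring.
by rewrite mulrDr EFinD; exact: leeD.
Qed.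

Lemma score_mean (k l : 'I_q) : \int[P]_w (phi k (tx w) * phi l (ty w)) = 0.
Proof.
have bG := bmf_comp measurable_with_x (bmf_true_score hphi mX kX k).
have := Ex_cond_indep_gen acP mX mY dkX dkY ciP bG (bmf_score hphi l).
move=> /= ->; have [_ _ -> _ _] := hphi; exact: mulr0.
Qed.

(** The products of scores of U1 and of scores of U2 are independent. *)
Lemma score_second_moment (k l s t : 'I_q) :
  \int[P]_w ((phi k (tx w) * phi l (ty w)) * (phi s (tx w) * phi t (ty w))) =
  score_cov phi k s * score_cov phi l t.
Proof.
have bks := bmfM (bmf_score hphi k) (bmf_score hphi s).
have blt := bmfM (bmf_score hphi l) (bmf_score hphi t).
have bG := bmf_comp measurable_with_x
  (bmfM (bmf_true_score hphi mX kX k) (bmf_true_score hphi mX kX s)).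
have E := Ex_cond_indep_gen acP mX mY dkX dkY ciP bG blt.
transitivity (\int[P]_w ((phi k (tx w) * phi s (tx w)) * (phi l (ty w) * phi t (ty w)))).
  by apply: eq_Rintegral => w _; ring.
transitivity (\int[P]_w (phi k (tx w) * phi s (tx w)) * score_cov phi l t).
  exact: E.
by congr (_ * _); exact: (Ex_cond_cdf acP mX dkX bks).
Qed.

End one_law.
End statistic.

(** * Uniform limits *)

Section asymptotics.
Context {R : realType}.

Lemma eventually_le (u : nat -> R) (e : R) : u n @[n --> \oo] --> (0 : R) -> 0 < e ->
  exists n0, forall n, (n0 <= n)%N -> `|u n| <= e.
Proof.
move=> /cvgrPdist_le u0 e0; have [n0 _ h] := u0 e e0.
by exists n0 => n n0n; have := h n n0n; rewrite /= sub0r normrN.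
Qed.

Lemma cvg0M (c : R) (u : nat -> R) : u n @[n --> \oo] --> (0 : R) ->
  c * u n @[n --> \oo] --> (0 : R).
Proof. by move=> u0; rewrite -[X in _ --> X](mulr0 c); apply: cvgM => //; exact: cvg_cst. Qed.

Lemma cvg0_norm (u : nat -> R) : u n @[n --> \oo] --> (0 : R) ->
  `|u n| @[n --> \oo] --> (0 : R).
Proof. by move=> u0; rewrite -[X in _ --> X](normr0 R); exact: cvg_norm. Qed.

Lemma measure_bigsetU_le d (T : measurableType d) (P : probability T R) (I : Type)
    (r : seq I) (A : I -> set T) (c : R) :
  (forall i, measurable (A i)) -> (forall i, P (A i) <= c%:E)%E ->
  (P (\big[setU/set0]_(i <- r) A i) <= ((size r)%:R * c)%:E)%E.
Proof.
move=> mA PA; elim: r => [|i r IH]; first by rewrite big_nil measure0 mul0r.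
rewrite big_cons; apply: le_trans (measureU2 _ (mA i) _) _.
  exact: bigsetU_measurable.
by rewrite /= -natr1 mulrDl mul1r addrC EFinD; apply: leeD.
Qed.

Lemma mx_norm_tail d (T : measurableType d) (P : probability T R) q
    (W : T -> 'M[R]_q) (e : R) : 0 < e ->
  (forall k l, bmf (fun t => W t k l)) ->
  (forall k l, P [set t | e / (entry_count q + 1) < `|W t k l|]%R <=
     (e / (entry_count q + 1))%:E)%E ->
  (P [set t | e < `|W t|]%R <= e%:E)%E.
Proof.
move=> e0 bW PW; set e' := e / _ in PW.
have N0 : 0 <= entry_count q :> R by rewrite /entry_count ler0n.
have N1 : 0 < entry_count q + 1 :> R by rewrite ltr_wpDl.
have e'0 : 0 < e' by rewrite divr_gt0.
have e'e : e' <= e by rewrite ler_pdivrMr// ler_peMr ?(ltW e0)// lerDr.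
pose A (p : 'I_q * 'I_q) := [set t | e' < `|W t p.1 p.2|].
have mA p : measurable (A p) by exact: measurable_tail.
pose r := index_enum ('I_q * 'I_q)%type.
have sub : [set t | e < `|W t|] `<=` \big[setU/set0]_(p <- r) A p.
  move=> t /= eW; rewrite -bigcup_seq.
  have [//|h] := pselect ((\bigcup_(p in [set` r]) A p) t).
  move: eW; rewrite ltNge => /negP[]; apply: le_trans e'e.
  apply: mx_norm_le; first exact: ltW.
  move=> k l; rewrite leNgt; apply/negP => kl; apply: h.
  by exists (k, l) => //=; rewrite mem_index_enum.
have mD : measurable [set t | e < `|W t|].
  have mN : measurable_fun setT (fun t => `|W t|).
    apply: (@measurable_cont_comp _ _ _ _ W (fun x => `|x|)); first exact: norm_continuous.
    by move=> k l; exact: bmf_meas.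
  exact: measurable_gt.
apply: le_trans (le_measure _ _ _ sub) _; rewrite ?inE//; first exact: bigsetU_measurable.
have PA p : (P (A p) <= e'%:E)%E by exact: PW.
have PU : (P (\big[setU/set0]_(p <- r) A p) <= ((size r)%:R * e')%:E)%E.
  exact: measure_bigsetU_le.
apply: (le_trans PU).
rewrite lee_fin (_ : (size r)%:R = entry_count q :> R); last first.
  by rewrite /entry_count -sum1_size -sum1_card.
rewrite /e' mulrCA -[leRHS]mulr1; apply: ler_wpM2l; first exact: ltW.
by rewrite ler_pdivrMr// mul1r lerDl.
Qed.

End asymptotics.

Section main_proof.
Context {R : realType} (d q : nat) (phi : 'I_q -> R -> R).
Hypotheses (hq : (0 < q)%N) (hphi : score_functions phi).
Variables (P0 : set (probability (obs R d) R)) (hP0 : P0 `<=` @abs_cont_laws R d).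
Variables (kX kY : probability (obs R d) R -> R.-pker (d.-tuple R) ~> R).
Hypotheses (hkX : forall P, P0 P -> cond_dist P (@xcoord R d) (kX P))
  (hkY : forall P, P0 P -> cond_dist P (@ycoord R d) (kY P)).
Variables (FX FY : forall n, n.-tuple (R * d.-tuple R) -> R -> d.-tuple R -> R).
Hypotheses (hFX : estimator FX) (hFY : estimator FY).
Variables (g h : nat -> R).
Hypotheses (hg : g n @[n --> \oo] --> (0 : R)) (hh : h n @[n --> \oo] --> (0 : R)).
Variable L : R.
Hypotheses (L0 : 0 <= L) (phiL : forall k u, `|phi k u| <= L).

Let tX B n := L * (B * `|g n|).
Let tY B n := L * (B * `|h n|).

Hypothesis errX : forall dl, 0 < dl -> exists2 B, 0 < B & forall P n, P0 P -> (0 < n)%N ->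
  (iid_law P n (large_err phi (@xcoord R d) FX (kX P) (tX B n)) <= dl%:E)%E.
Hypothesis errY : forall dl, 0 < dl -> exists2 B, 0 < B & forall P n, P0 P -> (0 < n)%N ->
  (iid_law P n (large_err phi (@ycoord R d) FY (kY P) (tY B n)) <= dl%:E)%E.

Let tX0 B n : 0 < B -> 0 <= tX B n.
Proof. by move=> B0; rewrite /tX !mulr_ge0// ltW. Qed.

Let tY0 B n : 0 < B -> 0 <= tY B n.
Proof. by move=> B0; rewrite /tY !mulr_ge0// ltW. Qed.

Let tX_cvg B : tX B n @[n --> \oo] --> (0 : R).
Proof. by apply: cvg0M; apply: cvg0M; exact: cvg0_norm. Qed.

Let tY_cvg B : tY B n @[n --> \oo] --> (0 : R).
Proof. by apply: cvg0M; apply: cvg0M; exact: cvg0_norm. Qed.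

Lemma rho_hat_consistent : unif_cvg_prob P0 (fun n s => rho_hat FX FY phi s)
  (fun P => rho (kX P) (kY P) phi P).
Proof.
move=> k l eps eps0; apply: nng_sup_cvg0 => e e0.
have e4 : 0 < e / 4 by rewrite divr_gt0.
have [BX BX0 PX] := errX e4; have [BY BY0 PY] := errY e4.
have [n1 h1] : exists n0, forall n, (n0 <= n)%N -> `|L * (tX BX n + tY BY n)| <= eps / 2.
  apply: eventually_le; last by rewrite divr_gt0.
  by apply: cvg0M; rewrite -[X in _ --> X](addr0 0); apply: cvgD.
pose n2 := Num.bound (16 * L ^+ 4 / eps ^+ 2 / (e / 2)).
exists (maxn 1 (maxn n1 n2)) => n; rewrite !geq_max => /and3P[n0 n1n n2n] P PP.
rewrite measurable_mu_extE; last first.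
  apply: (measurable_tail eps
    (f := fun s : n.-tuple (obs R d) => rho_hat FX FY phi s k l - rho (kX P) (kY P) phi P k l)).
  by apply: bmfB; [exact: bmf_rho_hat|exact: bmf_cst].
apply: le_trans (rho_hat_prob hphi phiL hFX hFY k l eps0 n0 (PX P n PP n0) (PY P n PP n0) _) _.
  exact: le_trans (ler_norm _) (h1 n n1n).
have nR : 0 < n%:R :> R by rewrite ltr0n.
rewrite lee_fin [leRHS](_ : e = 2 * (e / 4) + e / 2); last by field.
have e2 : 0 < e / 2 by rewrite divr_gt0.
have hn : 16 * L ^+ 4 / eps ^+ 2 / (e / 2) <= n%:R.
  apply: le_trans (ltW (archi_boundP _)) _; last by rewrite ler_nat.
  by apply: divr_ge0 (ltW e2); apply: divr_ge0; [apply: mulr_ge0|]; rewrite ?exprn_ge0// ltW.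
rewrite lerD2l ler_pdivrMr ?mulr_gt0 ?exprn_gt0//.
move: hn; rewrite !ler_pdivrMr ?exprn_gt0//.
rewrite [X in _ -> _ <= X](_ : _ = n%:R * (e / 2) * eps ^+ 2) //; ring.
Qed.

Lemma rho_hat_asymptotically_normal :
  Num.sqrt n%:R * g n * h n @[n --> \oo] --> (0 : R) ->
  exists2 nu : probability (borel_mx R q) R,
    centered_gaussian nu (fun k l s t => score_cov phi k s * score_cov phi l t)
    & unif_cvg_law (P0 `&` @cond_indep_laws R d)
        (fun n s => Num.sqrt n%:R *: rho_hat FX FY phi s) nu.
Proof.
move=> rate; have [A AS] := score_cov_factor hphi.
exists (gauss_mx A).
  rewrite (_ : (fun k l s t => _) = fun k l s t => (A *m A^T) k s * (A *m A^T) l t).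
    exact: gauss_mx_centered.
  by apply/funext => k; apply/funext => l; apply/funext => s; apply/funext => t; rewrite !AS.
move=> f cf [B fB]; apply: nng_sup_cvg0 => e e0.
pose w0 : obs R d := ((0, 0), [tuple of nseq d 0]).
have [eta eta0 [n1 clt]] := uniform_clt A w0 cf fB (sqr_ge0 L) e0.
have N1 : 0 < entry_count q + 1 :> R by rewrite ltr_wpDl// /entry_count ler0n.
set eta' := eta / (entry_count q + 1).
have eta'0 : 0 < eta' by rewrite divr_gt0.
pose kap := 9 * L ^+ 2 / eta' ^+ 2.
have kap0 : 0 <= kap by apply: divr_ge0; [apply: mulr_ge0|]; rewrite ?sqr_ge0.
(* D dl is the part of the bound of [remainder_prob] due to the probability of
   large errors; dl makes it eta' / 2 *)
pose D := kap * (8 * L ^+ 2) + 2.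
have D0 : 0 < D.
  by rewrite ltr_wpDl//; apply: mulr_ge0 => //; apply: mulr_ge0; rewrite ?sqr_ge0.
pose dl := eta' / 2 / D; have dl0 : 0 < dl by rewrite !divr_gt0.
have [BX BX0 PX] := errX dl0; have [BY BY0 PY] := errY dl0.
have sqr_cvg (u : nat -> R) : u n @[n --> \oo] --> (0 : R) -> u n ^+ 2 @[n --> \oo] --> (0 : R).
  by move=> u0; rewrite -[X in _ --> X](mulr0 0); under eq_fun do rewrite expr2; exact: cvgM.
have [n2 h2] : exists n0, forall n, (n0 <= n)%N ->
    `|kap * (tX BX n ^+ 2 + tY BY n ^+ 2)| <= eta' / 2.
  apply: eventually_le; last by rewrite divr_gt0.
  by apply: cvg0M; rewrite -[X in _ --> X](addr0 0); apply: cvgD; exact: sqr_cvg.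
have [n3 h3] : exists n0, forall n, (n0 <= n)%N ->
    `|(L ^+ 2 * (BX * BY)) * `|Num.sqrt n%:R * g n * h n| | <= eta' / 3.
  apply: eventually_le; last by rewrite divr_gt0.
  by apply: cvg0M; exact: cvg0_norm.
exists (maxn (maxn 1 n1) (maxn n2 n3)) => n; rewrite !geq_max.
move=> /andP[/andP[n0 n1n] /andP[n2n n3n]] P [PP ciP].
have acP := hP0 PP; have dkX := hkX PP; have dkY := hkY PP.
pose X (s : n.-tuple (obs R d)) : 'M[R]_q := Num.sqrt n%:R *: rho_hat FX FY phi s.
have bX k l : bmf (fun s => X s k l).
  under eq_fun do rewrite mxE; apply: bmfZ; exact: bmf_rho_hat.
pose V := score_mx phi (kX P) (kY P).
have VE w k l : V w k l = phi k (true_rank (@xcoord R d) (kX P) w) *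
    phi l (true_rank (@ycoord R d) (kY P) w) by rewrite mxE.
have bV k l : bmf (fun w => V w k l).
  under eq_fun do rewrite VE; exact: bmf_score_mx.
have {}clt : `|\int[iid_law P n]_s f (X s) -
    \int[iid_law (@gauss1 R) (q * q)]_t f (gmx A t)| <= e.
  apply: (clt P V) => //.
  - by move=> k l; exact: bmf_meas.
  - by move=> w k l; rewrite VE; exact: score_mx_le.
  - by move=> p; under eq_Rintegral do rewrite VE; exact: score_mean.
  - move=> p p'; under eq_Rintegral do rewrite !VE.
    by rewrite /kron_cov !AS; exact: score_second_moment.
  - by move=> k l; exact: bmf_meas.
  apply: mx_norm_tail => // k l.
    under eq_fun do rewrite mxE.
    apply: bmfD; first exact: bX.
    under eq_fun do rewrite mxE mxE summxE.
    by apply: bmfN; apply: bmfZ; apply: bmf_sum => i; exact: (bmf_tnth i (bV k l)).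
  apply: le_trans (remainder_prob hphi L0 phiL hFX hFY acP dkX dkY ciP k l
    (tX0 n BX0) (tY0 n BY0) eta'0 n0 (PX P n PP n0) (PY P n PP n0) _) _.
    have := h3 n n3n; rewrite ger0_norm; last by do ?apply: mulr_ge0; rewrite ?sqr_ge0 ?(ltW BX0) ?(ltW BY0).
    rewrite !normrM (ger0_norm (sqrtr_ge0 _)); apply: le_trans.
    by rewrite /tX /tY le_eqVlt; apply/orP; left; apply/eqP; ring.
  rewrite lee_fin -/kap -/eta'.
  have := le_trans (ler_norm _) (h2 n n2n).
  have -> : kap * (tX BX n ^+ 2 + tY BY n ^+ 2 + 8 * L ^+ 2 * dl) + 2 * dl =
    kap * (tX BX n ^+ 2 + tY BY n ^+ 2) + D * dl by rewrite /D; ring.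
  have -> : D * dl = eta' / 2 by rewrite /dl mulrC divfK// gt_eqF.
  by move=> hk; rewrite [leRHS](_ : _ = eta' / 2 + eta' / 2) ?lerD2r//; field.
have bfX : bmf (fun s => f (X s)).
  by apply: bmf_cont_comp => //; [exists B|move=> k l; exact: bmf_meas].
have bfg : bmf (fun t => f (gmx A t)).
  by apply: bmf_cont_comp => //; [exists B|exact: measurable_gmx_entry].
rewrite (integral_gauss_mx (measurable_cont_mx cf) (bmf_integrable _ bfg)).
by rewrite -(EFin_Ex (bmf_integrable (iid_law P n) bfX)) -EFinB abse_EFin lee_fin.
Qed.

End main_proof.

Theorem theorem21 (R : realType) (d q : nat) (hq : (0 < q)%N)
  (phi : 'I_q -> R -> R) (hphi : score_functions phi)
  (P0 : set (probability (obs R d) R)) (hP0 : P0 `<=` @abs_cont_laws R d)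
  (kX kY : probability (obs R d) R -> R.-pker (d.-tuple R) ~> R)
  (hkX : forall P, P0 P -> cond_dist P (fun w => w.1.1) (kX P))
  (hkY : forall P, P0 P -> cond_dist P (fun w => w.1.2) (kY P))
  (FX FY : forall n, n.-tuple (R * d.-tuple R) -> R -> d.-tuple R -> R)
  (hFX : estimator FX) (hFY : estimator FY)
  (g h : nat -> R)
  (hg : g n @[n --> \oo] --> (0 : R)) (hh : h n @[n --> \oo] --> (0 : R))
  (xi xi' : R -> d.-tuple R -> R)
  (haX : unif_bigO P0 (fun P n s =>
     sup_norm_on (quantile_range (kX P) (tau_min phi) (tau_max phi))
       (fun t z => cond_cdf (kX P) t z - FX n (xz_sample s) t z)) g)
  (haY : unif_bigO P0 (fun P n s =>
     sup_norm_on (quantile_range (kY P) (tau_min phi) (tau_max phi))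
       (fun t z => cond_cdf (kY P) t z - FY n (yz_sample s) t z)) h)
  (hbX : unif_bigO P0 (fun P n s =>
     sup_norm_on (quantile_range_compl (kX P) (tau_min phi) (tau_max phi))
       (fun t z => xi t z - FX n (xz_sample s) t z)) g)
  (hbY : unif_bigO P0 (fun P n s =>
     sup_norm_on (quantile_range_compl (kY P) (tau_min phi) (tau_max phi))
       (fun t z => xi' t z - FY n (yz_sample s) t z)) h) :
  (Num.sqrt n%:R * g n * h n @[n --> \oo] --> (0 : R) ->
   exists2 nu : probability (borel_mx R q) R,
     centered_gaussian nu (fun k l s t => score_cov phi k s * score_cov phi l t)
     & unif_cvg_law (P0 `&` @cond_indep_laws R d)
         (fun n s => Num.sqrt n%:R *: rho_hat FX FY phi s) nu) /\
  unif_cvg_prob P0 (fun n s => rho_hat FX FY phi s)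
    (fun P => rho (kX P) (kY P) phi P).
Proof.
have [L L0 [lip phiL]] := score_lipschitz hphi.
have errX := large_err_prob hq hphi L0 lip (@measurable_xcoord R d) (@xcoord01 R d)
  hFX hP0 hkX haX.
have errY := large_err_prob hq hphi L0 lip (@measurable_ycoord R d) (@ycoord01 R d)
  hFY hP0 hkY haY.
split; last exact: (rho_hat_consistent hphi hFX hFY hg hh L0 phiL errX errY).
exact: (rho_hat_asymptotically_normal hphi hP0 hkX hkY hFX hFY hg hh L0 phiL errX errY).
Qed.
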